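(* Assume that for every $\varphi\in\mathcal D$ there exists $\widetilde A[\varphi]\in L^2(\mathbb P_Y)$ such that for all $\chi\in\mathcal D$ $$\lim_{n\to\infty}\alpha_n\mathbb E[(\varphi(Y_n)-\varphi(Y))(\chi(Y_n)-\chi(Y))]=-2\,\mathbb E_Y[\widetilde A[\varphi]\,\chi].$$ Then: (a) the limit $$\widetilde{\mathcal E}[\varphi,\chi]=\lim_n\frac{\alpha_n}{2}\mathbb E[(\varphi(Y_n)-\varphi(Y))(\chi(Y_n)-\chi(Y))],\qquad \varphi,\chi\in\mathcal D,$$ defines a closable positive bilinear form on $\mathcal D$ in $L^2(\mathbb P_Y)$; denote by $(\mathcal E,\mathbb D)$ its smallest closed extension; (b) $(\mathcal E,\mathbb D)$ is a Dirichlet form; (c) $(\mathcal E,\mathbb D)$ admits a square field operator $\Gamma$, and for all $\varphi,\chi\in\mathcal D$ $$\Gamma[\varphi]=\widetilde A[\varphi^2]-2\varphi\,\widetilde A[\varphi],$$ $$\mathbb E_Y[\Gamma[\varphi]\chi]=\lim_n\alpha_n\mathbb E\big[(\varphi(Y_n)-\varphi(Y))^2(\chi(Y_n)+\chi(Y))/2\big];$$ (d) $(\mathcal E,\mathbb D)$ is local if and only if for every $\varphi\in\mathcal D$ $$\lim_n\alpha_n\mathbb E[(\varphi(Y_n)-\varphi(Y))^4]=0.$$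
   Context: $Y$ and $Y_n$ ($n\in\mathbb N$) are random variables defined on the same probability space $(\Omega,\mathcal A,\mathbb P)$ with values in the same measurable space $(E,\mathcal F)$. $\mathbb P_Y$ is the law of $Y$ and $\mathbb E_Y$ denotes expectation (of functions on $E$) with respect to $\mathbb P_Y$. $\mathcal D$ is an algebra of bounded measurable functions from $E$ into $\mathbb R$ or $\mathbb C$, containing the constants and dense in $L^2(E,\mathcal F,\mathbb P_Y)$; $(\alpha_n)$ is a sequence of positive numbers. Convention in the complex case: $\mathcal D$ is stable under complex conjugation; positivity, closability, the Dirichlet property and locality refer to real-valued functions, and forms and square field operators of real functions are extended to complex functions bilinearly (not as Hermitian forms). Square field operator: a Dirichlet form $(\mathcal E,\mathbb D)$ on $L^2(\mathbb P_Y)$ admits a square field operator if for every $f\in\mathbb D\cap L^\infty$ there is $\Gamma[f]\in L^1(\mathbb P_Y)$ with $2\mathcal E[fh,f]-\mathcal E[h,f^2]=\mathbb E_Y[h\,\Gamma[f]]$ for all $h\in\mathbb D\cap L^\infty$; $\Gamma$ then extends to a continuous symmetric bilinear map $\mathbb D\times\mathbb D\to L^1(\mathbb P_Y)$, with $\Gamma[f]=\Gamma[f,f]$. Local: for every real $f\in\mathbb D$ and all $F,G\in C^\infty_c(\mathbb R)$ with disjoint supports, $\mathcal E[F(f)-F(0),G(f)-G(0)]=0$. *)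

(* Defs.v *)
From HB Require Import structures.
From mathcomp Require Import all_boot all_order all_algebra.
From mathcomp Require Import complex.
From mathcomp Require Import all_classical all_reals all_analysis.

Set Implicit Arguments.
Unset Strict Implicit.
Unset Printing Implicit Defensive.

Import Order.TTheory GRing.Theory Num.Theory.
Import numFieldNormedType.Exports.

Local Open Scope classical_set_scope.
Local Open Scope ring_scope.
Local Open Scope complex_scope.

(* Elements of L^2 are represented by measurable functions. A form on a
   subspace of L^2 is a set of representatives [dom] together with a total
   function whose values off [dom] carry no information; compatibility with
   almost-everywhere equality is required explicitly below. *)
Record bform (E : Type) (R : Type) := BForm {
  dom : set (E -> R);
  form_val :> (E -> R) -> (E -> R) -> R
}.

Section Forms.
Context d (E : measurableType d) (R : realType) (mu : probability E R).
Implicit Types (q : bform E R) (f g h : E -> R) (u v : nat -> E -> R).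

(* Closure under scalar multiplication follows from constants and products. *)
Definition bounded_algebra (K : numFieldType) (D : set (E -> K)) : Prop :=
  [/\ forall c : K, D (cst c),
      forall f g : E -> K, D f -> D g -> D (f \+ g),
      forall f g : E -> K, D f -> D g -> D (f \* g) &
      forall f : E -> K, D f -> exists M : K, forall x, `|f x| <= M].

Definition L2_dense (D : set (E -> R)) : Prop :=
  forall f, f \in Lfun mu 2%:E -> forall e : R, 0 < e ->
  exists2 g, D g & ('N[mu]_2%:E [EFin \o (f \- g)%R] < e%:E)%E.

Definition sym_bilinear_on (K : numFieldType) (D : set (E -> K))
    (b : (E -> K) -> (E -> K) -> K) : Prop :=
  [/\ forall f g : E -> K, D f -> D g -> b f g = b g f,
      forall (a : K) (f g h : E -> K), D f -> D g -> D h ->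
        b (a \*o f \+ g) h = a * b f h + b g h &
      forall f f' g : E -> K, D f -> D f' -> D g -> f = f' %[ae mu] -> b f g = b f' g].

Definition positive_form q : Prop :=
  [/\ forall f, dom q f -> f \in Lfun mu 2%:E,
      dom q (cst 0),
      forall (a : R) f g, dom q f -> dom q g -> dom q (a \*o f \+ g),
      sym_bilinear_on (dom q) q &
      forall f, dom q f -> 0 <= q f f].

Definition L2_cvg u f : Prop :=
  ('N[mu]_2%:E [EFin \o (u n \- f)%R])%E @[n --> \oo] --> 0%E.

Definition L2_cauchy u : Prop :=
  forall e : R, 0 < e ->
  \forall k & l \near \oo, ('N[mu]_2%:E [EFin \o (u k \- u l)%R] < e%:E)%E.

Definition form_cauchy q u : Prop :=
  forall e : R, 0 < e ->
  \forall k & l \near \oo, q (u k \- u l) (u k \- u l) < e.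

(* Convergence for the norm (||f||^2 + q(f))^(1/2). *)
Definition form_cvg q u f : Prop :=
  L2_cvg u f /\ q (u n \- f) (u n \- f) @[n --> \oo] --> 0.

Definition closable q : Prop :=
  forall u, (forall n, dom q (u n)) -> L2_cvg u (cst 0) -> form_cauchy q u ->
  q (u n) (u n) @[n --> \oo] --> 0.

Definition closed_form q : Prop :=
  [/\ positive_form q,
      forall f f', dom q f -> f' \in Lfun mu 2%:E -> f = f' %[ae mu] ->
        dom q f' &
      forall u, (forall n, dom q (u n)) -> L2_cauchy u -> form_cauchy q u ->
        exists2 f, dom q f & form_cvg q u f].

Definition extends q' q : Prop :=
  dom q `<=` dom q' /\ forall f g, dom q f -> dom q g -> q' f g = q f g.

Definition smallest_closed_extension q qbar : Prop :=
  [/\ closed_form qbar, extends qbar q &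
      forall q', closed_form q' -> extends q' q -> extends q' qbar].

Definition dirichlet_form q : Prop :=
  [/\ closed_form q, L2_dense (dom q) &
      forall f, dom q f ->
        let g := fun x => Num.min (Num.max (f x) 0) 1 in
        dom q g /\ q g g <= q f f].

(* The intersection of the domain with L^oo is an algebra for every Dirichlet
   form, so that [q] is evaluated on its domain in the last clause. *)
Definition square_field_operator q (G : (E -> R) -> (E -> R) -> E -> R)
    : Prop :=
  [/\ forall f g, dom q f -> dom q g -> G f g \in Lfun mu 1,
      forall f g, dom q f -> dom q g -> G f g = G g f %[ae mu],
      forall (a : R) f g h, dom q f -> dom q g -> dom q h ->
        G (a \*o f \+ g) h = a \*o G f h \+ G g h %[ae mu],
      forall u v f g, (forall n, dom q (u n)) -> (forall n, dom q (v n)) ->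
        dom q f -> dom q g -> form_cvg q u f -> form_cvg q v g ->
        ('N[mu]_1 [EFin \o (G (u n) (v n) \- G f g)%R])%E @[n --> \oo] --> 0%E &
      forall f h, dom q f -> f \in Lfun mu +oo%E ->
        dom q h -> h \in Lfun mu +oo%E ->
        2 * q (f \* h) f - q h (f \* f) = \int[mu]_x (h x * G f f x)].

Definition fun_support (F : R -> R) : set R := closure [set x | F x != 0].

Definition test_function (F : R -> R) : Prop :=
  (forall n x, derivable (derive1n n F) x 1) /\ compact (fun_support F).

Definition local_form q : Prop :=
  forall f (F G : R -> R), dom q f -> test_function F -> test_function G ->
  fun_support F `&` fun_support G = set0 ->
  q (fun x => F (f x) - F 0) (fun x => G (f x) - G 0) = 0.

Definition cintegral d' (T : measurableType d') (P : {measure set T -> \bar R})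
    (f : T -> R[i]) : R[i] :=
  (\int[P]_x complex.Re (f x)) +i* (\int[P]_x complex.Im (f x)).

Definition cmeasurable (f : E -> R[i]) : Prop :=
  measurable_fun setT (fun x => complex.Re (f x)) /\
  measurable_fun setT (fun x => complex.Im (f x)).

Definition cLfun2 (f : E -> R[i]) : Prop :=
  (fun x => complex.Re (f x)) \in Lfun mu 2%:E /\
  (fun x => complex.Im (f x)) \in Lfun mu 2%:E.

Definition cL2_dense (D : set (E -> R[i])) : Prop :=
  forall f : E -> R[i], cLfun2 f -> forall e : R, 0 < e ->
  exists2 g : E -> R[i], D g &
    ('N[mu]_2%:E [EFin \o (fun x => complex.Re `|f x - g x|)%R] < e%:E)%E.

Definition complexify f : E -> R[i] := fun x => (f x)%:C.

Definition real_part (D : set (E -> R[i])) : set (E -> R) :=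
  [set f | D (complexify f)].

(* The C-bilinear (not Hermitian) extension of a square field operator. *)
Definition cextension (G : (E -> R) -> (E -> R) -> E -> R)
    (f g : E -> R[i]) : E -> R[i] :=
  let re (h : E -> R[i]) := fun x => complex.Re (h x) in
  let im (h : E -> R[i]) := fun x => complex.Im (h x) in
  fun x => (G (re f) (re g) x - G (im f) (im g) x)
           +i* (G (re f) (im g) x + G (im f) (re g) x).

End Forms.

Section LimitForm.
Context dO d (Omega : measurableType dO) (E : measurableType d) (R : realType).
Context (P : probability Omega R) (Y : Omega -> E) (Yn : nat -> Omega -> E).
Context (alpha : nat -> R).

Definition approx_form (n : nat) (f g : E -> R) : R :=
  alpha n / 2 *
  \int[P]_w ((f (Yn n w) - f (Y w)) * (g (Yn n w) - g (Y w))).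

Definition limit_form (f g : E -> R) : R :=
  lim (approx_form n f g @[n --> \oo]).

Definition capprox_form (n : nat) (f g : E -> R[i]) : (R[i] : numFieldType) :=
  (alpha n / 2)%:C *
  cintegral P (fun w => (f (Yn n w) - f (Y w)) * (g (Yn n w) - g (Y w))).

Definition climit_form (f g : E -> R[i]) : R[i] :=
  lim (capprox_form n f g @[n --> \oo]).

End LimitForm.

(* Main.v *)
Require Import Defs.
From HB Require Import structures.
From mathcomp Require Import all_boot all_order all_algebra.
From mathcomp Require Import complex ring lra.
From mathcomp Require Import all_classical all_reals all_analysis.
From mathcomp Require Import measurable_realfun ess_sup_inf.
Set Implicit Arguments.
Unset Strict Implicit.
Unset Printing Implicit Defensive.
Import Order.TTheory GRing.Theory Num.Theory.
Import numFieldNormedType.Exports.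
Local Open Scope classical_set_scope.
Local Open Scope ring_scope.

(** The hypothesis says that the limit [q phi chi] of the approximate forms is
    [- \int A phi * chi]. Hence [q phi] is continuous for the [L^2]-norm, which
    makes [q] closable ([limit_form_closable]), and the closure consists of the
    [L^2]-limits of energy-Cauchy sequences ([closable_closure]).

    Dirichlet property. Truncations leave the algebra, polynomials do not. A
    function [F] with Lipschitz constant [K] is a uniform limit of Bernstein
    polynomials with the same Lipschitz constant ([lipschitz_poly_approx]), and
    since [q] is a limit of mean squared increments, such a polynomial [p] gives
    [q (p \o phi) (p \o phi) <= K ^+ 2 * q phi phi] ([energy_lip]). Lower
    semicontinuity of closed forms ([closed_form_lsc]) transfers the bound to
    [F \o f] for every [f] in the domain ([EE_lipschitz]).

    Square field. For [gam u v = A (u * v) - u * A v - v * A u], the integral of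
    [gam u v * chi] is the limit of the normalised expectations of the increments
    of [u] and [v] times the average of [chi] ([gam_trip], [expect_trip]).
    Letting [chi] run over the unit ball of the algebra bounds [gam u v] in [L^1]
    by the energies ([gam_L1]), so [gam] extends by continuity to the domain
    ([gamma]). The defining identity passes from the core to bounded functions
    because products of bounded core functions converge weakly in energy
    ([closed_form_weak], [gamma_identity_bounded]).

    Locality implies vanishing fourth moments. Increments of [phi] larger than
    [4 h] are caught by finitely many pairs of bumps [F], [G] with disjoint
    supports ([large_increment]). The normalised expectation of the increments of
    [F \o phi] and [G \o phi] tends to twice their mutual energy ([C1_limit]),
    which locality annihilates; smaller increments contribute [O(h ^+ 2)].

    Conversely, vanishing fourth moments kill the products of four increments by
    which the Leibniz rule fails before the limit ([trip_leibniz]). The resulting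
    chain rule expresses the energy of [p \o phi] and [r \o psi] by the integral
    of [gam psi phi] against [p' (phi) * r' (psi)] ([chain_rule]). Approximating
    [F \o f] and [G \o f] by such polynomials, the product of derivatives tends
    to zero when the supports are disjoint ([C1_local]).

    Complex functions. Stability under conjugation puts the real and imaginary
    parts of the elements of [D] in the real algebra [real_part D], to which the
    real case applies. Testing against real functions shows that [A] acts on the
    two parts separately ([generator_Re], [generator_Im]), and the complex
    statements are bilinear expansions of the real ones. *)

(** * Sequences and positive forms *)

Section sequences_aux.
Context {R : realType}.

Lemma near2P (P : nat -> nat -> Prop) :
  (\forall k & l \near \oo, P k l) <->
  exists N, forall k l, (N <= k)%N -> (N <= l)%N -> P k l.
Proof.
split.
  case=> -[A B] /= [[N1 _ A1] [N2 _ B2]] AB.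
  exists (maxn N1 N2) => k l; rewrite !geq_max => /andP[k1 _] /andP[_ l2].
  by apply: (AB (k, l)); split; [apply: A1|apply: B2].
case=> N H; exists ([set n | (N <= n)%N], [set n | (N <= n)%N]) => /=.
  by split; exists N => //=.
by move=> [k l] /= [Nk Nl]; exact: H.
Qed.

Lemma cvg0P (x : nat -> R) : (forall n, 0 <= x n) ->
  (x n @[n --> \oo] --> 0) <->
  (forall e, 0 < e -> exists N, forall n, (N <= n)%N -> x n < e).
Proof.
move=> x0; split.
  move=> /cvgrPdist_lt H e /H[N _ HN]; exists N => n /HN /=.
  by rewrite sub0r normrN ger0_norm.
move=> H; apply/cvgrPdist_lt => e /H[N HN]; exists N => //= n /HN.
by rewrite sub0r normrN ger0_norm.
Qed.

Lemma cvgD0 (x y : nat -> R) : x n @[n --> \oo] --> 0 ->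
  y n @[n --> \oo] --> 0 -> x n + y n @[n --> \oo] --> 0.
Proof. by move=> x0 y0; rewrite -[X in _ --> X](addr0 (0 : R)); exact: cvgD. Qed.

Lemma cvgMl0 (a : R) (y : nat -> R) :
  y n @[n --> \oo] --> 0 -> a * y n @[n --> \oo] --> 0.
Proof.
by move=> y0; rewrite -[X in _ --> X](mulr0 a); apply: cvgM => //; exact: cvg_cst.
Qed.

Lemma cvg_sqrt0 (x : nat -> R) : x n @[n --> \oo] --> 0 ->
  Num.sqrt (x n) @[n --> \oo] --> 0.
Proof.
move=> x0; have := @sqrt_continuous R 0; rewrite /continuous_at sqrtr0.
exact: cvg_comp.
Qed.

End sequences_aux.

Section positive_forms.
Context d (E : measurableType d) (R : realType) (mu : probability E R).
Variable (q : bform E R).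
Hypothesis qP : positive_form mu q.
Implicit Types (f g h : E -> R) (u v : nat -> E -> R).

Lemma form_L2 f : dom q f -> f \in Lfun mu 2%:E.
Proof. by case: qP => + _ _ _ _; apply. Qed.

Lemma form_dom0 : dom q (cst 0). Proof. by case: qP. Qed.

Lemma form_domD f g : dom q f -> dom q g -> dom q (f \+ g).
Proof.
case: qP => _ _ H _ _ qf qg; have := H 1 f g qf qg.
by congr (dom q _); apply/funext => x /=; rewrite mul1r.
Qed.

Lemma form_domZ (a : R) f : dom q f -> dom q (a \*o f).
Proof.
case: qP => _ d0 H _ _ qf; have := H a f _ qf d0.
by congr (dom q _); apply/funext => x /=; rewrite addr0.
Qed.

Lemma form_domB f g : dom q f -> dom q g -> dom q (f \- g).
Proof.
move=> qf qg; have := form_domD qf (form_domZ (-1) qg).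
by congr (dom q _); apply/funext => x /=; rewrite mulN1r.
Qed.

Lemma bformC f g : dom q f -> dom q g -> q f g = q g f.
Proof. by case: qP => _ _ _ [H _ _] _; apply: H. Qed.

Lemma form_ge0 f : dom q f -> 0 <= q f f.
Proof. by case: qP => _ _ _ _; apply. Qed.

Lemma form_lin (a : R) f g h : dom q f -> dom q g -> dom q h ->
  q (a \*o f \+ g) h = a * q f h + q g h.
Proof. by case: qP => _ _ _ [_ H _] _; apply: H. Qed.

Lemma bformDl f g h : dom q f -> dom q g -> dom q h ->
  q (f \+ g) h = q f h + q g h.
Proof.
move=> qf qg qh; rewrite -[q f h]mul1r -form_lin//.
by congr (q _ _); apply/funext => x /=; rewrite mul1r.
Qed.

Lemma bform0l h : dom q h -> q (cst 0) h = 0.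
Proof.
move=> qh; have := bformDl form_dom0 form_dom0 qh.
rewrite (_ : _ \+ _ = cst 0); last by apply/funext => x /=; rewrite addr0.
lra.
Qed.

Lemma bformZl (a : R) f h : dom q f -> dom q h -> q (a \*o f) h = a * q f h.
Proof.
move=> qf qh; rewrite -[RHS]addr0 -(bform0l qh) -form_lin//; last exact: form_dom0.
by congr (q _ _); apply/funext => x /=; rewrite addr0.
Qed.

Lemma bformBl f g h : dom q f -> dom q g -> dom q h ->
  q (f \- g) h = q f h - q g h.
Proof.
move=> qf qg qh; rewrite -mulN1r -bformZl// -bformDl//; last exact: form_domZ.
by congr (q _ _); apply/funext => x /=; rewrite mulN1r.
Qed.

Lemma bformDr f g h : dom q f -> dom q g -> dom q h ->
  q h (f \+ g) = q h f + q h g.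
Proof.
by move=> qf qg qh; rewrite bformC ?bformDl// 1?bformC// 1?[q g h]bformC//; exact: form_domD.
Qed.

Lemma bformZr (a : R) f h : dom q f -> dom q h -> q h (a \*o f) = a * q h f.
Proof. by move=> qf qh; rewrite bformC ?bformZl// 1?bformC//; exact: form_domZ. Qed.

Lemma bformBr f g h : dom q f -> dom q g -> dom q h ->
  q h (f \- g) = q h f - q h g.
Proof.
by move=> qf qg qh; rewrite bformC ?bformBl// 1?bformC// 1?[q g h]bformC//; exact: form_domB.
Qed.

Lemma form_sqD f g : dom q f -> dom q g ->
  q (f \+ g) (f \+ g) = q f f + 2 * q f g + q g g.
Proof.
move=> qf qg; have qfg := form_domD qf qg.
rewrite bformDl// !bformDr// (bformC qg qf); ring.
Qed.

Lemma form_sqB f g : dom q f -> dom q g ->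
  q (f \- g) (f \- g) = q f f - 2 * q f g + q g g.
Proof.
move=> qf qg; have qfg := form_domB qf qg.
rewrite bformBl// !bformBr// (bformC qg qf); ring.
Qed.

Lemma form_sqZ a f : dom q f -> q (a \*o f) (a \*o f) = a ^+ 2 * q f f.
Proof.
move=> qf; have qaf := form_domZ a qf.
by rewrite bformZl// bformZr// mulrA expr2.
Qed.

(** Young's inequality; the sharp constant is recovered by optimising in [t]. *)
Lemma form_young (t : R) f g : 0 < t -> dom q f -> dom q g ->
  2 * `|q f g| <= t * q f f + t^-1 * q g g.
Proof.
move=> t0 qf qg; have ti0 : 0 < t^-1 by rewrite invr_gt0.
have t1 : t^-1 * t = 1 by rewrite mulVf// gt_eqF.
have H (e : R) : 0 <= t ^+ 2 * q f f + e * (2 * t * q f g) + q g g ->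
    0 <= t * q f f + e * (2 * q f g) + t^-1 * q g g.
  move=> /(mulr_ge0 (ltW ti0)); congr (_ <= _).
  by rewrite !mulrDr expr2 !mulrA t1 mul1r -[in RHS](mulr1 e) -t1; ring.
have [s0|s0] := leP 0 (q f g).
  have := form_ge0 (form_domB (form_domZ t qf) qg).
  rewrite form_sqB ?form_sqZ ?bformZl//; last exact: form_domZ.
  have := H (-1); rewrite ger0_norm//; lra.
have := form_ge0 (form_domD (form_domZ t qf) qg).
rewrite form_sqD ?form_sqZ ?bformZl//; last exact: form_domZ.
have := H 1; rewrite ltr0_norm//; lra.
Qed.

Lemma form_cauchy_schwarz f g : dom q f -> dom q g ->
  q f g ^+ 2 <= q f f * q g g.
Proof.
move=> qf qg.
have Hf := form_ge0 qf; have Hg := form_ge0 qg.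
have [f0|f0] := eqVneq (q f f) 0.
  suff -> : q f g = 0 by rewrite expr0n /= mulr_ge0.
  apply/eqP; apply: contraT => n0.
  pose a := - (q g g + 1) / (2 * q f g).
  have := form_ge0 (form_domD (form_domZ a qf) qg).
  rewrite form_sqD ?form_sqZ ?bformZl ?f0//; last exact: form_domZ.
  have -> : 2 * (a * q f g) = - (q g g + 1) by rewrite /a; field.
  by lra.
have fp : 0 < q f f by rewrite lt_def f0.
pose a := - q f g / q f f.
have := form_ge0 (form_domD (form_domZ a qf) qg).
rewrite form_sqD ?form_sqZ ?bformZl//; last exact: form_domZ.
have -> : a ^+ 2 * q f f + 2 * (a * q f g) + q g g =
  (q f f * q g g - q f g ^+ 2) / q f f by rewrite /a; field.
by rewrite pmulr_lge0 ?invr_gt0// subr_ge0.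
Qed.

Lemma form_normM f g : dom q f -> dom q g ->
  `|q f g| <= Num.sqrt (q f f) * Num.sqrt (q g g).
Proof.
move=> qf qg; rewrite -sqrtrM ?form_ge0// -sqrtr_sqr ler_sqrt.
  exact: form_cauchy_schwarz.
by rewrite mulr_ge0 ?form_ge0.
Qed.

Lemma form_sqD_le f g : dom q f -> dom q g ->
  q (f \+ g) (f \+ g) <= 2 * q f f + 2 * q g g.
Proof.
move=> qf qg; rewrite form_sqD//.
have := form_ge0 (form_domB qf qg); rewrite form_sqB//; lra.
Qed.

Lemma form_sqBC f g : dom q f -> dom q g ->
  q (f \- g) (f \- g) = q (g \- f) (g \- f).
Proof. by move=> qf qg; rewrite !form_sqB// (bformC qg qf); ring. Qed.

Lemma form_sqB_trans f g h : dom q f -> dom q g -> dom q h ->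
  q (f \- h) (f \- h) <= 2 * q (f \- g) (f \- g) + 2 * q (g \- h) (g \- h).
Proof.
move=> qf qg qh; have := form_sqD_le (form_domB qf qg) (form_domB qg qh).
by rewrite (_ : _ \+ _ = f \- h)//; apply/funext => x /=; rewrite addrA subrK.
Qed.

Definition seq_cvg u f := q (u n \- f) (u n \- f) @[n --> \oo] --> 0.

Lemma seq_cvgP u f : (forall n, dom q (u n)) -> dom q f ->
  seq_cvg u f <-> (forall e, 0 < e -> exists N, forall n, (N <= n)%N ->
    q (u n \- f) (u n \- f) < e).
Proof. by move=> qu qf; apply: cvg0P => n; apply/form_ge0/form_domB. Qed.

Lemma seq_cvg_form u v f g :
  (forall n, dom q (u n)) -> (forall n, dom q (v n)) -> dom q f -> dom q g ->
  seq_cvg u f -> seq_cvg v g -> q (u n) (v n) @[n --> \oo] --> q f g.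
Proof.
move=> qu qv qf qg uf vg.
have uf' n : dom q (u n \- f) by exact: form_domB.
have vg' n : dom q (v n \- g) by exact: form_domB.
have H (x y : nat -> E -> R) :
   (forall n, dom q (x n)) -> (forall n, dom q (y n)) ->
   Num.sqrt (q (x n) (x n)) * Num.sqrt (q (y n) (y n)) @[n --> \oo] --> 0 ->
   q (x n) (y n) @[n --> \oo] --> 0.
  move=> qx qy xy0; apply/norm_cvg0P.
  apply: (squeeze_cvgr _ (cvg_cst 0) xy0).
  by apply: nearW => n; rewrite normr_ge0 form_normM.
have E1 n : q (u n) (v n) = q f g + (q (u n \- f) (v n \- g)
    + (q (u n \- f) g + q f (v n \- g))).
  by rewrite !(bformBl, bformBr)//; ring.
rewrite (eq_cvg _ _ E1).
have s0 : q (u n \- f) (v n \- g) + (q (u n \- f) g + q f (v n \- g))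
    @[n --> \oo] --> 0.
  apply: cvgD0; [|apply: cvgD0].
  - apply: H => //.
    rewrite -[X in _ --> X](mulr0 (0 : R)).
    exact: (cvgM (cvg_sqrt0 uf) (cvg_sqrt0 vg)).
  - apply: (H _ (fun=> g)) => //.
    rewrite -[X in _ --> X](mul0r (Num.sqrt (q g g))).
    exact: (cvgM (cvg_sqrt0 uf) (cvg_cst _)).
  - by apply: (H (fun=> f)) => //; exact/cvgMl0/cvg_sqrt0.
have := cvgD (cvg_cst (q f g)) s0; rewrite addr0; exact.
Qed.

Lemma form_cauchyP u : form_cauchy q u <->
  (forall e, 0 < e -> exists N, forall k l, (N <= k)%N -> (N <= l)%N ->
    q (u k \- u l) (u k \- u l) < e).
Proof. by split=> H e /H /near2P. Qed.

Lemma seq_cvg_cauchy u f : (forall n, dom q (u n)) -> dom q f ->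
  seq_cvg u f -> form_cauchy q u.
Proof.
move=> qu qf /(seq_cvgP qu qf) uf; apply/form_cauchyP => e e0.
have /uf[N HN] : 0 < e / 4 by lra.
exists N => k l /HN Hk /HN Hl.
have := form_sqB_trans (qu k) qf (qu l).
rewrite [q (f \- _) _]form_sqBC//; lra.
Qed.

Lemma form_cauchy_bounded u : (forall n, dom q (u n)) -> form_cauchy q u ->
  exists C, exists N, forall n, (N <= n)%N -> q (u n) (u n) <= C.
Proof.
move=> qu /form_cauchyP /(_ 1 ltr01)[N HN].
exists (2 + 2 * q (u N) (u N)); exists N => n Nn.
have := form_sqD_le (form_domB (qu n) (qu N)) (qu N).
rewrite (_ : _ \+ _ = u n); last by apply/funext => x /=; rewrite subrK.
have := HN _ _ Nn (leqnn N); lra.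
Qed.

Lemma form_ae f f' g : dom q f -> dom q f' -> dom q g ->
  f = f' %[ae mu] -> q f g = q f' g.
Proof. by case: qP => _ _ _ [_ _ H] _; apply: H. Qed.

Lemma form_sq_ae f f' : dom q f -> dom q f' ->
  f = f' %[ae mu] -> q f f = q f' f'.
Proof.
by move=> qf qf' ff'; rewrite (form_ae qf qf' qf ff') bformC// (form_ae qf qf' qf').
Qed.

End positive_forms.

(** * Square-integrable functions *)

Definition bounded_fun_on (T : Type) (R : realType) (f : T -> R) :=
  exists M : R, forall x, `|f x| <= M.

Section L2.
Context d (E : measurableType d) (R : realType) (mu : probability E R).
Implicit Types (f g h : E -> R) (u v : nat -> E -> R).
Local Notation L2 := (Lfun mu 2%:E).
Local Notation intg f := (mu.-integrable [set: E] (EFin \o f)).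
Local Notation meas f := (measurable_fun [set: E] f).

Lemma intg_meas f : intg f -> meas f.
Proof. by move=> /integrableP[/measurable_EFinP]. Qed.

Lemma intg_le f g : meas f -> (forall x, `|f x| <= `|g x|) -> intg g -> intg f.
Proof.
move=> mf fg; apply: le_integrable => //; first exact/measurable_EFinP.
by move=> x _; rewrite lee_fin.
Qed.

Lemma intg_cst (c : R) : intg (fun=> c).
Proof. exact: finite_measure_integrable_cst. Qed.

Lemma intg_bounded f : meas f -> bounded_fun_on f -> intg f.
Proof.
move=> mf [M fM]; apply: (intg_le (g := fun=> M)) => //; last exact: intg_cst.
by move=> x; rewrite (le_trans (fM x))// ler_norm.
Qed.

Lemma intgD f g : intg f -> intg g -> intg (fun x => f x + g x).
Proof. by move=> If Ig; apply: (@integrableD _ _ _ mu) If Ig. Qed.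

Lemma intgB f g : intg f -> intg g -> intg (fun x => f x - g x).
Proof. by move=> If Ig; apply: (@integrableB _ _ _ mu) If Ig. Qed.

Lemma intgZ (a : R) f : intg f -> intg (fun x => a * f x).
Proof. by move=> If; apply: (@integrableZl _ _ _ mu setT measurableT a) If. Qed.

Lemma intg_norm f : intg f -> intg (fun x => `|f x|).
Proof.
move=> If; apply: (intg_le (g := f)) => //; last by move=> x; rewrite normr_id.
by apply: measurableT_comp => //; exact: intg_meas.
Qed.

Lemma intg_mulb f g : intg f -> meas g -> bounded_fun_on g ->
  intg (fun x => f x * g x).
Proof.
move=> If mg [M gM]; apply: (intg_le (g := fun x => M * f x)); last exact: intgZ.
  by apply: measurable_funM => //; exact: intg_meas.
move=> x; rewrite normrM normrM mulrC ler_wpM2r//.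
by rewrite (le_trans (gM x))// ler_norm.
Qed.

Lemma meas_L2 f : f \in L2 -> meas f.
Proof. by rewrite inE => /andP[/[!inE]]. Qed.

Lemma L2P f : f \in L2 <-> meas f /\ intg (fun x => f x ^+ 2).
Proof.
split=> [f2|[mf /integrableP[m2 i2]]].
  by split; [exact: meas_L2|exact: Lfun2_integrable_sqr].
rewrite inE; apply/andP; split; rewrite inE//=.
rewrite /finite_norm unlock poweR_lty//.
rewrite (le_lt_trans _ i2)// le_eqVlt; apply/orP; left; apply/eqP.
by apply: eq_integral => x _; rewrite /= normrX powR_mulrn// ger0_norm.
Qed.

Lemma L2_intgM f g : f \in L2 -> g \in L2 -> intg (fun x => f x * g x).
Proof. by move=> f2 g2; apply/Lfun1_integrable/Lfun2_mul_Lfun1. Qed.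

Lemma L2_intg f : f \in L2 -> intg f.
Proof.
move=> f2; apply/Lfun1_integrable; move: f f2.
by apply: Lfun_subset12; rewrite fin_num_measure.
Qed.

Lemma L2_le f g : meas g -> (forall x, `|g x| <= `|f x|) -> f \in L2 -> g \in L2.
Proof.
move=> mg gf /L2P[mf f2]; apply/L2P; split => //.
apply: (intg_le _ _ f2); first exact: measurable_funX.
by move=> x; rewrite !normrX lerXn2r ?nnegrE.
Qed.

Lemma L2_lin (a : R) f g : f \in L2 -> g \in L2 -> a \*o f \+ g \in L2.
Proof.
move=> f2 g2; have [_] := @Lfun_submod_closed _ E R mu 2%:E (lee1n 2).
by move=> /(_ a f g f2 g2).
Qed.

Lemma L2_cst (c : R) : cst c \in L2.
Proof. by apply/L2P; split; [exact: measurable_cst|exact: (intg_cst (c ^+ 2))]. Qed.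

Lemma L2D f g : f \in L2 -> g \in L2 -> f \+ g \in L2.
Proof.
move=> f2 g2; have := L2_lin 1 f2 g2.
by congr (is_true (in_mem _ _)); apply/funext => x /=; rewrite mul1r.
Qed.

Lemma L2Z a f : f \in L2 -> a \*o f \in L2.
Proof.
move=> f2; have := L2_lin a f2 (L2_cst 0).
by congr (is_true (in_mem _ _)); apply/funext => x /=; rewrite addr0.
Qed.

Lemma L2B f g : f \in L2 -> g \in L2 -> f \- g \in L2.
Proof.
move=> f2 g2; have := L2D f2 (L2Z (-1) g2).
by congr (is_true (in_mem _ _)); apply/funext => x /=; rewrite mulN1r.
Qed.

Lemma L2_bounded f : meas f -> bounded_fun_on f -> f \in L2.
Proof.
move=> mf [M fM]; apply: (L2_le (f := cst M)) => //; last exact: L2_cst.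
by move=> x; rewrite (le_trans (fM x))// ler_norm.
Qed.

Lemma L2_mulb f g : f \in L2 -> meas g -> bounded_fun_on g -> f \* g \in L2.
Proof.
move=> f2 mg [M gM]; apply: (L2_le (f := M \*o f)); last exact: L2Z.
  by apply: measurable_funM => //; exact: meas_L2.
move=> x /=; rewrite normrM normrM mulrC ler_wpM2r//.
by rewrite (le_trans (gM x))// ler_norm.
Qed.

Lemma L2_norm f : f \in L2 -> (fun x => `|f x|) \in L2.
Proof.
move=> f2; apply: (L2_le (f := f)) => //; last by move=> x; rewrite normr_id.
by apply: measurableT_comp => //; exact: meas_L2.
Qed.

Definition ip f g : R := \int[mu]_x (f x * g x).

Definition L2form : bform E R := BForm [set f | f \in L2] ip.

Lemma ipC f g : ip f g = ip g f.
Proof. by apply: eq_Rintegral => x _; rewrite mulrC. Qed.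

Lemma Rint_ae f g : meas f -> meas g -> f = g %[ae mu] ->
  \int[mu]_x f x = \int[mu]_x g x.
Proof.
move=> mf mg fg; congr fine; apply: ae_eq_integral => //.
- exact/measurable_EFinP.
- exact/measurable_EFinP.
- by apply: filterS fg => x /= /(_ I) -> _.
Qed.

Lemma L2form_positive : positive_form mu L2form.
Proof.
split => //=.
- exact: L2_cst.
- by move=> a f g; exact: L2_lin.
- split => /=.
  + by move=> f g _ _; exact: ipC.
  + move=> a f g h f2 g2 h2; rewrite -RintegralZl//; last exact: L2_intgM.
    rewrite -RintegralD//; [|exact/intgZ/L2_intgM|exact: L2_intgM].
    by apply: eq_Rintegral => x _ /=; rewrite mulrDl mulrA.
  + move=> f f' g f2 f2' g2 ff'; apply: Rint_ae.
    * by apply: measurable_funM; exact: meas_L2.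
    * by apply: measurable_funM; exact: meas_L2.
    * by apply: filterS ff' => x /= /(_ I) -> _.
- by move=> f f2; apply: Rintegral_ge0 => x _; rewrite -expr2 sqr_ge0.
Qed.

Lemma ip_ge0 f : 0 <= ip f f.
Proof. by apply: Rintegral_ge0 => x _; rewrite -expr2 sqr_ge0. Qed.

Lemma Lnorm2E f : f \in L2 ->
  'N[mu]_2%:E [EFin \o f]%E = (Num.sqrt (ip f f))%:E.
Proof.
move=> f2; rewrite unlock.
under eq_integral => x _ do rewrite /= powR_mulrn// -normrX ger0_norm ?sqr_ge0// expr2.
rewrite -[X in (X `^ _)%E]fineK; last first.
  by apply: integrable_fin_num => //; exact: L2_intgM.
by rewrite poweR_EFin powR12_sqrt//; exact: ip_ge0.
Qed.

Lemma Lnorm2_lt f e : f \in L2 -> 0 < e ->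
  ('N[mu]_2%:E [EFin \o f] < e%:E)%E = (ip f f < e ^+ 2).
Proof.
move=> f2 e0; rewrite Lnorm2E// lte_fin -[e in LHS]gtr0_norm// -sqrtr_sqr.
by rewrite ltr_sqrt// exprn_gt0.
Qed.

Lemma L2_cvgE u f : (forall n, u n \in L2) -> f \in L2 ->
  L2_cvg mu u f <-> seq_cvg L2form u f.
Proof.
move=> u2 f2; rewrite (seq_cvgP L2form_positive)//.
have uf n : u n \- f \in L2 by exact: L2B.
rewrite /L2_cvg; split.
  move=> /fine_cvgP[_ /cvgrPdist_lt H] e e0.
  have /H[N _ HN] : 0 < Num.sqrt e by rewrite sqrtr_gt0.
  exists N => n /HN /=; rewrite Lnorm2E//= sub0r normrN ger0_norm// ltr_sqrt//.
move=> H; apply/fine_cvgP; split.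
  by apply: nearW => n; rewrite Lnorm2E.
apply/cvgrPdist_lt => e e0; have /H[N HN] : 0 < e ^+ 2 by rewrite exprn_gt0.
exists N => //= n /HN /= {}HN; rewrite Lnorm2E//= sub0r normrN ger0_norm//.
by rewrite -[e]gtr0_norm// -sqrtr_sqr ltr_sqrt// exprn_gt0.
Qed.

Lemma L2_cauchyE u : (forall n, u n \in L2) ->
  L2_cauchy mu u <-> form_cauchy L2form u.
Proof.
move=> u2; have uf k l : u k \- u l \in L2 by exact: L2B.
split => H e e0; apply/near2P.
  have /H/near2P[N HN] : 0 < Num.sqrt e by rewrite sqrtr_gt0.
  exists N => k l Nk Nl; have := HN _ _ Nk Nl.
  by rewrite Lnorm2_lt ?sqrtr_gt0// sqr_sqrtr// ltW.
have /H/near2P[N HN] : 0 < e ^+ 2 by rewrite exprn_gt0.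
by exists N => k l Nk Nl; rewrite Lnorm2_lt//; exact: HN.
Qed.

Lemma ip_eq0_ae f : f \in L2 -> ip f f = 0 -> f = cst 0 %[ae mu].
Proof.
move=> f2 f0; have /Lnorm_eq0_eq0 : 'N[mu]_2%:E [EFin \o f]%E = 0%E.
  by rewrite Lnorm2E// f0 sqrtr0.
have mf : measurable_fun setT (EFin \o f) by apply/measurable_EFinP/meas_L2.
by move=> /(_ mf); rewrite lte_fin ltr0n => /(_ isT); apply: filterS => x /= /[apply] -[].
Qed.

Lemma Rint_cst (c : R) : \int[mu]_x c = c.
Proof. by rewrite Rintegral_cst// [X in fine X](@probability_setT _ _ _ mu) mulr1. Qed.

(** Cauchy-Schwarz against the constant one, whose norm is one under a
    probability. *)
Lemma Rint_norm_sq f : f \in L2 -> (\int[mu]_x `|f x|) ^+ 2 <= ip f f.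
Proof.
move=> f2; have := form_cauchy_schwarz L2form_positive (L2_norm f2) (L2_cst 1).
have -> : L2form (cst 1) (cst 1) = 1.
  by rewrite -[RHS]Rint_cst; apply: eq_Rintegral => x _ /=; rewrite mulr1.
have -> : L2form (fun x => `|f x|) (cst 1) = \int[mu]_x `|f x|.
  by apply: eq_Rintegral => x _ /=; rewrite mulr1.
rewrite mulr1; congr (_ <= _); apply: eq_Rintegral => x _ /=.
by rewrite -normrM ger0_norm// -expr2 sqr_ge0.
Qed.

End L2.

(** * Completeness of the Lebesgue spaces *)

Section completeness.
Context d (E : measurableType d) (R : realType) (mu : probability E R).
Implicit Types (f g h : E -> R) (u v : nat -> E -> R).
Local Notation L2 := (Lfun mu 2%:E).
Local Notation intg f := (mu.-integrable [set: E] (EFin \o f)).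
Local Notation meas f := (measurable_fun [set: E] f).

Lemma integral_norm_EFin f : intg f ->
  (\int[mu]_x `|(f x)%:E| = (\int[mu]_x `|f x|)%:E)%E.
Proof.
move=> If; rewrite fineK//; apply: integrable_fin_num => //; exact: intg_norm.
Qed.

Definition L1_cauchy u := forall e, 0 < e -> exists N, forall k l,
  (N <= k)%N -> (N <= l)%N -> \int[mu]_x `|u k x - u l x| < e.

(** Along a subsequence with summable successive distances, the sum of the
    absolute differences is integrable, hence finite almost everywhere, and the
    subsequence converges there. Its limit superior serves as a limit that is
    measurable and defined everywhere. *)
Lemma L1_cauchy_ae u : (forall n, intg (u n)) -> L1_cauchy u ->
  exists f, exists s : nat -> nat, [/\ meas f, forall n, (n <= s n)%N &
    {ae mu, forall x, u (s n) x @[n --> \oo] --> f x}].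
Proof.
move=> Iu uC.
pose eps n : R := 1 / (2 ^ n.+1)%:R.
have eps0 n : 0 < eps n by rewrite divr_gt0// ltr0n expn_gt0.
have [N_ HN] := choice (fun n => uC (eps n) (eps0 n)).
pose s n := (n + \sum_(i < n.+1) N_ i)%N.
have sn n : (n <= s n)%N by rewrite leq_addr.
have sN n : (N_ n <= s n)%N.
  by rewrite /s big_ord_recr /= addnA leq_addl.
have sSN n : (N_ n <= s n.+1)%N.
  apply: leq_trans (sN n) _; rewrite /s [in leqRHS]big_ord_recr /=.
  by rewrite leq_add// leq_addr.
pose w n x : R := `|u (s n.+1) x - u (s n) x|.
have Iw n : intg (w n) by apply: intg_norm; exact: intgB.
have mw n : measurable_fun setT (fun x => (w n x)%:E).
  by apply/measurable_EFinP; exact: intg_meas (Iw n).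
have wlt n : (\int[mu]_x (w n x)%:E <= (eps n)%:E)%E.
  rewrite -[leLHS]fineK; last exact: (integrable_fin_num measurableT (Iw n)).
  by rewrite lee_fin ltW// HN.
have w0 n x : 0 <= w n x by exact: normr_ge0.
pose W x := (\sum_(n <oo) (w n x)%:E)%E.
have W0 x : (0 <= W x)%E by apply: nneseries_ge0 => n _ _; rewrite lee_fin.
have IW : mu.-integrable setT W.
  apply/integrableP; split.
    apply: ge0_emeasurable_sum => // n x _ _; by rewrite lee_fin.
  under eq_integral => x _ do rewrite gee0_abs//.
  rewrite integral_nneseries//; last by move=> n x _; rewrite lee_fin.
  apply: (@le_lt_trans _ _ (1 : R)%:E); last exact: ltry.
  apply: le_trans (epsilon_trick0 xpredT (@ler01 R)).
  apply: lee_nneseries => [n _ _|n _]; last exact: wlt.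
  by apply: integral_ge0 => x _; rewrite lee_fin.
pose f x := fine (limn_esup (fun n => (u (s n) x)%:E)).
exists f, s; split => //.
  apply: measurableT_comp => //; apply: measurable_fun_limn_esup => n.
  by apply/measurable_EFinP; exact: intg_meas (Iu _).
apply: filterS (integrable_ae measurableT IW) => x /= /(_ I) Wx.
have cw : cvgn (series (fun n => w n x)).
  apply: nondecreasing_is_cvgn.
    by apply: nondecreasing_series => n _ _; exact: normr_ge0.
  exists (fine (W x)) => _ [n _ <-] /=.
  rewrite -lee_fin fineK// /series /= -sumEFin.
  by apply: nneseries_lim_ge => k _ _; rewrite lee_fin.
have cu : cvgn (fun n => u (s n) x).
  have /normed_cvg cd : cvgn [normed series (fun n => u (s n.+1) x - u (s n) x)] by [].
  have -> : (fun n => u (s n) x) =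
      (fun n => u (s 0%N) x + series (fun n => u (s n.+1) x - u (s n) x) n).
    apply/funext => n.
    by rewrite /series /= (telescope_sumr (fun n => u (s n) x))// subrKC.
  by apply: is_cvgD => //; exact: is_cvg_cst.
have cE : (u (s n) x)%:E @[n --> \oo] --> (lim (u (s n) x @[n --> \oo]))%:E.
  by apply: cvg_EFin => //; exact: nearW.
rewrite /f is_cvg_limn_esupE; last by apply/cvg_ex; eexists; exact: cE.
by rewrite (cvg_lim _ cE).
Qed.

Lemma fatou_norm (w : nat -> E -> R) f (C : R) : (forall n, intg (w n)) -> meas f ->
  {ae mu, forall x, w n x @[n --> \oo] --> f x} ->
  (forall n, \int[mu]_x `|w n x| <= C) ->
  intg f /\ \int[mu]_x `|f x| <= C.
Proof.
move=> Iw mf wf wC.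
have mw n : measurable_fun setT (fun x => `|(w n x)%:E|%E).
  by apply: measurableT_comp => //; apply/measurable_EFinP; exact: intg_meas (Iw n).
have H : (\int[mu]_x `|(f x)%:E| <= C%:E)%E.
  have -> : (\int[mu]_x `|(f x)%:E| = \int[mu]_x limn_einf (fun n => `|(w n x)%:E|))%E.
    apply: ae_eq_integral => //.
    - by apply: measurableT_comp => //; exact/measurable_EFinP.
    - have -> : (fun x => limn_einf (fun n => `|(w n x)%:E|%E)) =
          (fun x => - limn_esup (fun n => - `|(w n x)%:E|))%E.
        apply/funext => x; rewrite (limn_esupN (fun n => `|(w n x)%:E|%E)).
        by rewrite oppeK.
      apply: measurableT_comp => //; apply: measurable_fun_limn_esup => n.
      exact: measurableT_comp.
    - apply: filterS wf => x wx _.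
      have cE : `|(w n x)%:E|%E @[n --> \oo] --> `|(f x)%:E|%E.
        by apply: cvg_EFin; [exact: nearW|exact: cvg_norm].
      rewrite is_cvg_limn_einfE; last by apply/cvg_ex; eexists; exact: cE.
      by rewrite (cvg_lim _ cE).
  have w0 n x : [set: E] x -> (0 <= `|(w n x)%:E|)%E by [].
  apply: (le_trans (fatou mu measurableT mw w0)).
  rewrite limn_einf_lim; apply: lime_le; first exact: is_cvg_einfs.
  apply: nearW => n; apply: (@le_trans _ _ (\int[mu]_x `|(w n x)%:E|)%E).
    by apply: ereal_inf_lbound; exists n => /=.
  by rewrite integral_norm_EFin// lee_fin.
have If : intg f.
  by apply/integrableP; split; [exact/measurable_EFinP|exact: le_lt_trans H (ltry _)].
by split => //; rewrite -lee_fin -integral_norm_EFin.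
Qed.

(** Fatou's lemma, applied to the distances from [u n] to the terms of the
    subsequence, turns almost everywhere convergence into convergence in norm;
    likewise for [L2_complete]. *)
Lemma L1_complete u : (forall n, intg (u n)) -> L1_cauchy u ->
  exists2 f, intg f &
    forall e, 0 < e -> exists N, forall n, (N <= n)%N -> \int[mu]_x `|u n x - f x| < e.
Proof.
move=> Iu uC; have [f [s [mf sn sf]]] := L1_cauchy_ae Iu uC.
have H e : 0 < e -> exists N, forall n, (N <= n)%N ->
    intg (fun x => u n x - f x) /\ \int[mu]_x `|u n x - f x| < e.
  move=> e0; have /uC[N HN] : 0 < e / 2 by lra.
  exists N => n Nn.
  have [||||I1 I2] := @fatou_norm (fun k x => u n x - u (s (k + N)%N) x)
     (fun x => u n x - f x) (e / 2).
  - by move=> k; exact: intgB.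
  - by apply: measurable_funB => //; exact: intg_meas (Iu n).
  - apply: filterS sf => x sx; apply: cvgB; first exact: cvg_cst.
    by have := sx; rewrite -(cvg_shiftn N).
  - by move=> k; rewrite ltW// HN// (leq_trans _ (sn _))// leq_addl.
  - by split => //; lra.
have [N0 HN0] := H 1 ltr01.
exists f.
  have [I1 _] := HN0 _ (leqnn _).
  have := intgB (Iu N0) I1; congr (mu.-integrable _ _).
  by apply/funext => x /=; rewrite opprB addrC subrK.
by move=> e /H[N HN]; exists N => n /HN[].
Qed.

Lemma L2_complete u : (forall n, u n \in L2) -> form_cauchy (L2form mu) u ->
  exists2 f, f \in L2 & seq_cvg (L2form mu) u f.
Proof.
move=> u2 /form_cauchyP uC.
have uB k l : u k \- u l \in L2 by exact: L2B.
have uC1 : L1_cauchy u.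
  move=> e e0; have /uC[N HN] : 0 < e ^+ 2 by rewrite exprn_gt0.
  exists N => k l Nk Nl; have := le_lt_trans (Rint_norm_sq (uB k l)) (HN _ _ Nk Nl).
  rewrite ltr_pXn2r// nnegrE; last exact: ltW.
  by apply: Rintegral_ge0 => x _.
have [f [s [mf sn sf]]] := L1_cauchy_ae (fun n => L2_intg (u2 n)) uC1.
have H e : 0 < e -> exists N, forall n, (N <= n)%N ->
    u n \- f \in L2 /\ ip mu (u n \- f) (u n \- f) < e.
  move=> e0; have /uC[N HN] : 0 < e / 2 by lra.
  exists N => n Nn.
  have muf : meas (u n \- f) by apply: measurable_funB => //; exact: meas_L2 (u2 n).
  have sqE g : \int[mu]_x `|g x ^+ 2| = ip mu g g.
    by apply: eq_Rintegral => x _; rewrite ger0_norm ?sqr_ge0// expr2.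
  have [||||I1 I2] := @fatou_norm (fun k x => (u n x - u (s (k + N)%N) x) ^+ 2)
     (fun x => (u n x - f x) ^+ 2) (e / 2).
  - by move=> k; have /L2P[] := uB n (s (k + N)%N).
  - exact: measurable_funX.
  - apply: filterS sf => x sx.
    have sx' : u (s (k + N)%N) x @[k --> \oo] --> f x.
      by rewrite (cvg_shiftn N (fun k => u (s k) x)).
    have c1 : u n x - u (s (k + N)%N) x @[k --> \oo] --> u n x - f x.
      by apply: cvgB sx'; exact: cvg_cst.
    by rewrite expr2; under eq_cvg do rewrite expr2; exact: (cvgM c1 c1).
  - move=> k; rewrite (sqE (u n \- u (s (k + N)%N))) ltW// HN//.
    by rewrite (leq_trans _ (sn _))// leq_addl.
  - split; first exact/L2P.
    by rewrite -sqE; lra.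
have [N0 HN0] := H 1 ltr01.
have f2 : f \in L2.
  have [I1 _] := HN0 _ (leqnn _).
  have := L2B (u2 N0) I1; congr (is_true (in_mem _ _)).
  by apply/funext => x /=; rewrite opprB addrC subrK.
exists f => //; apply/(seq_cvgP (L2form_positive mu)) => //.
by move=> e /H[N HN]; exists N => n /HN[].
Qed.

End completeness.

(** * Closed forms: lower semicontinuity and weak convergence *)

Section real_sequences.
Context {R : realType}.
Implicit Types (x y : nat -> R).

Lemma real_cauchy_cvg x : (forall e, 0 < e -> exists N, forall k l,
  (N <= k)%N -> (N <= l)%N -> `|x k - x l| < e) -> cvgn x.
Proof.
move=> H; apply/cauchy_cvgP/cauchy_ballP => e e0; rewrite near_map2; apply/near2P.
have [N HN] := H e e0; exists N => k l Nk Nl.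
by rewrite -ball_normE /=; exact: HN.
Qed.

Lemma cvgr_le_eps x l C : x n @[n --> \oo] --> l ->
  (forall e, 0 < e -> exists N, forall n, (N <= n)%N -> x n <= C + e) -> l <= C.
Proof.
move=> xl H; apply/ler_addgt0Pr => e /H[N HN].
apply: (cvgr_to_le xl); exists N => //= n; exact: HN.
Qed.

Definition inv_succ (n : nat) : R := n.+1%:R^-1.

Lemma inv_succ_gt0 n : 0 < inv_succ n. Proof. by rewrite invr_gt0. Qed.

Lemma inv_succ_le m n : (m <= n)%N -> inv_succ n <= inv_succ m.
Proof. by move=> mn; rewrite lef_pV2 ?posrE// ler_nat. Qed.

Lemma inv_succ_lt (e : R) : 0 < e -> exists N, forall n, (N <= n)%N -> inv_succ n < e.
Proof.
move=> e0; have := @cvg_harmonic R => /cvgrPdist_lt /(_ e e0)[N _ HN].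
by exists N => n /HN /=; rewrite sub0r normrN ger0_norm.
Qed.

End real_sequences.

Section closed_forms.
Context d (E : measurableType d) (R : realType) (mu : probability E R).
Implicit Types (f g h : E -> R) (u v : nat -> E -> R) (q : bform E R).
Local Notation L2 := (Lfun mu 2%:E).
Local Notation l2 := (L2form mu).

Lemma form_cvgE q u f : positive_form mu q -> (forall n, dom q (u n)) -> dom q f ->
  form_cvg mu q u f <-> seq_cvg l2 u f /\ seq_cvg q u f.
Proof.
move=> qP qu qf; rewrite /form_cvg L2_cvgE//; last exact: form_L2 qf.
by move=> n; exact: form_L2 (qu n).
Qed.

Lemma L2_cvg_ae u f f' : (forall n, u n \in L2) -> f \in L2 -> f' \in L2 ->
  f = f' %[ae mu] -> seq_cvg l2 u f -> seq_cvg l2 u f'.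
Proof.
move=> u2 f2 f2' ff' uf; rewrite /seq_cvg.
have E1 n : l2 (u n \- f') (u n \- f') = l2 (u n \- f) (u n \- f).
  apply: (form_sq_ae (L2form_positive mu)); [exact: L2B|exact: L2B|].
  by apply: filterS ff' => x /= /(_ I) ->.
by rewrite (eq_cvg _ _ E1).
Qed.

Lemma L2_lim_unique u f f' : (forall n, u n \in L2) -> f \in L2 -> f' \in L2 ->
  seq_cvg l2 u f -> seq_cvg l2 u f' -> f = f' %[ae mu].
Proof.
move=> u2 f2 f2' uf uf'; have lP := L2form_positive mu.
have ff'2 : f \- f' \in L2 by exact: L2B.
suff /(ip_eq0_ae ff'2) : ip mu (f \- f') (f \- f') = 0.
  by apply: filterS => x /= /[apply] /eqP; rewrite subr_eq0 => /eqP.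
apply/eqP; rewrite eq_le ip_ge0 andbT; apply/ler_addgt0Pr => e e0; rewrite add0r.
have e4 : 0 < e / 4 by lra.
have [N1 H1] := (seq_cvgP lP u2 f2).1 uf _ e4.
have [N2 H2] := (seq_cvgP lP u2 f2').1 uf' _ e4.
have := form_sqB_trans lP f2 (u2 (maxn N1 N2)) f2'.
have := H1 _ (leq_maxl N1 N2); have := H2 _ (leq_maxr N1 N2).
rewrite (form_sqBC lP f2 (u2 (maxn N1 N2))) /=; lra.
Qed.

(** Closedness provides some limit; its [L^2]-class is that of [f], and both the
    domain and the form only depend on this class. *)
Lemma closed_form_lim q u f : closed_form mu q -> (forall n, dom q (u n)) ->
  f \in L2 -> seq_cvg l2 u f -> form_cauchy q u -> dom q f /\ seq_cvg q u f.
Proof.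
move=> [qP qae qcl] qu f2 uf uC.
have u2 n : u n \in L2 by exact: form_L2 (qu n).
have uC2 : L2_cauchy mu u.
  by apply/L2_cauchyE => //; apply: (seq_cvg_cauchy (L2form_positive mu)) uf.
have [f' qf' /(form_cvgE qP qu qf')[uf' quf']] := qcl u qu uC2 uC.
have f2' := form_L2 qP qf'.
have ff' := L2_lim_unique u2 f2 f2' uf uf'.
have f'f : f' = f %[ae mu] by apply: filterS ff' => x /= /[apply].
have qf := qae _ _ qf' f2 f'f.
split => //; rewrite /seq_cvg.
have E1 n : q (u n \- f) (u n \- f) = q (u n \- f') (u n \- f').
  apply: (form_sq_ae qP); [exact: (form_domB qP)|exact: (form_domB qP)|].
  by apply: filterS ff' => x /= /(_ I) ->.
by rewrite (eq_cvg _ _ E1).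
Qed.

(** Lower semicontinuity: the energy infima over shrinking [L^2]-balls around
    [f] increase to a limit, and near-minimisers form an energy-Cauchy sequence
    by the parallelogram law, since midpoints stay in the (convex) balls. *)
Lemma closed_form_lsc q f C : closed_form mu q -> f \in L2 ->
  (forall e, 0 < e -> exists g, [/\ dom q g, ip mu (g \- f) (g \- f) < e &
     q g g <= C + e]) ->
  dom q f /\ q f f <= C.
Proof.
move=> qcl f2 H; have [qP _ _] := qcl; have lP := L2form_positive mu.
pose B n := [set g | dom q g /\ ip mu (g \- f) (g \- f) < inv_succ n].
pose S n := [set q g g | g in B n].
pose m n := inf (S n).
have S0 n : has_inf (S n).
  split.
    have [g [qg gf _]] := H _ (inv_succ_gt0 n).
    by exists (q g g); exists g.
  by exists 0 => _ [g [qg _] <-]; exact: (form_ge0 qP qg).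
have mle n g : B n g -> m n <= q g g.
  by move=> Bg; apply: ge_inf; [case: (S0 n)|exists g].
have mC n : m n <= C.
  apply/ler_addgt0Pr => e e0.
  have : 0 < Num.min e (inv_succ n) by rewrite lt_min e0 inv_succ_gt0.
  move=> /H[g [qg]]; rewrite lt_min => /andP[_ gf] gC.
  apply: (le_trans (mle n g _)) => //; apply: (le_trans gC).
  by rewrite lerD2l ge_min lexx.
have BS n k : (n <= k)%N -> B k `<=` B n.
  move=> nk g [qg gk]; split => //; exact: lt_le_trans gk (inv_succ_le nk).
have mnd n k : (n <= k)%N -> m n <= m k.
  move=> nk; apply: lb_le_inf; first by case: (S0 k).
  by move=> _ [g Bg <-]; apply: mle; apply: BS Bg.
have /choice[g_ Hg] : forall n, exists g, B n g /\ q g g < m n + inv_succ n.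
  move=> n.
  have [_ [g Bg <-] gm] := inf_adherent (inv_succ_gt0 n) (S0 n).
  by exists g.
have qg n : dom q (g_ n) by have [[]] := Hg n.
have g2 n : g_ n \in L2 by exact: form_L2 (qg n).
have gC : form_cauchy q g_.
  apply/form_cauchyP => e e0.
  pose M := sup (range m).
  have sM : has_sup (range m).
    by split; [exists (m 0%N); exists 0%N|exists C => _ [n _ <-]].
  have mM n : m n <= M by apply: ub_le_sup; [case: sM|exists n].
  have e8 : 0 < e / 8 by lra.
  have [_ [N1 _ <-] HN1] := sup_adherent e8 sM.
  have [N2 HN2] := @inv_succ_lt R _ e8.
  exists (maxn N1 N2) => k l Nk Nl; set N := maxn N1 N2 in Nk Nl *.
  have mN : M - e / 8 < m N by rewrite (lt_le_trans HN1)// mnd// leq_maxl.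
  have rN : inv_succ N < e / 8 by rewrite HN2// leq_maxr.
  pose mid := 2^-1 \*o (g_ k \+ g_ l).
  have qkl : dom q (g_ k \+ g_ l) by exact: (form_domD qP).
  have qmid : dom q mid by exact: (form_domZ qP).
  have Bmid : B N mid.
    split => //; have [[_ Hk] _] := Hg k; have [[_ Hl] _] := Hg l.
    have -> : mid \- f = 2^-1 \*o ((g_ k \- f) \+ (g_ l \- f)).
      by apply/funext => x; rewrite /mid /=; field.
    have := form_sqZ lP 2^-1 (L2D (L2B (g2 k) f2) (L2B (g2 l) f2)).
    rewrite /= => ->.
    have /= := form_sqD_le lP (L2B (g2 k) f2) (L2B (g2 l) f2).
    have := @inv_succ_le R _ _ Nk; have := @inv_succ_le R _ _ Nl. lra.
  have := mle _ _ Bmid; rewrite (form_sqZ qP _ qkl) (form_sqD qP)// (form_sqB qP)//.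
  have [_] := Hg k; have [_] := Hg l.
  have := @inv_succ_le R _ _ Nk; have := @inv_succ_le R _ _ Nl; have := mM k; have := mM l.
  move: (m k) (m l) (m N) (inv_succ k) (inv_succ l) (inv_succ N) mN rN => mk ml mN' ik il iN.
  lra.
have gf : seq_cvg l2 g_ f.
  apply/(seq_cvgP lP) => // e e0; have [N HN] := inv_succ_lt e0.
  by exists N => n Nn; have [[_ Hn] _] := Hg n; apply: lt_trans Hn (HN _ Nn).
have [qf qgf] := closed_form_lim qcl qg f2 gf gC.
split => //; apply: (cvgr_le_eps (seq_cvg_form qP qg qg qf qf qgf qgf)) => e e0.
have [N HN] := inv_succ_lt e0; exists N => n Nn.
have [_ Hn] := Hg n; have := HN _ Nn; have := mC n; lra.
Qed.

(** A sequence bounded in energy and converging in [L^2] converges weakly in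
    energy: lower semicontinuity along [u n + t g] leaves a defect that is
    linear in [t], which large [t] forbids. *)
Lemma closed_form_weak q u f g C : closed_form mu q -> (forall n, dom q (u n)) ->
  dom q f -> dom q g -> seq_cvg l2 u f ->
  (exists N, forall n, (N <= n)%N -> q (u n) (u n) <= C) ->
  q (u n) g @[n --> \oo] --> q f g.
Proof.
move=> qcl qu qf qg uf [N0 HN0]; have [qP _ _] := qcl.
have lP := L2form_positive mu.
have u2 n : u n \in L2 by exact: form_L2 (qu n).
have f2 := form_L2 qP qf.
have C0 : 0 <= C by apply: le_trans (HN0 _ (leqnn _)); exact: (form_ge0 qP).
have K h e : dom q h -> 0 < e -> exists N, forall n, (N <= n)%N ->
    q f h - e < q (u n) h.
  move=> qh e0; have h2 := form_L2 qP qh.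
  apply: contrapT => /forallNP Hn.
  pose t := (C + 1) / e.
  have t0 : 0 < t by rewrite divr_gt0//; lra.
  have te : t * e = C + 1 by rewrite /t; field; rewrite gt_eqF.
  have qth : dom q (t \*o h) by exact: (form_domZ qP).
  have qfh : dom q (f \+ t \*o h) by exact: (form_domD qP).
  have [_] : dom q (f \+ t \*o h) /\ q (f \+ t \*o h) (f \+ t \*o h) <=
      C + 2 * t * (q f h - e) + t ^+ 2 * q h h.
    apply: closed_form_lsc => //; first exact: form_L2 qfh.
    move=> eps eps0.
    have [N1 HN1] := (seq_cvgP lP u2 f2).1 uf _ eps0.
    have /existsNP[n /not_implyP[nN /negP]] := Hn (maxn N0 N1).
    rewrite -leNgt => nh; rewrite geq_max in nN; move/andP: nN => [n0 n1].
    exists (u n \+ t \*o h); split; first exact: (form_domD qP).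
      have -> : (u n \+ t \*o h) \- (f \+ t \*o h) = u n \- f.
        by apply/funext => x /=; ring.
      exact: HN1.
    rewrite (form_sqD qP)// (form_sqZ qP)// (bformZr qP)//.
    have := HN0 _ n0; nra.
  rewrite (form_sqD qP)// (form_sqZ qP)// (bformZr qP)//.
  have := form_ge0 qP qf.
  rewrite mulrBr; have -> : 2 * t * e = 2 * (C + 1) by rewrite -te mulrA.
  lra.
apply/cvgrPdist_lt => e e0.
have [N1 H1] := K _ _ qg e0.
have [N2 H2] := K _ _ (form_domZ qP (-1) qg) e0.
exists (maxn N1 N2) => //= n /=; rewrite geq_max => /andP[/H1 n1 /H2].
rewrite !(bformZr qP)// ltr_norml; move: n1; lra.
Qed.

(** Weak convergence together with convergence of the norms is strong
    convergence. *)
Lemma closed_form_strong q u f : closed_form mu q -> (forall n, dom q (u n)) ->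
  dom q f -> seq_cvg l2 u f ->
  (forall e, 0 < e -> exists N, forall n, (N <= n)%N -> q (u n) (u n) <= q f f + e) ->
  seq_cvg q u f.
Proof.
move=> qcl qu qf uf H; have [qP _ _] := qcl.
have /cvgrPdist_lt W := closed_form_weak qcl qu qf qf uf (H 1 ltr01).
apply/(seq_cvgP qP) => // e e0.
have e4 : 0 < e / 4 by lra.
have [N1 H1] := H _ e4; have [N2 _ H2] := W _ e4.
exists (maxn N1 N2) => n; rewrite geq_max => /andP[/H1 n1 /H2 /=].
rewrite (form_sqB qP)// ltr_norml; move: n1; lra.
Qed.

End closed_forms.

(** * The closure of a closable form *)

Section closure.
Context d (E : measurableType d) (R : realType) (mu : probability E R).
Variable q : bform E R.
Hypotheses (qP : positive_form mu q) (qcl : closable mu q).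
Implicit Types (f g h : E -> R) (u v : nat -> E -> R).
Local Notation L2 := (Lfun mu 2%:E).
Local Notation l2 := (L2form mu).
Let lP := L2form_positive mu.

Definition core_approx f u :=
  [/\ f \in L2, forall n, dom q (u n), seq_cvg l2 u f & form_cauchy q u].

Let dom_L2 u : (forall n, dom q (u n)) -> forall n, u n \in L2.
Proof. by move=> qu n; exact: (form_L2 qP). Qed.

Lemma form_cvg0_bounded u v C : (forall n, dom q (u n)) -> (forall n, dom q (v n)) ->
  q (u n) (u n) @[n --> \oo] --> 0 ->
  (exists N, forall n, (N <= n)%N -> q (v n) (v n) <= C) ->
  q (u n) (v n) @[n --> \oo] --> 0.
Proof.
move=> qu qv u0 [N HN]; apply/norm_cvg0P.
have uC : Num.sqrt (q (u n) (u n)) * Num.sqrt C @[n --> \oo] --> 0.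
  rewrite -[X in _ --> X](mul0r (Num.sqrt C)).
  by apply: cvgM; [exact: cvg_sqrt0|exact: cvg_cst].
apply: (squeeze_cvgr _ (cvg_cst 0) uC); exists N => //= n /HN vC.
rewrite normr_ge0 (le_trans (form_normM qP _ _))// ler_wpM2l ?sqrtr_ge0//.
by rewrite ler_wsqrtr.
Qed.

Lemma approx_lin (a : R) f g u v : core_approx f u -> core_approx g v ->
  core_approx (a \*o f \+ g) (fun n => a \*o u n \+ v n).
Proof.
move=> [f2 qu uf uC] [g2 qv vg vC].
have u2 := dom_L2 qu; have v2 := dom_L2 qv.
have K (b : bform E R) x y x' y' : positive_form mu b ->
    dom b x -> dom b y -> dom b x' -> dom b y' ->
    b (a \*o x \+ y \- (a \*o x' \+ y')) (a \*o x \+ y \- (a \*o x' \+ y')) <=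
    2 * a ^+ 2 * b (x \- x') (x \- x') + 2 * b (y \- y') (y \- y').
  move=> bP bx b_y bx' by'.
  have -> : a \*o x \+ y \- (a \*o x' \+ y') = a \*o (x \- x') \+ (y \- y').
    by apply/funext => z /=; ring.
  have bxx := form_domB bP bx bx'; have byy := form_domB bP b_y by'.
  rewrite -mulrA -(form_sqZ bP)//; apply: (form_sqD_le bP) => //.
  by apply: (form_domZ bP).
split.
- exact: L2_lin.
- by move=> n; apply: (form_domD qP) => //; exact: (form_domZ qP).
- have uv0 : 2 * a ^+ 2 * l2 (u n \- f) (u n \- f) +
      2 * l2 (v n \- g) (v n \- g) @[n --> \oo] --> 0.
    by apply: cvgD0; exact: cvgMl0.
  apply: (squeeze_cvgr _ (cvg_cst 0) uv0); apply: nearW => n.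
  rewrite ip_ge0 /=.
  by apply: (K l2 _ _ _ _ lP); [exact: u2|exact: v2|exact: f2|exact: g2].
- apply/form_cauchyP => e e0.
  pose c := 2 * a ^+ 2 + 2.
  have c0 : 0 < c by rewrite /c; have := sqr_ge0 a; lra.
  have ec0 : 0 < e / c by rewrite divr_gt0.
  have [N1 H1] := (form_cauchyP _ _).1 uC _ ec0.
  have [N2 H2] := (form_cauchyP _ _).1 vC _ ec0.
  exists (maxn N1 N2) => k l; rewrite !geq_max => /andP[k1 k2] /andP[l1 l2].
  apply: le_lt_trans (K _ _ _ _ _ qP _ _ _ _) _ => //.
  have -> : e = 2 * a ^+ 2 * (e / c) + 2 * (e / c).
    by rewrite -mulrDl -/c mulrC divfK// gt_eqF.
  apply: ler_ltD; last by rewrite ltr_pM2l// H2.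
  apply: ler_wpM2l; first by rewrite mulr_ge0 ?sqr_ge0.
  exact/ltW/H1.
Qed.

Lemma approx_cst f : dom q f -> core_approx f (fun=> f).
Proof.
move=> qf; have qf0 : q (f \- f) (f \- f) = 0.
  by rewrite (bformBl qP)// ?subrr//; exact: (form_domB qP).
have f2 := form_L2 qP qf.
split => //.
- rewrite /seq_cvg (_ : l2 _ _ = 0); first exact: cvg_cst.
  by rewrite (bformBl lP)//= ?subrr//; exact: L2B.
- by apply/form_cauchyP => e e0; exists 0%N => k l _ _; rewrite qf0.
Qed.

Lemma approx_ae f f' u : core_approx f u -> f' \in L2 -> f = f' %[ae mu] -> core_approx f' u.
Proof.
by move=> [f2 qu uf uC] f2' ff'; split => //; apply: L2_cvg_ae uf => //; exact: dom_L2.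
Qed.

(** This is what closability says: two approximating sequences of the same
    function differ by an energy-Cauchy sequence that tends to zero in [L^2]. *)
Lemma approx_uniq f u u' : core_approx f u -> core_approx f u' ->
  q (u n \- u' n) (u n \- u' n) @[n --> \oo] --> 0.
Proof.
move=> uf uf'; have [f2 qu _ _] := uf; have [_ qu' _ _] := uf'.
have [_ qw wf wC] := approx_lin (-1) uf' uf.
have EB n : -1 \*o u' n \+ u n = u n \- u' n.
  by apply/funext => x /=; ring.
have w0 : L2_cvg mu (fun n => -1 \*o u' n \+ u n) (cst 0).
  apply/L2_cvgE; [exact: dom_L2|exact: L2_cst|].
  by move: wf; congr (seq_cvg _ _ _); apply/funext => x /=; ring.
have E1 n : q (u n \- u' n) (u n \- u' n) =
    q (-1 \*o u' n \+ u n) (-1 \*o u' n \+ u n) by rewrite EB.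
by rewrite (eq_cvg _ _ E1); exact: qcl qw w0 wC.
Qed.

Lemma approx_cvg f g u v : core_approx f u -> core_approx g v -> cvgn (fun n => q (u n) (v n)).
Proof.
move=> [f2 qu uf uC] [g2 qv vg vC].
have [C1 [N1 H1]] := form_cauchy_bounded qP qu uC.
have [C2 [N2 H2]] := form_cauchy_bounded qP qv vC.
apply: real_cauchy_cvg => e e0.
pose C := Num.max C1 C2 + 1.
have C0 : 0 < C.
  rewrite /C ltr_pwDr// le_max; apply/orP; left.
  by apply: le_trans (H1 _ (leqnn _)); exact: (form_ge0 qP).
pose t := 2 * C / e; have t0 : 0 < t by rewrite divr_gt0// mulr_gt0.
have et : t^-1 * C = e / 2 by rewrite /t; field; rewrite !gt_eqF.
have et0 : 0 < e / (2 * t) by rewrite divr_gt0// mulr_gt0.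
have [N3 H3] := (form_cauchyP _ _).1 uC _ et0.
have [N4 H4] := (form_cauchyP _ _).1 vC _ et0.
exists (maxn (maxn N1 N2) (maxn N3 N4)) => k l.
rewrite !geq_max => /andP[/andP[k1 k2] /andP[k3 k4]] /andP[/andP[l1 l2] /andP[l3 l4]].
have quB := form_domB qP (qu k) (qu l); have qvB := form_domB qP (qv k) (qv l).
have -> : q (u k) (v k) - q (u l) (v l) =
    q (u k \- u l) (v k) + q (v k \- v l) (u l).
  rewrite !(bformBl qP)// (bformC qP (qu l) (qv k)) (bformC qP (qu l) (qv l)).
  ring.
have Y1 := form_young qP t0 quB (qv k).
have Y2 := form_young qP t0 qvB (qu l).
have B1 : q (v k) (v k) < C.
  by rewrite /C (le_lt_trans (H2 _ k2))// ltr_pwDr// le_max lexx orbT.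
have B2 : q (u l) (u l) < C.
  by rewrite /C (le_lt_trans (H1 _ l1))// ltr_pwDr// le_max lexx.
have ti0 : 0 < t^-1 by rewrite invr_gt0.
have {}B1 : t^-1 * q (v k) (v k) < e / 2 by rewrite -et ltr_pM2l.
have {}B2 : t^-1 * q (u l) (u l) < e / 2 by rewrite -et ltr_pM2l.
have E2 : t * (e / (2 * t)) = e / 2 by field; rewrite gt_eqF.
have := H3 _ _ k3 l3; rewrite -(ltr_pM2l t0) E2 => B3.
have := H4 _ _ k4 l4; rewrite -(ltr_pM2l t0) E2 => B4.
rewrite (le_lt_trans (ler_normD _ _))//; lra.
Qed.

Definition closure_dom : set (E -> R) := [set f | exists u, core_approx f u].

Definition closure_seq f : nat -> E -> R := xget (fun=> cst 0) (core_approx f).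

Definition closure_form : bform E R := BForm closure_dom
  (fun f g => lim (q (closure_seq f n) (closure_seq g n) @[n --> \oo])).

Local Notation EE := closure_form.

Lemma closure_seqP f : closure_dom f -> core_approx f (closure_seq f).
Proof. by move=> [u uf]; exact: (xgetPex _ (ex_intro _ u uf)). Qed.

Lemma approx_dom f u : core_approx f u -> closure_dom f.
Proof. by exists u. Qed.

Lemma closure_form_lim f g u v : core_approx f u -> core_approx g v ->
  q (u n) (v n) @[n --> \oo] --> EE f g.
Proof.
move=> uf vg.
have sf := closure_seqP (approx_dom uf); have sg := closure_seqP (approx_dom vg).
have [_ qu _ uC] := uf; have [_ qv _ vC] := vg.
have [_ qsf _ sfC] := sf; have [_ qsg _ _] := sg.
have [C1 H1] := form_cauchy_bounded qP qv vC.
have [C2 H2] := form_cauchy_bounded qP qsf sfC.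
set s := closure_seq f in sf qsf sfC H2 *; set t := closure_seq g in sg qsg *.
have qus n : dom q (u n \- s n) by exact: (form_domB qP).
have qvt n : dom q (v n \- t n) by exact: (form_domB qP).
have E1 n : q (u n) (v n) = q (s n) (t n) +
    (q (u n \- s n) (v n) + q (v n \- t n) (s n)).
  rewrite !(bformBl qP)// (bformC qP (qv n) (qsf n)) (bformC qP (qsg n) (qsf n)).
  by ring.
have r0 : q (u n \- s n) (v n) + q (v n \- t n) (s n) @[n --> \oo] --> 0.
  apply: cvgD0; first exact: form_cvg0_bounded (approx_uniq uf sf) H1.
  exact: form_cvg0_bounded (approx_uniq vg sg) H2.
rewrite (eq_cvg _ _ E1); have := cvgD (approx_cvg sf sg : _ --> EE f g) r0.
by rewrite addr0; exact.
Qed.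

Lemma closure_form_positive : positive_form mu EE.
Proof.
split => /=.
- by move=> f [u []].
- by exists (fun=> cst 0); apply: approx_cst; exact: (form_dom0 qP).
- move=> a f g [u uf] [v vg]; eexists; exact: (approx_lin a uf vg).
- split.
  + move=> f g [u uf] [v vg].
    have := closure_form_lim uf vg; have := closure_form_lim vg uf.
    have E1 n : q (v n) (u n) = q (u n) (v n).
      by have [_ qu _ _] := uf; have [_ qv _ _] := vg; exact: (bformC qP).
    rewrite (eq_cvg _ _ E1) => h1 h2; exact: (cvg_unique _ h2 h1).
  + move=> a f g h [u uf] [v vg] [w wh].
    have := closure_form_lim (approx_lin a uf vg) wh.
    have E1 n : q (a \*o u n \+ v n) (w n) = a * q (u n) (w n) + q (v n) (w n).
      have [_ qu _ _] := uf; have [_ qv _ _] := vg; have [_ qw _ _] := wh.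
      exact: (form_lin qP).
    rewrite (eq_cvg _ _ E1) => h1.
    have h2 : a * q (u n) (w n) + q (v n) (w n) @[n --> \oo] --> a * EE f h + EE g h.
      apply: cvgD; last exact: closure_form_lim.
      by apply: cvgM; [exact: cvg_cst|exact: closure_form_lim].
    exact: (cvg_unique _ h1 h2).
  + move=> f f' g [u uf] [u' uf'] [v vg] ff'.
    have [f2' _ _ _] := uf'.
    exact: (cvg_unique _ (closure_form_lim uf vg) (closure_form_lim (approx_ae uf f2' ff') vg)).
- move=> f [u uf]; apply: (cvgr_to_ge (closure_form_lim uf uf)).
  by apply: nearW => n; have [_ qu _ _] := uf; exact: (form_ge0 qP).
Qed.

Lemma closure_extends : extends EE q.
Proof.
split=> [f qf|f g qf qg]; first by exists (fun=> f); exact: approx_cst.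
have := closure_form_lim (approx_cst qf) (approx_cst qg).
by move=> h; exact: (cvg_unique _ h (cvg_cst (q f g))).
Qed.

(** The energy of [u n \- f] is the limit in [k] of the energies of
    [u n \- u k], which are uniformly small. *)
Lemma closure_core f u : core_approx f u -> seq_cvg EE u f.
Proof.
move=> uf; have [f2 qu ufl uC] := uf; have eP := closure_form_positive.
have [sub eqE] := closure_extends.
have eu n : dom EE (u n) by exact: sub.
have ef : dom EE f by exists u.
apply/(seq_cvgP eP) => // e e0; have e2 : 0 < e / 2 by lra.
have [N HN] := (form_cauchyP _ _).1 uC _ e2.
exists N => n Nn; apply: (@le_lt_trans _ _ (e / 2)); last by lra.
have uu : core_approx (u n \- f) (fun k => u n \- u k).
  have := approx_lin (-1) uf (approx_cst (qu n)).
  congr (core_approx _ _); first by apply/funext => x /=; ring.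
  by apply/funext => k; apply/funext => x /=; ring.
apply: (cvgr_to_le (closure_form_lim uu uu)); exists N => //= k /= Nk.
by apply/ltW/HN.
Qed.

(** A diagonal argument: each term of an energy-Cauchy sequence of the extension
    is replaced by a nearby element of the original domain. *)
Lemma closure_closed : closed_form mu EE.
Proof.
(* From here on the extension is used through these properties alone. *)
have domE f : dom EE f <-> exists u, core_approx f u by [].
move: closure_form_positive closure_extends closure_core domE.
move: closure_form => F eP [sub eqE] core domE.
split => //.
  move=> f f' /domE[u uf] f2' ff'; apply/domE; exists u; exact: approx_ae ff'.
move=> u eu uC euC.
have u2 n : u n \in L2 by exact: (form_L2 eP).
have [f f2 uf] := L2_complete u2 ((L2_cauchyE u2).1 uC).
have Hex : forall n, exists g : E -> R, [/\ dom q g,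
    l2 (g \- u n) (g \- u n) < inv_succ n & F (g \- u n) (g \- u n) < inv_succ n].
  move=> n; have [w wu] := (domE _).1 (eu n); have [_ qw wl _] := wu.
  have w2 k : w k \in L2 by exact: (form_L2 qP).
  have ew k : dom F (w k) by exact: sub.
  have [N1 H1] := (seq_cvgP lP w2 (u2 n)).1 wl _ (inv_succ_gt0 n).
  have [N2 H2] := (seq_cvgP eP ew (eu n)).1 (core _ _ wu) _ (inv_succ_gt0 n).
  exists (w (maxn N1 N2)); split => //.
  - by apply: H1; rewrite leq_maxl.
  - by apply: H2; rewrite leq_maxr.
have [v Hv] := choice Hex.
have qv n : dom q (v n) by have [] := Hv n.
have v2 n : v n \in L2 by exact: (form_L2 qP).
have ev n : dom F (v n) by exact: sub.
have vf : seq_cvg l2 v f.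
  apply/(seq_cvgP lP) => // e e0; have e4 : 0 < e / 4 by lra.
  have [N1 H1] := (seq_cvgP lP u2 f2).1 uf _ e4.
  have [N2 H2] := inv_succ_lt e4.
  exists (maxn N1 N2) => n; rewrite geq_max => /andP[n1 n2].
  have [_ Hn _] := Hv n.
  have := form_sqB_trans lP (v2 n) (u2 n) f2.
  have := H1 _ n1; have := H2 _ n2; lra.
have vC : form_cauchy q v.
  apply/form_cauchyP => e e0; have e16 : 0 < e / 16 by lra.
  have [N1 H1] := (form_cauchyP _ _).1 euC _ e16.
  have [N2 H2] := inv_succ_lt e16.
  exists (maxn N1 N2) => k l; rewrite !geq_max => /andP[k1 k2] /andP[l1 l2].
  have [_ _ Hk] := Hv k; have [_ _ Hl] := Hv l.
  have qB := form_domB qP (qv k) (qv l); rewrite -eqE//.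
  have := form_sqB_trans eP (ev k) (eu k) (ev l).
  have := form_sqB_trans eP (eu k) (eu l) (ev l).
  rewrite (form_sqBC eP (eu l) (ev l)).
  have := H1 _ _ k1 l1; have := H2 _ k2; have := H2 _ l2; lra.
have vfa : core_approx f v by [].
have ef : dom F f by apply/domE; exists v.
exists f => //; apply/(form_cvgE eP) => //; split => //.
apply/(seq_cvgP eP) => // e e0; have e4 : 0 < e / 4 by lra.
have [N1 H1] := (seq_cvgP eP ev ef).1 (core _ _ vfa) _ e4.
have [N2 H2] := inv_succ_lt e4.
exists (maxn N1 N2) => n; rewrite geq_max => /andP[n1 n2].
have [_ _ Hn] := Hv n; have := form_sqB_trans eP (eu n) (ev n) ef.
rewrite (form_sqBC eP (eu n) (ev n)).
have := H1 _ n1; have := H2 _ n2; lra.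
Qed.

Lemma closure_smallest q' : closed_form mu q' -> extends q' q -> extends q' EE.
Proof.
move=> qcl' [sub' eq']; have [qP' _ _] := qcl'.
have K f u : core_approx f u -> dom q' f /\ seq_cvg q' u f.
  move=> [f2 qu uf /form_cauchyP uC].
  apply: (closed_form_lim qcl') => // [n|]; first exact: sub'.
  apply/form_cauchyP => e /uC[N HN]; exists N => k l Nk Nl.
  by have qB := form_domB qP (qu k) (qu l); rewrite eq'//; exact: HN.
split=> [f [u /K[]]//|f g [u uf] [v vg]].
have [f' uf'] := K _ _ uf; have [g' vg'] := K _ _ vg.
have [_ qu _ _] := uf; have [_ qv _ _] := vg.
have := seq_cvg_form qP' (fun n => sub' _ (qu n)) (fun n => sub' _ (qv n)) f' g' uf' vg'.
have E1 n : q' (u n) (v n) = q (u n) (v n) by exact: eq'.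
by rewrite (eq_cvg _ _ E1) => h; exact: (cvg_unique _ h (closure_form_lim uf vg)).
Qed.

End closure.

(** Friedrichs extension of a closable form: the domain consists of the
    [L^2]-limits of energy-Cauchy sequences. *)
Theorem closable_closure d (E : measurableType d) (R : realType)
    (mu : probability E R) (q : bform E R) :
  positive_form mu q -> closable mu q ->
  exists2 EE : bform E R, smallest_closed_extension mu q EE &
    forall f, dom EE f -> exists u, [/\ forall n, dom q (u n),
      seq_cvg (L2form mu) u f & seq_cvg EE u f].
Proof.
move=> qP qcl; exists (closure_form mu q).
  split; [exact: closure_closed|exact: closure_extends|].
  by move=> q' qc' ex; exact: closure_smallest.
move=> f [u uf]; exists u; have [_ qu ul _] := uf; split => //.
exact: closure_core.
Qed.

(** * Bernstein approximation with control of the derivative *)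

Section bernstein.
Context {R : realType}.
Implicit Types (u v w : nat -> R) (x y c : R).

(** Bernstein polynomials by de Casteljau's recursion: [bern n u] is the sum of
    the [u k *: 'C(n, k) 'X^k (1 - 'X)^(n - k)]. The recursion turns the
    estimates below into inductions on [n]. *)
Fixpoint bern (n : nat) u : {poly R} :=
  if n is m.+1 then (1 - 'X) * bern m u + 'X * bern m (fun k => u k.+1)
  else (u 0%N)%:P.

Lemma bernS n u x : (bern n.+1 u).[x] =
  (1 - x) * (bern n u).[x] + x * (bern n (fun k => u k.+1)).[x].
Proof. by rewrite /= !hornerE. Qed.

Lemma bern_le n u v x : 0 <= x <= 1 -> (forall k, u k <= v k) ->
  (bern n u).[x] <= (bern n v).[x].
Proof.
move=> /andP[x0 x1]; elim: n u v => [|n IH] u v uv; first by rewrite /= !hornerE.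
by rewrite !bernS lerD// ler_wpM2l ?subr_ge0// IH.
Qed.

Lemma bern_cst n c x : (bern n (fun=> c)).[x] = c.
Proof. by elim: n => [|n IH]; [rewrite /= hornerE|rewrite bernS IH; ring]. Qed.

Lemma bernB n u v : bern n (fun k => u k - v k) = bern n u - bern n v.
Proof.
elim: n u v => [|n IH] u v /=; first by rewrite polyCB.
by rewrite IH (IH (fun k => u k.+1)); ring.
Qed.

Lemma bernZ n c u : bern n (fun k => c * u k) = c *: bern n u.
Proof.
elim: n u => [|n IH] u /=; first by rewrite polyCM mul_polyC.
by rewrite IH (IH (fun k => u k.+1)) -!mul_polyC; ring.
Qed.

Lemma bern_dist n u w c x : 0 <= x <= 1 -> (forall k, `|u k - c| <= w k) ->
  `|(bern n u).[x] - c| <= (bern n w).[x].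
Proof.
move=> /andP[x0 x1]; elim: n u w => [|n IH] u w uw; first by rewrite /= !hornerE.
rewrite !bernS; have -> : (1 - x) * (bern n u).[x] + x * (bern n (fun k => u k.+1)).[x] - c
  = (1 - x) * ((bern n u).[x] - c) + x * ((bern n (fun k => u k.+1)).[x] - c) by ring.
rewrite (le_trans (ler_normD _ _))// !normrM ger0_norm ?subr_ge0// (ger0_norm x0).
by rewrite lerD// ler_wpM2l ?subr_ge0// IH.
Qed.

(** The variance of the binomial law; the centre [c] is left free because the
    recursion shifts it by one. *)
Lemma bern_moment n (a b c x : R) :
  (bern n (fun k => a + b * (k%:R - c) ^+ 2)).[x] =
  a + b * (n%:R * x * (1 - x) + (n%:R * x - c) ^+ 2).
Proof.
elim: n c => [|n IH] c; first by rewrite /= hornerE; ring.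
have E1 : (fun k : nat => a + b * (k.+1%:R - c) ^+ 2) =
    (fun k => a + b * (k%:R - (c - 1)) ^+ 2).
  by apply/funext => k; rewrite -natr1; ring.
by rewrite bernS IH E1 IH -natr1; ring.
Qed.

(** Each of the [n] steps of the recursion adds the term
    [(x - y) * bern _ (differences of u)], bounded by [D * `|x - y|]. *)
Lemma bern_lipschitz n u (D x y : R) : 0 <= x <= 1 -> 0 <= y <= 1 ->
  (forall k, `|u k.+1 - u k| <= D) ->
  `|(bern n u).[x] - (bern n u).[y]| <= n%:R * D * `|x - y|.
Proof.
move=> /andP[x0 x1] y01; elim: n u => [|n IH] u uD.
  by rewrite /= !hornerC subrr normr0 mulr0n -mulrA mul0r.
rewrite !bernS.
pose v k := u k.+1.
have -> : (1 - x) * (bern n u).[x] + x * (bern n v).[x]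
    - ((1 - y) * (bern n u).[y] + y * (bern n v).[y]) =
   ((1 - x) * ((bern n u).[x] - (bern n u).[y]) +
    x * ((bern n v).[x] - (bern n v).[y])) +
    (x - y) * (bern n (fun k => v k - u k)).[y].
  by rewrite bernB !hornerE; ring.
have H1 := IH _ uD; have H2 := IH v (fun k => uD k.+1).
have H3 : `|(bern n (fun k => v k - u k)).[y]| <= D.
  rewrite -[X in `|X|]subr0 -[leRHS](bern_cst n D y); apply: bern_dist => // k.
  by rewrite subr0; exact: uD.
have -> : n.+1%:R * D * `|x - y| =
   ((1 - x) * (n%:R * D * `|x - y|) + x * (n%:R * D * `|x - y|)) + `|x - y| * D.
  by rewrite -natr1; ring.
rewrite (le_trans (ler_normD _ _))// lerD//.
  rewrite (le_trans (ler_normD _ _))// !normrM (ger0_norm x0) ger0_norm ?subr_ge0//.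
  by rewrite lerD// ler_wpM2l ?subr_ge0.
by rewrite normrM ler_wpM2l.
Qed.

Lemma bern_deriv n u :
  (bern n.+1 u)^`() = n.+1%:R *: bern n (fun k => u k.+1 - u k).
Proof.
have d1 : (1 : {poly R})^`() = 0 by rewrite -polyC1 derivC.
elim: n u => [|n IH] u.
  by rewrite /= !(derivD, derivM, derivN, derivX, derivC) scale1r polyCB; ring.
have -> : bern n.+2 u = (1 - 'X) * bern n.+1 u + 'X * bern n.+1 (fun k => u k.+1).
  by [].
have := bernB n.+1 (fun k => u k.+1) u.
have -> : bern n.+1 (fun k => u k.+1 - u k) = (1 - 'X) *
  bern n (fun k => u k.+1 - u k) + 'X * bern n (fun k => u k.+2 - u k.+1) by [].
move: (IH u) (IH (fun k => u k.+1)).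
move: (bern n.+1 u) (bern n.+1 (fun k => u k.+1)) => P Q dP dQ.
move=> /eqP; rewrite eq_sym subr_eq => /eqP QP.
rewrite !(derivD, derivM, derivN, derivX) d1 dP dQ QP.
by rewrite -!mul_polyC -!natr1 !polyCD !polyC1; ring.
Qed.

Lemma unit_var (x : R) : 0 <= x <= 1 -> 0 <= x * (1 - x) <= 1.
Proof.
move=> /andP[x0 x1]; have y0 : 0 <= 1 - x by lra.
have y1 : 1 - x <= 1 by lra.
by rewrite mulr_ge0//= -[leRHS]mulr1 ler_pM.
Qed.

(** Young's inequality turns an absolute value into the quadratic that
    [bern_moment] evaluates. *)
Lemma bern_approx n u (K c0 c eta s t x : R) : 0 <= x <= 1 -> 0 <= K -> 0 < eta ->
  (forall k, `|u k - c0| <= K * (s * `|k%:R - c| + t)) -> 0 <= s ->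
  `|(bern n u).[x] - c0| <= K * (eta + t +
    s ^+ 2 / eta * (n%:R * x * (1 - x) + (n%:R * x - c) ^+ 2)).
Proof.
move=> x01 K0 eta0 H s0.
have -> : K * (eta + t + s ^+ 2 / eta * (n%:R * x * (1 - x) + (n%:R * x - c) ^+ 2))
  = (bern n (fun k => K * (eta + t) + K * (s ^+ 2 / eta) * (k%:R - c) ^+ 2)).[x].
  by rewrite bern_moment; ring.
apply: bern_dist => // k; apply: le_trans (H k) _.
have -> : K * (eta + t) + K * (s ^+ 2 / eta) * (k%:R - c) ^+ 2 =
    K * (eta + t + s ^+ 2 / eta * (k%:R - c) ^+ 2) by ring.
rewrite ler_wpM2l// addrAC lerD2r.
set a := s * `|k%:R - c|.
have -> : s ^+ 2 / eta * (k%:R - c) ^+ 2 = a ^+ 2 / eta.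
  by rewrite /a exprMn real_normK ?num_real//; ring.
rewrite -(ler_pM2r eta0) mulrDl divfK ?gt_eqF//.
have := sqr_ge0 (a - eta); have := sqr_ge0 a; have := sqr_ge0 eta; nra.
Qed.

Section unit_interval.
Variables (G : R -> R) (K : R).
Hypothesis (K0 : 0 <= K).
Hypothesis (GK : forall x y, `|G x - G y| <= K * `|x - y|).

Let smp n k := G (k%:R / n.+1%:R).

Definition bernG n := bern n.+1 (smp n).

Lemma bernG_lip n x y : 0 <= x <= 1 -> 0 <= y <= 1 ->
  `|(bernG n).[x] - (bernG n).[y]| <= K * `|x - y|.
Proof.
move=> x01 y01; have n0 : (n.+1%:R : R) != 0 by rewrite pnatr_eq0.
have -> : K = n.+1%:R * (K / n.+1%:R) by field.
apply: bern_lipschitz => // k; apply: le_trans (GK _ _) _.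
rewrite -mulrBl -natr1 addrAC subrr add0r mul1r ger0_norm//.
Qed.

Lemma bernG_range n lo hi x : (forall x, lo <= G x <= hi) -> 0 <= x <= 1 ->
  lo <= (bernG n).[x] <= hi.
Proof.
move=> H x01; apply/andP; split.
  by rewrite -(bern_cst n.+1 lo x); apply: bern_le => // k; case/andP: (H (k%:R / n.+1%:R)).
by rewrite -[leRHS](bern_cst n.+1 hi x); apply: bern_le => // k; case/andP: (H (k%:R / n.+1%:R)).
Qed.

Lemma bernG_approx e : 0 < e -> exists N, forall n, (N <= n)%N ->
  forall x, 0 <= x <= 1 -> `|(bernG n).[x] - G x| <= e.
Proof.
move=> e0; have K1 : 0 < K + 1 by rewrite ltr_wpDl.
pose eta := e / (2 * (K + 1)); have eta0 : 0 < eta by rewrite divr_gt0// mulr_gt0.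
have [N HN] := @inv_succ_lt R (eta ^+ 2) (exprn_gt0 _ eta0).
exists N => n /HN Hn x x01.
have n0 : (n.+1%:R : R) != 0 by rewrite pnatr_eq0.
have H k : `|smp n k - G x| <= K * (n.+1%:R^-1 * `|k%:R - n.+1%:R * x| + 0).
  rewrite addr0 -[X in X * `|_|]ger0_norm// -normrM; apply: le_trans (GK _ _) _.
  by rewrite ler_wpM2l// le_eqVlt; apply/orP; left; apply/eqP; congr `|_|; field.
have := bern_approx n.+1 x01 K0 eta0 H; rewrite invr_ge0 => /(_ (ler0n _ _)).
move=> /le_trans; apply.
rewrite subrr expr0n /= !addr0.
have -> : n.+1%:R^-1 ^+ 2 / eta * (n.+1%:R * x * (1 - x)) =
  inv_succ n / eta * (x * (1 - x)).
  by rewrite /inv_succ; field; rewrite nat1r n0 gt_eqF.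
have /andP[Hx0 Hx] := unit_var x01.
have Hq : inv_succ n / eta <= eta by rewrite ler_pdivrMr// -expr2 ltW.
have Hq0 : 0 <= inv_succ n / eta by rewrite divr_ge0 ?ltW ?inv_succ_gt0.
have := ler_pM Hq0 Hx0 Hq Hx; rewrite mulr1 => Hqx.
have -> : e = (K + 1) * (2 * eta) by rewrite /eta; field; rewrite gt_eqF.
by apply: ler_pM => //; [apply: addr_ge0; [exact: ltW|exact: mulr_ge0]|lra|lra].
Qed.

(** The derivative of a Bernstein polynomial is the Bernstein polynomial of the
    difference quotients, and these are values of [G1] at points within one mesh
    step of the nodes. *)
Lemma bernG_deriv_approx (G1 : R -> R) (L e : R) : 0 <= L ->
  (forall x, is_derive x 1 G (G1 x)) ->
  (forall x y, `|G1 x - G1 y| <= L * `|x - y|) ->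
  0 < e -> exists N, forall n, (N <= n)%N ->
  forall x, 0 <= x <= 1 -> `|(bernG n)^`().[x] - G1 x| <= e.
Proof.
move=> L0 dG G1L e0; have K1 : 0 < L + 1 by rewrite ltr_wpDl.
pose eta := e / (3 * (L + 1)); have eta0 : 0 < eta by rewrite divr_gt0// mulr_gt0.
have e2 : 0 < Num.min eta (eta ^+ 2) by rewrite lt_min eta0 exprn_gt0.
have [N HN] := inv_succ_lt e2.
exists N => n /HN; rewrite lt_min => /andP[Hn1 Hn2] x x01.
have n0 : (n.+1%:R : R) != 0 by rewrite pnatr_eq0.
rewrite /bernG bern_deriv -bernZ.
have H k : `|n.+1%:R * (smp n k.+1 - smp n k) - G1 x| <=
    L * (n.+1%:R^-1 * `|k%:R - n.+1%:R * x| + n.+1%:R^-1).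
  have lt01 : (k%:R / n.+1%:R : R) < k.+1%:R / n.+1%:R.
    by rewrite ltr_pM2r ?invr_gt0 ?ltr0n// ltr_nat.
  have cG : {within `[(k%:R / n.+1%:R : R), k.+1%:R / n.+1%:R], continuous G}.
    apply: derivable_within_continuous => y _; exact: ex_derive.
  have [c] := MVT lt01 (fun y _ => dG y) cG.
  rewrite in_itv /= => /andP[c1 c2]; rewrite -/(smp n k.+1) -/(smp n k) => ->.
  have -> : n.+1%:R * (G1 c * (k.+1%:R / n.+1%:R - k%:R / n.+1%:R)) = G1 c.
    by rewrite -natr1; field.
  apply: le_trans (G1L _ _) _; rewrite ler_wpM2l//.
  have -> : c - x = (c - k%:R / n.+1%:R) + (k%:R / n.+1%:R - x) by ring.
  rewrite (le_trans (ler_normD _ _))// addrC lerD//.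
    rewrite -[X in X * `|_|]ger0_norm// -normrM.
    by rewrite le_eqVlt; apply/orP; left; apply/eqP; congr `|_|; field.
  rewrite ger0_norm ?subr_ge0 ?ltW//.
  by rewrite ltrBlDl -[X in _ < _ + X]mul1r -mulrDl natr1.
have := bern_approx n x01 L0 eta0 H; rewrite invr_ge0 => /(_ (ler0n _ _)).
move=> /le_trans; apply; have /andP[x0 x1] := x01.
set Q := n%:R * x * (1 - x) + _.
have Q0 : 0 <= Q by rewrite addr_ge0 ?sqr_ge0// !mulr_ge0// subr_ge0.
have Q1 : Q <= n.+1%:R.
  have -> : Q = n%:R * (x * (1 - x)) + x ^+ 2 by rewrite /Q -natr1; ring.
  have /andP[_ Hx] := unit_var x01.
  rewrite -natr1 lerD//; last by rewrite expr_le1 ?x0 ?x1.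
  by rewrite -[leRHS]mulr1 ler_wpM2l.
have -> : n.+1%:R^-1 ^+ 2 / eta * Q = inv_succ n / eta * (Q / n.+1%:R).
  by rewrite /inv_succ; field; rewrite nat1r n0 gt_eqF.
have Hq : inv_succ n / eta <= eta by rewrite ler_pdivrMr// -expr2 ltW.
have Hq0 : 0 <= inv_succ n / eta by rewrite divr_ge0 ?ltW ?inv_succ_gt0.
have Qn0 : 0 <= Q / n.+1%:R by rewrite divr_ge0.
have Qn1 : Q / n.+1%:R <= 1 by rewrite ler_pdivrMr ?mul1r// ltr0n.
have := ler_pM Hq0 Qn0 Hq Qn1; rewrite mulr1 => Hqx.
have -> : e = (L + 1) * (3 * eta).
  by rewrite /eta; field; rewrite gt_eqF.
move: Hn1; rewrite /inv_succ => Hn1.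
have -> : 3 * eta = eta + eta + eta by ring.
apply: ler_pM => //; [|by rewrite lerDl|by rewrite !lerD// ltW].
apply: addr_ge0; last exact: mulr_ge0.
by apply: addr_ge0; [exact: ltW|rewrite invr_ge0].
Qed.

End unit_interval.

(** Only the affine change of variable from the unit interval to [-M, M] is
    involved here: it scales the Lipschitz constant by [2 * M] and the
    polynomials scale it back. *)
Section symmetric_interval.
Variables (F : R -> R) (K M : R).
Hypothesis (K0 : 0 <= K) (M0 : 0 < M).
Hypothesis (FK : forall x y, `|F x - F y| <= K * `|x - y|).

Let G s := F (2 * M * s - M).
Let aff : {poly R} := (2 * M)^-1 *: ('X + M%:P).
Let p n := bernG G n \Po aff.

Let affE x : aff.[x] = (x + M) / (2 * M).
Proof. by rewrite /aff !hornerE mulrC. Qed.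

Let pE n x : (p n).[x] = (bernG G n).[aff.[x]].
Proof. by rewrite /p horner_comp. Qed.

Let M2 : 0 < 2 * M. Proof. by rewrite mulr_gt0. Qed.

Let aff01 x : `|x| <= M -> 0 <= aff.[x] <= 1.
Proof.
rewrite ler_norml affE => /andP[x1 x2].
apply/andP; split; last by rewrite ler_pdivrMr// mul1r; lra.
by apply: divr_ge0; [lra|exact: ltW].
Qed.

Let affK x : 2 * M * aff.[x] - M = x.
Proof. by rewrite affE; field; rewrite gt_eqF. Qed.

Let GK x y : `|G x - G y| <= 2 * M * K * `|x - y|.
Proof.
apply: le_trans (FK _ _) _.
have -> : 2 * M * x - M - (2 * M * y - M) = 2 * M * (x - y) by ring.
by rewrite normrM gtr0_norm// mulrA [K * _]mulrC.
Qed.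

Let K20 : 0 <= 2 * M * K. Proof. by rewrite mulr_ge0// ltW. Qed.

Let p_lip n x y : `|x| <= M -> `|y| <= M -> `|(p n).[x] - (p n).[y]| <= K * `|x - y|.
Proof.
move=> xM yM; rewrite !pE.
apply: (le_trans (bernG_lip GK n (aff01 xM) (aff01 yM))).
rewrite !affE -mulrBl opprD addrACA subrr addr0 normrM [`|(_)^-1|]gtr0_norm ?invr_gt0//.
by rewrite le_eqVlt; apply/orP; left; apply/eqP; field; rewrite gt_eqF.
Qed.

Let p_range n lo hi x : (forall x, lo <= F x <= hi) -> `|x| <= M ->
  lo <= (p n).[x] <= hi.
Proof.
move=> H xM; rewrite pE; apply: bernG_range (aff01 xM) => y; exact: H.
Qed.

Let p_approx e : 0 < e -> exists N, forall n, (N <= n)%N ->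
  forall x, `|x| <= M -> `|(p n).[x] - F x| <= e.
Proof.
move=> e0; have [N HN] := bernG_approx K20 GK e0.
exists N => n /HN Hn x xM; have := Hn _ (aff01 xM).
by rewrite pE /G affK.
Qed.

Lemma lipschitz_poly_approx e : 0 < e -> exists P : {poly R},
  [/\ forall x, `|x| <= M -> `|P.[x] - F x| <= e,
      forall x y, `|x| <= M -> `|y| <= M -> `|P.[x] - P.[y]| <= K * `|x - y| &
      forall lo hi x, (forall x, lo <= F x <= hi) -> `|x| <= M -> lo <= P.[x] <= hi].
Proof.
move=> /p_approx[N HN]; exists (p N); split.
- exact: HN.
- exact: p_lip.
- exact: p_range.
Qed.

Lemma C1_poly_approx (F1 : R -> R) (L e : R) : 0 <= L ->
  (forall x, is_derive x 1 F (F1 x)) ->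
  (forall x y, `|F1 x - F1 y| <= L * `|x - y|) ->
  0 < e -> exists P : {poly R},
  [/\ forall x, `|x| <= M -> `|P.[x] - F x| <= e,
      forall x y, `|x| <= M -> `|y| <= M -> `|P.[x] - P.[y]| <= K * `|x - y| &
      forall x, `|x| <= M -> `|P^`().[x] - F1 x| <= e].
Proof.
move=> L0 dF F1L e0; have [N1 H1] := p_approx e0.
pose G1 s := 2 * M * F1 (2 * M * s - M).
have dG (s : R) : is_derive s 1 G (G1 s).
  pose a : {poly R} := (2 * M) *: 'X - M%:P.
  have aE t : a.[t] = 2 * M * t - M by rewrite !hornerE.
  have da : is_derive s 1 (horner a) (2 * M).
    have := is_derive_poly a s.
    by rewrite derivB derivZ derivX derivC subr0 hornerZ hornerC mulr1.
  have -> : G = F \o horner a by apply/funext => t /=; rewrite aE.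
  rewrite /G1 mulrC -aE; exact: is_derive1_comp.
have G1L x y : `|G1 x - G1 y| <= (2 * M) ^+ 2 * L * `|x - y|.
  rewrite /G1 -mulrBr normrM (gtr0_norm M2).
  have := F1L (2 * M * x - M) (2 * M * y - M).
  have -> : 2 * M * x - M - (2 * M * y - M) = 2 * M * (x - y) by ring.
  rewrite normrM (gtr0_norm M2) => H.
  apply: (le_trans (ler_wpM2l (ltW M2) H)).
  by rewrite le_eqVlt; apply/orP; left; apply/eqP; ring.
have L20 : 0 <= (2 * M) ^+ 2 * L by rewrite mulr_ge0// sqr_ge0.
have [N2 H2] := bernG_deriv_approx L20 dG G1L (mulr_gt0 M2 e0).
exists (p (maxn N1 N2)); split.
- by apply: H1; rewrite leq_maxl.
- exact: p_lip.
- move=> x xM; have := H2 _ (leq_maxr N1 N2) _ (aff01 xM).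
  rewrite /p deriv_comp /G1 affK.
  have -> : aff^`() = (2 * M)^-1%:P.
    by rewrite /aff derivZ derivD derivX derivC addr0 -mul_polyC mulr1.
  rewrite hornerM hornerC horner_comp.
  set z := (bernG G _)^`().[_] => Hz.
  have -> : z / (2 * M) - F1 x = (z - 2 * M * F1 x) / (2 * M).
    by field; rewrite gt_eqF.
  rewrite normrM [`|(_)^-1|]gtr0_norm ?invr_gt0//.
  by rewrite ler_pdivrMr// [e * _]mulrC.
Qed.

End symmetric_interval.
End bernstein.

(** * Integrable functions and Lipschitz maps *)

Section L1_norm.
Context d (E : measurableType d) (R : realType) (mu : probability E R).
Implicit Types (f g h : E -> R).
Local Notation L2 := (Lfun mu 2%:E).
Local Notation intg f := (mu.-integrable [set: E] (EFin \o f)).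
Local Notation meas f := (measurable_fun [set: E] f).

Definition norm1 f : R := \int[mu]_x `|f x|.

Lemma norm1_ge0 f : 0 <= norm1 f.
Proof. by apply: Rintegral_ge0. Qed.

Lemma norm1_le f g : intg f -> intg g -> (forall x, `|f x| <= g x) ->
  norm1 f <= \int[mu]_x g x.
Proof. by move=> If Ig fg; apply: le_Rintegral => //; exact: intg_norm. Qed.

Lemma norm1D f g : intg f -> intg g -> norm1 (f \+ g) <= norm1 f + norm1 g.
Proof.
move=> If Ig; rewrite /norm1 -RintegralD//; [|exact: intg_norm..].
apply: norm1_le => [||x]; [exact: intgD|by apply: intgD; exact: intg_norm|].
exact: ler_normD.
Qed.

Lemma norm1B f g h : intg f -> intg g -> intg h ->
  norm1 (f \- h) <= norm1 (f \- g) + norm1 (g \- h).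
Proof.
move=> If Ig Ih; have := norm1D (intgB If Ig) (intgB Ig Ih).
by congr (norm1 _ <= _); apply/funext => x /=; rewrite addrA subrK.
Qed.

Lemma norm1BC f g : norm1 (f \- g) = norm1 (g \- f).
Proof. by apply: eq_Rintegral => x _ /=; rewrite distrC. Qed.

Lemma norm1Z a f : intg f -> norm1 (a \*o f) = `|a| * norm1 f.
Proof.
move=> If; rewrite /norm1 -RintegralZl//; last exact: intg_norm.
by apply: eq_Rintegral => x _ /=; rewrite normrM.
Qed.

Lemma norm1_ae f g : meas f -> meas g -> f = g %[ae mu] -> norm1 f = norm1 g.
Proof.
move=> mf mg fg; apply: Rint_ae; [exact: measurableT_comp|exact: measurableT_comp|].
by apply: filterS fg => x /= /(_ I) ->.
Qed.

Lemma norm1_eq0 f : intg f -> norm1 f <= 0 -> f = cst 0 %[ae mu].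
Proof.
move=> If f0; have mf : measurable_fun setT (EFin \o f).
  by apply/measurable_EFinP; exact: intg_meas If.
have [+ _] := ae_eq_integral_abs mu measurableT mf.
rewrite (integral_norm_EFin If) (_ : \int[mu]_x _ = 0); last first.
  by apply/eqP; rewrite eq_le norm1_ge0 andbT.
by move=> /(_ erefl); apply: filterS => x /= /(_ I)[].
Qed.

Lemma Lnorm1E f : intg f -> ('N[mu]_1 [EFin \o f] = (norm1 f)%:E)%E.
Proof. by move=> If; rewrite Lnorm1 integral_norm_EFin. Qed.

Lemma Rint_norm1 f : intg f -> `|\int[mu]_x f x| <= norm1 f.
Proof. by move=> If; exact: le_normr_Rintegral. Qed.

Lemma norm1_mulb f g (B : R) : intg f -> meas g -> (forall x, `|g x| <= B) ->
  `|\int[mu]_x (f x * g x)| <= B * norm1 f.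
Proof.
move=> If mg gB; have bg : bounded_fun_on g by exists B.
apply: le_trans (Rint_norm1 (intg_mulb If mg bg)) _.
rewrite /norm1 -RintegralZl//; last exact: intg_norm.
apply: le_Rintegral => //; first exact/intg_norm/intg_mulb.
  exact/intgZ/intg_norm.
by move=> x _; rewrite normrM mulrC ler_wpM2r.
Qed.

Lemma L2_ae_mem f g : meas g -> f = g %[ae mu] -> f \in L2 -> g \in L2.
Proof.
move=> mg fg /L2P[mf If]; apply/L2P; split => //.
have mg2 : measurable_fun setT (EFin \o (fun x => g x ^+ 2)).
  by apply/measurable_EFinP; exact: measurable_funX.
have /integrableP[mf2 If2] := If; apply/integrableP; split => //.
rewrite -(_ : (\int[mu]_x `|(EFin \o (fun x => f x ^+ 2)%R) x| =
  \int[mu]_x `|(EFin \o (fun x => g x ^+ 2)%R) x|)%E)//.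
apply: ae_eq_integral => //; [exact: measurableT_comp|exact: measurableT_comp|].
by apply: filterS fg => x /= /(_ I) ->.
Qed.

Lemma lipschitz_continuous (F : R -> R) (K : R) : 0 <= K ->
  (forall x y, `|F x - F y| <= K * `|x - y|) -> continuous F.
Proof.
move=> K0 FK x; apply/cvgrPdist_lt => e e0.
have K1 : 0 < K + 1 by rewrite ltr_wpDl.
near=> y; apply: le_lt_trans (FK x y) _.
have yx : `|x - y| < e / (K + 1).
  by near: y; apply: cvgr_dist_lt; rewrite ?divr_gt0//; exact: cvg_id.
apply: (@le_lt_trans _ _ ((K + 1) * `|x - y|)); first by rewrite ler_wpM2r// lerDl.
by rewrite mulrC -ltr_pdivlMr.
Unshelve. all: by end_near. Qed.

Lemma L2_lipschitz (F : R -> R) (K : R) f : 0 <= K ->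
  (forall x y, `|F x - F y| <= K * `|x - y|) -> f \in L2 -> (F \o f) \in L2.
Proof.
move=> K0 FK f2; have mF := continuous_measurable_fun (lipschitz_continuous K0 FK).
apply: (L2_le (f := cst `|F 0| \+ K \*o (fun x => `|f x|))).
- by apply: measurableT_comp => //; exact: meas_L2 f2.
- move=> x /=; rewrite [leRHS]ger0_norm ?addr_ge0 ?mulr_ge0//.
  rewrite -[F (f x)](subrK (F 0)) addrC (le_trans (ler_normD _ _))// lerD//.
  by rewrite (le_trans (FK _ _))// subr0.
- by apply: L2D; [exact: L2_cst|exact/L2Z/L2_norm].
Qed.

Lemma Lfun_infty_bounded f : f \in Lfun mu +oo%E ->
  exists2 M : R, 0 <= M & {ae mu, forall x, `|f x| <= M}.
Proof.
rewrite inE => /andP[_]; rewrite inE /= /finite_norm unlock /Lnorm.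
rewrite [X in (0 < X)%E](@probability_setT _ _ _ mu) lte01 => /ess_supr_bounded[M fM].
exists `|M| => //; apply: filterS fM => x /= fM; exact: le_trans fM (ler_norm _).
Qed.

End L1_norm.

(** * Algebras of bounded functions *)

Section clamp.
Context {R : realType}.
Implicit Types M x y : R.

Definition clamp M x : R := Num.max (- M) (Num.min M x).

Lemma clamp_range M x : 0 <= M -> - M <= clamp M x <= M.
Proof.
move=> M0; rewrite /clamp le_max lexx ge_max ge_min lexx !andbT /=; lra.
Qed.

Lemma clamp_norm M x : 0 <= M -> `|clamp M x| <= M.
Proof. by move=> M0; rewrite ler_norml clamp_range. Qed.

Lemma clamp_id M x : `|x| <= M -> clamp M x = x.
Proof.
by rewrite ler_norml /clamp => /andP[x1 x2]; rewrite min_r// max_r.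
Qed.

Lemma clamp_lip M x y : `|clamp M x - clamp M y| <= 1 * `|x - y|.
Proof.
rewrite mul1r /clamp; have [xM|xM] := leP M x; have [yM|yM] := leP M y;
  rewrite ?(min_l xM) ?(min_l yM) ?(min_r (ltW xM)) ?(min_r (ltW yM));
  rewrite /Num.max /Num.min; repeat case: ifPn; rewrite -?leNgt => *;
  rewrite ler_norml; apply/andP; split;
  have := ler_norm (x - y); have := ler_norm (y - x); rewrite (distrC y); lra.
Qed.

Definition unit_trunc x : R := Num.min (Num.max x 0) 1.

Lemma unit_trunc_lip x y : `|unit_trunc x - unit_trunc y| <= 1 * `|x - y|.
Proof.
rewrite mul1r /unit_trunc /Num.max /Num.min; repeat case: ifPn; rewrite -?leNgt => *;
  rewrite ler_norml; apply/andP; split;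
  have := ler_norm (x - y); have := ler_norm (y - x); rewrite (distrC y); lra.
Qed.

End clamp.

Section algebra.
Context d (E : measurableType d) (R : realType) (mu : probability E R).
Variable D : set (E -> R).
Hypotheses (DA : bounded_algebra D) (Dm : forall phi, D phi -> measurable_fun setT phi).
Implicit Types (f g h phi psi chi : E -> R).
Local Notation L2 := (Lfun mu 2%:E).

Lemma alg_cst c : D (cst c). Proof. by case: DA. Qed.

Lemma algD f g : D f -> D g -> D (f \+ g). Proof. by case: DA => _ + _ _; apply. Qed.

Lemma algM f g : D f -> D g -> D (f \* g). Proof. by case: DA => _ _ + _; apply. Qed.

Lemma alg_bounded f : D f -> bounded_fun_on f. Proof. by case: DA => _ _ _; apply. Qed.

Lemma algZ a f : D f -> D (a \*o f).
Proof. by move=> Df; apply: (algM (alg_cst a) Df). Qed.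

Lemma algB f g : D f -> D g -> D (f \- g).
Proof.
move=> Df Dg; have := algD Df (algZ (-1) Dg).
by congr (D _); apply/funext => x /=; rewrite mulN1r.
Qed.

Lemma alg_poly (p : {poly R}) f : D f -> D (fun x => p.[f x]).
Proof.
move=> Df; elim/poly_ind: p => [|p c IH].
  have := alg_cst 0; congr (D _); apply/funext => x /=; by rewrite horner0.
have := algD (algM IH Df) (alg_cst c).
by congr (D _); apply/funext => x /=; rewrite hornerMXaddC.
Qed.

Lemma alg_L2 f : D f -> f \in L2.
Proof. by move=> Df; apply: L2_bounded; [exact: Dm|exact: alg_bounded]. Qed.

Lemma alg_bound f : D f -> exists2 M : R, 0 < M & forall x, `|f x| <= M.
Proof.
move=> /alg_bounded[M fM]; exists (`|M| + 1); first by rewrite ltr_wpDl.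
by move=> x; rewrite (le_trans (fM x))// (le_trans (ler_norm _))// lerDl.
Qed.

Lemma ip_le f g : f \in L2 -> g \in L2 -> (forall x, `|f x| <= `|g x|) ->
  ip mu f f <= ip mu g g.
Proof.
move=> f2 g2 fg; apply: le_Rintegral => //; [exact: L2_intgM|exact: L2_intgM|].
by move=> x _; rewrite -!expr2 -[leLHS]real_normK ?num_real// -[leRHS]real_normK
  ?num_real// lerXn2r ?nnegrE.
Qed.

Lemma ip_cst (c : R) : ip mu (cst c) (cst c) = c ^+ 2.
Proof. by rewrite /ip /= Rint_cst expr2. Qed.

(** Polynomials in an element of the algebra, chosen by [lipschitz_poly_approx],
    replace its truncations. *)
Lemma alg_lipschitz (F : R -> R) (K e : R) f : 0 <= K -> 0 < e ->
  (forall x y, `|F x - F y| <= K * `|x - y|) -> D f ->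
  exists g, [/\ D g, forall x, `|g x - F (f x)| <= e,
     forall x y, `|g x - g y| <= K * `|f x - f y| &
     forall lo hi, (forall x, lo <= F x <= hi) -> forall x, lo <= g x <= hi].
Proof.
move=> K0 e0 FK Df; have [M M0 fM] := alg_bound Df.
have [p [p1 p2 p3]] := lipschitz_poly_approx K0 M0 FK e0.
exists (fun x => p.[f x]); split.
- exact: alg_poly.
- by move=> x; apply: p1.
- by move=> x y; apply: p2.
- by move=> lo hi H x; apply: p3.
Qed.

Hypothesis (Dd : L2_dense mu D).

(** The [L^2]-approximant given by density may exceed the bound of [f]; composing
    it with a polynomial close to the truncation [clamp M] restores the bound
    and does not increase the distance to [f] by much. *)
Lemma alg_dense_bounded f (M e : R) : f \in L2 -> 0 <= M -> (forall x, `|f x| <= M) ->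
  0 < e -> exists chi, [/\ D chi, forall x, `|chi x| <= M &
    ip mu (chi \- f) (chi \- f) < e].
Proof.
move=> f2 M0 fM e0; have lP := L2form_positive mu.
have e4 : 0 < e / 8 by lra.
have [g Dg gf] := Dd f2 (ltac:(by rewrite sqrtr_gt0) : 0 < Num.sqrt (e / 8)).
have g2 := alg_L2 Dg.
rewrite Lnorm2_lt ?sqrtr_gt0// in gf; last exact: L2B.
rewrite sqr_sqrtr ?ltW// in gf.
have {}gf : ip mu (g \- f) (g \- f) < e / 8.
  by have := form_sqBC lP f2 g2; rewrite /= => <-.
have se4 : 0 < Num.sqrt (e / 8) by rewrite sqrtr_gt0.
have [h [Dh hg _ hM]] := alg_lipschitz ler01 se4 (@clamp_lip R M) Dg.
exists h; split => //.
  by move=> x; rewrite ler_norml; apply: hM => y; exact: clamp_range.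
have h2 := alg_L2 Dh.
have c2 : (fun x => Num.sqrt (e / 8) + `|g x - f x|) \in L2.
  have := L2D (L2_cst mu (Num.sqrt (e / 8))) (L2_norm (L2B g2 f2)).
  by [].
have hf x : `|(h \- f) x| <= `|Num.sqrt (e / 8) + `|g x - f x| |.
  rewrite [leRHS]ger0_norm ?addr_ge0 ?sqrtr_ge0//=.
  have -> : h x - f x = (h x - clamp M (g x)) + (clamp M (g x) - clamp M (f x)).
    by rewrite [clamp M (f x)]clamp_id//; ring.
  rewrite (le_trans (ler_normD _ _))// lerD//.
  by rewrite (le_trans (clamp_lip _ _ _))// mul1r.
apply: le_lt_trans (ip_le (L2B h2 f2) c2 hf) _.
have := form_sqD_le lP (L2_cst mu (Num.sqrt (e / 8))) (L2_norm (L2B g2 f2)).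
rewrite [X in 2 * X + _]/= ip_cst sqr_sqrtr; last exact: ltW.
have -> : L2form mu (fun x => `|(g \- f) x|) (fun x => `|(g \- f) x|) =
    ip mu (g \- f) (g \- f).
  by apply: eq_Rintegral => x _ /=; rewrite -normrM ger0_norm// -expr2 sqr_ge0.
move=> H; apply: (le_lt_trans H); lra.
Qed.

(** The integral of [`|f|] is nearly that of [f] against the continuous sign
    [clamp 1 (k * f)] for large [k], and this sign is an [L^2]-limit of elements
    of the unit ball of the algebra. *)
Lemma alg_L1_norm f C : f \in L2 ->
  (forall chi, D chi -> (forall x, `|chi x| <= 1) -> ip mu f chi <= C) ->
  norm1 mu f <= C.
Proof.
move=> f2 H; have lP := L2form_positive mu; have mf := meas_L2 f2.
apply/ler_addgt0Pr => e e0.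
pose k := 2 / e; have k0 : 0 < k by rewrite divr_gt0.
pose s x := clamp 1 (k * f x).
have ms : measurable_fun setT s.
  apply: measurable_maxr => //; apply: measurable_minr => //.
  exact: measurable_funM.
have s1 x : `|s x| <= 1 by apply: clamp_norm.
have s2 : s \in L2 by apply: L2_bounded => //; exists 1.
have fs x : `|f x| <= f x * s x + e / 2.
  have e2k : (e / 2) * k = 1 by rewrite /k; field; rewrite gt_eqF.
  rewrite /s; have [kf|] := leP `|k * f x| 1.
    rewrite clamp_id//; apply: (@le_trans _ _ (e / 2)).
      by rewrite -(ler_pM2r k0) e2k -[X in _ * X <= _]gtr0_norm// -normrM mulrC.
    by rewrite lerDr mulrCA mulr_ge0 ?(ltW k0)// -expr2 sqr_ge0.
  rewrite ltr_normr => /orP[kf|kf].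
    rewrite /clamp min_l ?ltW// max_r ?mulr1; last by lra.
    have f0 : 0 < f x by rewrite -(pmulr_rgt0 _ k0); lra.
    rewrite gtr0_norm//; lra.
  have kf1 : k * f x < -1 by lra.
  have f0 : f x < 0 by rewrite -(pmulr_rlt0 _ k0); lra.
  rewrite /clamp min_r; last by lra.
  rewrite max_l ?ltW// ltr0_norm//; lra.
have HC : ip mu f s <= C + e / 2.
  pose t := e / (2 * (ip mu f f + 1)).
  have f0 := ip_ge0 mu f.
  have f10 : 0 < ip mu f f + 1 by rewrite ltr_wpDl.
  have t0 : 0 < t by rewrite divr_gt0// mulr_gt0.
  have te0 : 0 < t * (e / 2) by rewrite mulr_gt0// divr_gt0.
  have [chi [Dchi chi1 chis]] := alg_dense_bounded s2 ler01 s1 te0.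
  have c2 := alg_L2 Dchi; have cs2 := L2B c2 s2.
  have Y := form_young lP t0 f2 cs2.
  have -> : ip mu f s = ip mu f chi - L2form mu f (chi \- s).
    by rewrite (bformBr lP)//=; ring.
  have Hc := H _ Dchi chi1.
  have Y1 : t * L2form mu f f <= e / 2.
    have -> : t * L2form mu f f = e / 2 * (ip mu f f / (ip mu f f + 1)).
      by rewrite /t /=; field; rewrite gt_eqF.
    apply: ler_piMr; first by rewrite divr_ge0// ltW.
    by rewrite ler_pdivrMr// mul1r lerDl.
  have Y2 : t^-1 * L2form mu (chi \- s) (chi \- s) <= e / 2.
    by rewrite ler_pdivrMl// ltW.
  have := ler_norm (- L2form mu f (chi \- s)); rewrite normrN.
  move: Y Y1 Y2 Hc.
  move: (L2form mu f (chi \- s)) (t * _) (t^-1 * _) (ip mu f chi) => *; lra.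
have I2 : mu.-integrable setT (EFin \o (fun x => f x * s x + e / 2)).
  by apply: intgD; [exact: L2_intgM|exact: intg_cst].
have := le_Rintegral measurableT (intg_norm (L2_intg f2)) I2 (fun x _ => fs x).
rewrite RintegralD//; [|exact: L2_intgM|exact: intg_cst].
rewrite Rint_cst => /le_trans; apply; move: HC; rewrite /ip; lra.
Qed.

Lemma alg_test_ae f g : f \in L2 -> g \in L2 ->
  (forall chi, D chi -> ip mu f chi = ip mu g chi) -> f = g %[ae mu].
Proof.
move=> f2 g2 H; have fg2 := L2B f2 g2; have lP := L2form_positive mu.
suff /(norm1_eq0 (L2_intg fg2)) : norm1 mu (f \- g) <= 0.
  by apply: filterS => x /= /[apply] /eqP; rewrite subr_eq0 => /eqP.
apply: alg_L1_norm => // chi Dchi _; have c2 := alg_L2 Dchi.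
by have := bformBl lP f2 g2 c2; rewrite /= => ->; rewrite H// subrr.
Qed.

End algebra.

(** * Test functions and smooth bumps *)

Section test_functions.
Context {R : realType}.
Implicit Types (f F G : R -> R) (a b x y z : R).

Lemma derivable_is_derive f x : derivable f x 1 -> is_derive x 1 f (derive1 f x).
Proof. by move=> df; rewrite derive1E; exact: derivableP. Qed.

Lemma is_derive_continuous f f1 : (forall x, is_derive x 1 f (f1 x)) -> continuous f.
Proof.
move=> df x; apply: differentiable_continuous; apply/derivable1_diffP.
by have [] := df x.
Qed.

Lemma is_derive_lipschitz_on f f1 (M K : R) : (forall x, is_derive x 1 f (f1 x)) ->
  (forall x, `|x| <= M -> `|f1 x| <= K) ->
  forall x y, `|x| <= M -> `|y| <= M -> `|f x - f y| <= K * `|x - y|.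
Proof.
move=> df fK x y; wlog xy : x y / x <= y.
  move=> H xM yM; have [xy|/ltW yx] := leP x y; first exact: H.
  by rewrite distrC [`|x - y|]distrC; exact: H.
move=> xM yM.
have cf : {within `[x, y], continuous f}.
  exact/continuous_subspaceT/(is_derive_continuous df).
have [c cxy E1] := MVT_segment xy (fun z _ => df z) cf.
rewrite distrC [`|x - y|]distrC E1 normrM ler_wpM2r// fK//.
move: cxy xM yM; rewrite in_itv /= !ler_norml => /andP[xc cy] /andP[Mx _] /andP[_ yM].
by rewrite (le_trans Mx)// (le_trans cy).
Qed.

Lemma is_derive_lipschitz f f1 K : (forall x, is_derive x 1 f (f1 x)) ->
  (forall x, `|f1 x| <= K) -> forall x y, `|f x - f y| <= K * `|x - y|.
Proof.
move=> df fK x y; apply: (@is_derive_lipschitz_on f f1 (Num.max `|x| `|y|)) => //.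
  by rewrite le_max lexx.
by rewrite le_max lexx orbT.
Qed.

Lemma vanish_bounded f (B : R) : 0 <= B -> continuous f ->
  (forall x, B < `|x| -> f x = 0) -> exists2 K : R, 0 <= K & forall x, `|f x| <= K.
Proof.
move=> B0 cf f0; have cn : {within `[- B, B], continuous (fun x => `|f x|)}.
  apply/continuous_subspaceT => x; apply: cvg_norm; exact: cf.
have BB : - B <= B by rewrite (le_trans _ B0)// oppr_le0.
have [c _ Hc] := EVT_max BB cn.
exists `|f c| => // x; have [xB|xB] := leP `|x| B.
  by apply: Hc; rewrite in_itv /= -ler_norml.
by rewrite f0// normr0.
Qed.

Lemma closed_vanish_derive (S : set R) f f1 : closed S ->
  (forall x, is_derive x 1 f (f1 x)) -> (forall x, ~ S x -> f x = 0) ->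
  forall x, ~ S x -> f1 x = 0.
Proof.
move=> cS df f0 x Sx.
have H : \near x, f x = cst 0 x.
  by have : \near x, (~` S) x by [apply: open_nbhs_nbhs; split => //; exact: closed_openC];
     apply: filterS => y /f0.
have := near_eq_is_derive H (df x) => -[_ <-]; exact: derive_cst.
Qed.

(** This much regularity lets polynomials approximate [F] and [F1] at once. *)
Definition lipschitz_C1 (K : R) F F1 : Prop :=
  [/\ 0 <= K, forall x, is_derive x 1 F (F1 x), forall x, `|F1 x| <= K &
      forall x y, `|F1 x - F1 y| <= K * `|x - y|].

(** All derivatives vanish off the support, which is bounded, so that the first
    two are bounded by continuity. *)
Lemma test_function_C1 F : test_function F -> exists F1 : R -> R, exists K0 : R,
  [/\ 0 <= K0, forall K, K0 <= K -> lipschitz_C1 K F F1 &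
      forall x, ~ fun_support F x -> F1 x = 0].
Proof.
move=> [dF cS]; have clS : closed (fun_support F) by exact: closed_closure.
have d0 x : is_derive x 1 F ((derive1 F) x) by apply: derivable_is_derive; exact: (dF 0%N).
have d1 x : is_derive x 1 (derive1 F) (derive1n 2 F x).
  by apply: derivable_is_derive; exact: (dF 1%N).
have d2 x : is_derive x 1 (derive1n 2 F) (derive1n 3 F x).
  by apply: derivable_is_derive; exact: (dF 2%N).
have S0 x : ~ fun_support F x -> F x = 0.
  move=> Sx; apply/eqP; apply: contraT => Fx; exfalso; apply: Sx.
  exact: subset_closure.
have S1 := closed_vanish_derive clS d0 S0; have S2 := closed_vanish_derive clS d1 S1.
have [B [_ HB]] := compact_bounded cS.
pose B' := `|B| + 1; have B'0 : 0 <= B' by rewrite addr_ge0.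
have BB' : B < B' by rewrite (le_lt_trans (ler_norm B))// ltrDl.
have out x : B' < `|x| -> ~ fun_support F x.
  by move=> xB /(HB _ BB') /=; rewrite leNgt xB.
have [K1 K10 HK1] := vanish_bounded B'0 (is_derive_continuous d1) (fun x xB => S1 x (out x xB)).
have [K2 K20 HK2] := vanish_bounded B'0 (is_derive_continuous d2) (fun x xB => S2 x (out x xB)).
exists (derive1 F), (Num.max K1 K2); split => //; first by rewrite le_max K10.
move=> K; rewrite ge_max => /andP[K1K K2K]; split => //.
- exact: le_trans K10 K1K.
- by move=> x; exact: le_trans (HK1 x) K1K.
- move=> x y; apply: le_trans (is_derive_lipschitz d1 HK2 x y) _.
  by rewrite ler_wpM2r.
Qed.

(** The family is stable under differentiation, [flat_next] being the induced map
    on polynomials; this makes each of its members smooth. *)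
Definition flat (p : {poly R}) x : R :=
  if 0 < x then p.[x^-1] * expR (- x^-1) else 0.

Definition flat_next (p : {poly R}) : {poly R} := 'X^2 * (p - p^`()).

Lemma horner_growth (p : {poly R}) : exists2 C : R, 0 <= C &
  forall t, 1 <= t -> `|p.[t]| <= C * t ^+ size p.
Proof.
exists (\sum_(i < size p) `|p`_i|); first by apply: sumr_ge0.
move=> t t1; rewrite horner_coef mulr_suml (le_trans (ler_norm_sum _ _ _))//.
apply: ler_sum => i _; rewrite normrM ler_wpM2l// normrX ger0_norm ?(le_trans ler01)//.
by rewrite ler_weXn2l// ltnW.
Qed.

(** The exponential beats every power of [x^-1]. The exponent two is what makes
    [flat p] differentiable at the origin with derivative zero. *)
Lemma flat_small (p : {poly R}) : exists2 C : R, 0 <= C &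
  forall x, `|x| <= 1 -> `|flat p x| <= C * x ^+ 2.
Proof.
have [C C0 HC] := horner_growth p; pose m := size p.
exists (C * (m.+2)`!%:R); first by rewrite mulr_ge0.
move=> x x1; rewrite /flat; case: ifPn => [x0|_]; last first.
  by rewrite normr0 mulr_ge0 ?sqr_ge0// mulr_ge0.
have t0 : 0 < x^-1 by rewrite invr_gt0.
have t1 : 1 <= x^-1 by rewrite invf_ge1// -[x]gtr0_norm.
rewrite normrM [`|expR _|]gtr0_norm ?expR_gt0// expRN.
have ex : x^-1 ^+ m.+2 / (m.+2)`!%:R <= expR x^-1.
  by apply: le_trans (expR_ge1Dxn m.+1 (ltW t0)); rewrite lerDr.
have fp : (0 : R) < (m.+2)`!%:R by rewrite ltr0n fact_gt0.
have q0 : 0 < x^-1 ^+ m.+2 / (m.+2)`!%:R by rewrite divr_gt0// exprn_gt0.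
have ei : (expR x^-1)^-1 <= (m.+2)`!%:R * x ^+ m.+2.
  apply: (@le_trans _ _ (x^-1 ^+ m.+2 / (m.+2)`!%:R)^-1).
    by rewrite lef_pV2 ?posrE// expR_gt0.
  by rewrite invf_div exprVn invrK.
apply: (@le_trans _ _ (C * x^-1 ^+ m * ((m.+2)`!%:R * x ^+ m.+2))).
  by apply: ler_pM => //; rewrite ?invr_ge0 ?(ltW (expR_gt0 _)) ?HC.
rewrite le_eqVlt; apply/orP; left; apply/eqP.
have xm : x^-1 ^+ m * x ^+ m = 1 by rewrite -exprMn mulVf ?gt_eqF// expr1n.
have -> : x ^+ m.+2 = x ^+ m * x ^+ 2 by rewrite -exprD addn2.
transitivity (C * (m.+2)`!%:R * (x^-1 ^+ m * x ^+ m) * x ^+ 2); first by ring.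
by rewrite xm mulr1.
Qed.

Lemma quadratic_is_derive0 f (C : R) : 0 <= C ->
  (forall x, `|x| <= 1 -> `|f x| <= C * x ^+ 2) -> is_derive (0 : R) 1 f 0.
Proof.
move=> C0 Hf.
have f0 : f 0 = 0.
  apply/eqP; rewrite -normr_le0; have := Hf 0; rewrite normr0 expr0n mulr0.
  by apply; exact: ler01.
have c : h^-1 *: (f (h *: 1 + 0) - f 0) @[h --> 0^'] --> (0 : R).
  apply/cvgrPdist_lt => e e0; near=> h.
  have h1 : `|h| <= 1.
    by near: h; apply: dnbhs0_le; exact: ltr01.
  have hn0 : h != 0 by near: h; exact: nbhs_dnbhs_neq.
  have he : `|h| < e / (C + 1).
    by near: h; apply: dnbhs0_lt; rewrite divr_gt0// ltr_wpDl.
  rewrite f0 subr0 addr0 sub0r normrN /= [h *: 1]mulr1.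
  rewrite normrM normfV ltr_pdivrMl ?normr_gt0//.
  apply: le_lt_trans (Hf _ h1) _.
  rewrite -[h ^+ 2]real_normK ?num_real// expr2 mulrCA ltr_pM2l ?normr_gt0//.
  apply: (@le_lt_trans _ _ ((C + 1) * `|h|)); first by rewrite ler_wpM2r// lerDl.
  by rewrite mulrC -ltr_pdivlMr// ltr_wpDl.
apply: DeriveDef; first by apply/cvg_ex; exists 0.
exact: (cvg_lim _ c).
Unshelve. all: by end_near. Qed.

Lemma is_derive_flat (p : {poly R}) x : is_derive x 1 (flat p) (flat (flat_next p) x).
Proof.
have [x0|x0|->] := ltgtP x 0.
- have -> : flat (flat_next p) x = 0 by rewrite /flat ltNge (ltW x0).
  suff H : \near x, (cst 0 : R -> R) x = flat p x.
    exact: near_eq_is_derive H (is_derive_cst _ _ _).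
  near=> y; have : y < 0 by near: y; exact: lt_nbhsl.
  by rewrite /flat => y0; rewrite ltNge (ltW y0).
- have xn0 : x != 0 by rewrite gt_eqF.
  have H : \near x, ((horner p \o @GRing.inv R) * (expR \o (fun y => - y^-1))) x
      = flat p x.
    near=> y; have y0 : 0 < y by near: y; exact: lt_nbhsr.
    by rewrite /flat y0.
  have dV : is_derive x 1 (@GRing.inv R) (- x ^- 2).
    have dV := @is_deriveV R id x 1 1 xn0 (is_derive_id _ _).
    by rewrite -[- x ^- 2]mulr1; exact: dV.
  have dVN : is_derive x 1 (fun y => - y^-1) (x ^- 2).
    by rewrite -[x ^- 2]opprK; exact: is_deriveN dV.
  have d1 := is_derive1_comp (is_derive_poly p x^-1) dV.
  have d2 := @is_derive1_comp R expR (fun y => - y^-1) x _ _ (is_derive_expR _) dVN.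
  apply: (near_eq_is_derive H); apply: is_derive_eq (is_deriveM d1 d2) _.
  rewrite /flat x0 /flat_next hornerM hornerXn hornerD hornerN /=.
  rewrite /GRing.scale /= -exprVn; ring.
- have -> : flat (flat_next p) 0 = 0 by rewrite /flat ltxx.
  have [C C0 HC] := flat_small p; exact: quadratic_is_derive0 C0 HC.
Unshelve. all: by end_near. Qed.

(** The derivatives of [smooth_bump] remain in the span of the products of a flat
    function at [a] and a reflected one at [b]; the list holds the terms. *)
Definition bsum a b (s : seq ({poly R} * {poly R})) x : R :=
  foldr (fun pq r => flat pq.1 (x - a) * flat pq.2 (b - x) + r) 0 s.

Fixpoint bsum_next (s : seq ({poly R} * {poly R})) :=
  if s is (p, r) :: s' then
    [:: (flat_next p, r), (p, - flat_next r) & bsum_next s'] else [::].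

Lemma is_derive_bsum a b s x : is_derive x 1 (bsum a b s) (bsum a b (bsum_next s) x).
Proof.
elim: s => [|[p r] s IH]; first exact: is_derive_cst.
have dl : is_derive x 1 (fun y => y - a) 1.
  rewrite -[X in is_derive _ _ _ X]subr0.
  exact: (is_deriveB (is_derive_id x 1) (is_derive_cst a x 1)).
have dr : is_derive x 1 (fun y => b - y) (- 1).
  rewrite -[X in is_derive _ _ _ X]sub0r.
  exact: (is_deriveB (is_derive_cst b x 1) (is_derive_id x 1)).
have d1 := @is_derive1_comp R (flat p) (fun y => y - a) x _ _ (is_derive_flat p _) dl.
have d2 := @is_derive1_comp R (flat r) (fun y => b - y) x _ _ (is_derive_flat r _) dr.
have := is_deriveD (is_deriveM d1 d2) IH => d3; apply: is_derive_eq d3 _ => /=.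
have flatN (t : {poly R}) y : flat (- t) y = - flat t y.
  by rewrite /flat; case: ifP => _; rewrite ?oppr0// hornerN mulNr.
by rewrite flatN /GRing.scale /=; ring.
Qed.

Definition smooth_bump a b x : R := flat 1 (x - a) * flat 1 (b - x).

Lemma flat1_ge0 x : 0 <= flat 1 x.
Proof. by rewrite /flat; case: ifP => // _; rewrite hornerC mul1r ltW// expR_gt0. Qed.

Lemma flat1_gt0 x : 0 < x -> 0 < flat 1 x.
Proof. by move=> x0; rewrite /flat x0 hornerC mul1r expR_gt0. Qed.

Lemma flat1_le x y : 0 < x -> x <= y -> flat 1 x <= flat 1 y.
Proof.
move=> x0 xy; have y0 := lt_le_trans x0 xy.
by rewrite /flat x0 y0 !hornerC !mul1r ler_expR lerN2 lef_pV2.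
Qed.

Lemma smooth_bump_ge0 a b x : 0 <= smooth_bump a b x.
Proof. by rewrite mulr_ge0 ?flat1_ge0. Qed.

Lemma smooth_bump_ge a b (h x : R) : 0 < h -> a + h <= x -> x <= b - h ->
  flat 1 h ^+ 2 <= smooth_bump a b x.
Proof.
move=> h0 ax xb; rewrite expr2 ler_pM ?flat1_ge0// flat1_le//; lra.
Qed.

Lemma smooth_bump_support a b : fun_support (smooth_bump a b) `<=` `[a, b]%classic.
Proof.
have cl : closed `[a, b]%classic by exact: interval_closed.
rewrite /fun_support [X in _ `<=` X](closure_id _).1//; apply: closureS.
move=> y /=; rewrite in_itv /= /smooth_bump /flat.
case: ifPn => [|_]; last by rewrite mul0r eqxx.
case: ifPn => [|_]; last by rewrite mulr0 eqxx.
by rewrite !subr_gt0 => yb ay _; rewrite !ltW.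
Qed.

Lemma smooth_bump_test_function a b : test_function (smooth_bump a b).
Proof.
split.
  have E1 n : derive1n n (smooth_bump a b) = bsum a b (iter n bsum_next [:: (1, 1)]).
    elim: n => [|n IH]; first by apply/funext => x; rewrite /= addr0.
    rewrite derive1nS IH; apply/funext => x; rewrite derive1E.
    by have [_ ->] := is_derive_bsum a b (iter n bsum_next [:: (1, 1)]) x.
  move=> n x; rewrite E1.
  by have [] := is_derive_bsum a b (iter n bsum_next [:: (1, 1)]) x.
apply: (subclosed_compact _ (@segment_compact _ a b)); last exact: smooth_bump_support.
exact: closed_closure.
Qed.

End test_functions.

Section large.
Context {R : realType}.
(** When [x] and [y] are more than [4 h] apart, some pair of bumps has increments
    whose product is negative and bounded away from zero; disjointness of the
    supports keeps the other products nonpositive, so that nothing cancels.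
    Points closer than this are left to the quadratic term. *)
Lemma large_increment (M h : R) : 0 < M -> 0 < h ->
  exists N : nat, exists a b : nat -> R, exists C : R, [/\ 0 <= C,
    forall i, a i < b i &
    forall x y, `|x| <= M -> `|y| <= M ->
    (x - y) ^+ 4 <= 16 * h ^+ 2 * (x - y) ^+ 2 +
     C * \sum_(i < N) - ((smooth_bump (- M - h) (a i) x - smooth_bump (- M - h) (a i) y) *
        (smooth_bump (b i) (M + h) x - smooth_bump (b i) (M + h) y))].
Proof.
move=> M0 h0.
pose t (i : nat) : R := - M + i%:R * h.
(* The interval [-M, M] is cut with mesh [h]. If [x] is in the [i]-th cell and
   [y > x + 4 h], then [x] is at least [h] to the left of [a i] and [y] at least
   [h] to the right of [b i], so that both bumps are at least [c] there. *)
pose a i := t i + 2 * h; pose b i := t i + 3 * h.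
pose N := (Num.truncn (2 * M / h)).+1.
pose c : R := flat 1 h ^+ 2.
have c0 : 0 < c by rewrite exprn_gt0// flat1_gt0.
pose C := (2 * M) ^+ 4 / c ^+ 2.
have C0 : 0 <= C by rewrite divr_ge0// exprn_ge0// ?ltW// mulr_gt0.
have ab i : a i < b i by rewrite /a /b; lra.
exists N, a, b, C; split => // x y xM yM.
pose F i := smooth_bump (- M - h) (a i); pose G i := smooth_bump (b i) (M + h).
have disj i z : F i z * G i z = 0.
  have [za|za] := leP (a i) z.
    by rewrite /F /smooth_bump /flat [0 < a i - z]ltNge subr_le0 za /= mulr0 mul0r.
  have zb : z < b i := lt_trans za (ab i).
  by rewrite /G /smooth_bump /flat [0 < z - b i]ltNge subr_le0 (ltW zb) /= mul0r mulr0.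
have termE i : - ((F i x - F i y) * (G i x - G i y)) = F i x * G i y + F i y * G i x.
  have -> : - ((F i x - F i y) * (G i x - G i y)) =
     F i x * G i y + F i y * G i x - F i x * G i x - F i y * G i y by ring.
  by rewrite !disj !subr0.
have term0 i : 0 <= F i x * G i y + F i y * G i x.
  by rewrite addr_ge0// mulr_ge0// smooth_bump_ge0.
rewrite (eq_bigr (fun i : 'I_N => F i x * G i y + F i y * G i x)); last by move=> i _; exact: termE.
have [small|large] := leP `|x - y| (4 * h).
  have s2 : (x - y) ^+ 2 <= 16 * h ^+ 2.
    have -> : 16 * h ^+ 2 = (4 * h) ^+ 2 by ring.
    by rewrite -[leLHS]real_normK ?num_real// lerXn2r ?nnegrE// mulr_ge0// ltW.
  apply: (@le_trans _ _ (16 * h ^+ 2 * (x - y) ^+ 2)).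
    by rewrite -[4%N]/(2 + 2)%N exprD ler_wpM2r ?sqr_ge0.
  by rewrite lerDl mulr_ge0// sumr_ge0.
have key z z' : `|z| <= M -> `|z'| <= M -> 4 * h < z' - z ->
    exists i : 'I_N, c ^+ 2 <= F i z * G i z'.
  rewrite !ler_norml => /andP[z1 z2] /andP[z1' z2'] zz'.
  have zM0 : 0 <= (z + M) / h by rewrite divr_ge0 ?(ltW h0)//; lra.
  have iN : (Num.truncn ((z + M) / h) < N)%N.
    rewrite ltnS; apply: le_truncn; rewrite ler_pM2r ?invr_gt0//; lra.
  exists (Ordinal iN) => /=; set i := Num.truncn _.
  have /andP[i1 i2] : i%:R <= (z + M) / h < i.+1%:R by exact: truncn_itv.
  have ti1 : t i <= z by move: i1; rewrite ler_pdivlMr// /t; lra.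
  have ti2 : z <= t i + h.
    by move: i2; rewrite ltr_pdivrMr// -natr1 mulrDl mul1r /t; lra.
  rewrite expr2 ler_pM ?(ltW c0)//; apply: smooth_bump_ge => //; rewrite /a /b; lra.
have pow4 : (x - y) ^+ 4 <= (2 * M) ^+ 4.
  rewrite -[4%N]/(2 * 2)%N !exprM lerXn2r ?nnegrE ?sqr_ge0//.
  rewrite -[leLHS]real_normK ?num_real// lerXn2r ?nnegrE//; first by rewrite ltW// mulr_gt0.
  by rewrite (le_trans (ler_normB _ _))// mulr_natl mulr2n lerD.
have [i ci] : exists i : 'I_N, c ^+ 2 <= F i x * G i y + F i y * G i x.
  have := large; rewrite ltr_normr => /orP[xy|xy].
    have [i ci] := key y x yM xM xy; exists i; rewrite (le_trans ci)// lerDr.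
    by rewrite mulr_ge0// smooth_bump_ge0.
  have [|i ci] := key x y xM yM; first by rewrite -opprB.
  by exists i; rewrite (le_trans ci)// lerDl mulr_ge0// smooth_bump_ge0.
apply: (le_trans pow4); rewrite -[leLHS]add0r lerD//.
  by rewrite mulr_ge0 ?sqr_ge0// mulr_ge0// sqr_ge0.
rewrite -[leLHS](divfK (lt0r_neq0 (exprn_gt0 2 c0))) -/C ler_wpM2l//.
apply: (le_trans ci); rewrite (bigD1 i)//= lerDl sumr_ge0// => j _; exact: term0.
Qed.

End large.

(** * The limit form on the algebra *)

Section bounded_measurable.
Context d (T : measurableType d) (R : realType) (P : probability T R).
Implicit Types (h k : T -> R).

Definition bmeas h := measurable_fun setT h /\ bounded_fun_on h.

Lemma bmeas_intg h : bmeas h -> P.-integrable setT (EFin \o h).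
Proof. by move=> [mh bh]; exact: intg_bounded. Qed.

Lemma bmeas_cst (c : R) : bmeas (fun=> c).
Proof. by split; [exact: measurable_cst|exists `|c|]. Qed.

Lemma bmeasD h k : bmeas h -> bmeas k -> bmeas (fun w => h w + k w).
Proof.
move=> [mh [H hH]] [mk [K kK]]; split; first exact: measurable_funD.
by exists (H + K) => x; rewrite (le_trans (ler_normD _ _))// lerD.
Qed.

Lemma bmeasM h k : bmeas h -> bmeas k -> bmeas (fun w => h w * k w).
Proof.
move=> [mh [H hH]] [mk [K kK]]; split; first exact: measurable_funM.
by exists (H * K) => x; rewrite normrM ler_pM.
Qed.

Lemma bmeasB h k : bmeas h -> bmeas k -> bmeas (fun w => h w - k w).
Proof.
move=> bh bk; have := bmeasD bh (bmeasM (bmeas_cst (-1)) bk).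
by congr bmeas; apply/funext => w; rewrite mulN1r.
Qed.

Lemma bmeasX h n : bmeas h -> bmeas (fun w => h w ^+ n).
Proof.
move=> bh; elim: n => [|n IH].
  by have := bmeas_cst 1; congr bmeas; apply/funext => w; rewrite expr0.
by have := bmeasM bh IH; congr bmeas; apply/funext => w; rewrite exprS.
Qed.

Lemma Rint_linear (a b : R) h k : bmeas h -> bmeas k ->
  \int[P]_w (a * h w + b * k w) = a * \int[P]_w h w + b * \int[P]_w k w.
Proof.
move=> bh bk; rewrite -!RintegralZl//; try exact: bmeas_intg.
rewrite -RintegralD//; first exact/intgZ/bmeas_intg.
exact/intgZ/bmeas_intg.
Qed.

End bounded_measurable.

Section limit_form.
Context (R : realType) (dO dE : measure_display)
    (Omega : measurableType dO) (E : measurableType dE)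
    (P : probability Omega R) (mu : probability E R)
    (Y : {RV P >-> E}) (Yn : nat -> {RV P >-> E})
    (alpha : nat -> R) (alpha_gt0 : forall n, 0 < alpha n).
Variables (D : set (E -> R)) (A : (E -> R) -> E -> R).
Local Notation L2 := (Lfun mu 2%:E).
Hypotheses (DA : bounded_algebra D)
  (Dm : forall phi, D phi -> measurable_fun setT phi)
  (Dd : L2_dense mu D).
Hypothesis HA : forall phi, D phi -> A phi \in L2 /\
  forall chi, D chi ->
    alpha n * \int[P]_w ((phi (Yn n w) - phi (Y w)) * (chi (Yn n w) - chi (Y w)))
      @[n --> \oo] --> - 2 * \int[mu]_y (A phi y * chi y).
Implicit Types (f g h phi psi chi u v : E -> R) (X Z : Omega -> R).

Local Notation q := (BForm D (limit_form P Y Yn alpha)).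
Local Notation ip := (ip mu).
Local Notation lP := (L2form_positive mu).

Definition expect (n : nat) (h : Omega -> R) : R := alpha n * \int[P]_w h w.

Definition incr n f (w : Omega) : R := f (Yn n w) - f (Y w).
Definition avg n f (w : Omega) : R := (f (Yn n w) + f (Y w)) / 2.

Lemma bmeas_comp f (V : {RV P >-> E}) : measurable_fun setT f -> bounded_fun_on f ->
  bmeas (fun w => f (V w)).
Proof.
move=> mf [M fM]; split; last by exists M => w.
by apply: measurableT_comp.
Qed.

Lemma bmeas_incr n f : D f -> bmeas (incr n f).
Proof.
by move=> Df; apply: bmeasB; apply: bmeas_comp; (exact: Dm || exact: (alg_bounded DA)).
Qed.

Lemma bmeas_avg n f : D f -> bmeas (avg n f).
Proof.
move=> Df; rewrite /avg; apply: bmeasM; last exact: bmeas_cst.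
by apply: bmeasD; apply: bmeas_comp; (exact: Dm || exact: (alg_bounded DA)).
Qed.

Lemma expect_lin n (a b : R) X Z : bmeas X -> bmeas Z ->
  expect n (fun w => a * X w + b * Z w) = a * expect n X + b * expect n Z.
Proof. by move=> bX bZ; rewrite /expect (Rint_linear P)//; ring. Qed.

Lemma expect_le n X Z : bmeas X -> bmeas Z -> (forall w, X w <= Z w) ->
  expect n X <= expect n Z.
Proof.
move=> bX bZ XZ; rewrite /expect; apply: ler_wpM2l; first exact: ltW.
by apply: le_Rintegral => //; exact: bmeas_intg.
Qed.

Lemma eq_expect n X Z : X =1 Z -> expect n X = expect n Z.
Proof. by move=> XZ; congr (_ * _); apply: eq_Rintegral => w _; rewrite XZ. Qed.

Lemma A_L2 phi : D phi -> A phi \in L2. Proof. by case/HA. Qed.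

Lemma approx_form_cvg phi chi : D phi -> D chi ->
  approx_form P Y Yn alpha n phi chi @[n --> \oo] --> - ip (A phi) chi.
Proof.
move=> Dp /(proj2 (HA Dp)) h.
have -> : - ip (A phi) chi = 2^-1 * (- 2 * ip (A phi) chi) by field.
have E1 n : approx_form P Y Yn alpha n phi chi = 2^-1 * (alpha n *
  \int[P]_w ((phi (Yn n w) - phi (Y w)) * (chi (Yn n w) - chi (Y w)))).
  by rewrite /approx_form; ring.
by rewrite (eq_cvg _ _ E1); apply: cvgM => //; exact: cvg_cst.
Qed.

Lemma limit_formE phi chi : D phi -> D chi -> q phi chi = - ip (A phi) chi.
Proof.
by move=> Dp Dc; apply: cvg_lim; [exact: Rhausdorff|exact: approx_form_cvg].
Qed.

Lemma expect_incr phi chi : D phi -> D chi ->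
  expect n (fun w => incr n phi w * incr n chi w) @[n --> \oo] --> 2 * q phi chi.
Proof.
move=> Dp Dc; rewrite limit_formE//.
have -> : 2 * - ip (A phi) chi = - 2 * ip (A phi) chi by ring.
exact: (proj2 (HA Dp)).
Qed.

Lemma limit_formC phi chi : q phi chi = q chi phi.
Proof.
rewrite /= /Defs.limit_form.
suff -> : (fun n => approx_form P Y Yn alpha n phi chi) =
  (fun n => approx_form P Y Yn alpha n chi phi) by [].
apply/funext => n.
by congr (_ * _); apply: eq_Rintegral => w _; rewrite mulrC.
Qed.

Lemma limit_form_positive : positive_form mu q.
Proof.
have a2 f : D f -> f \in L2 by exact: (alg_L2 mu DA Dm).
split.
- exact: a2.
- exact: (alg_cst DA).
- by move=> a f g Df Dg; apply: (algD DA) => //; exact: (algZ DA).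
- split=> [f g _ _|a f g h Df Dg Dh|f f' g Df Df' Dg ff'].
  + exact: limit_formC.
  + have Dl : D (a \*o f \+ g) by apply: (algD DA) => //; exact: (algZ DA).
    rewrite limit_formC [in RHS]limit_formC [_ g h]limit_formC !limit_formE//.
    have Ah := A_L2 Dh.
    have := bformDr lP (L2Z a (a2 _ Df)) (a2 _ Dg) Ah.
    rewrite /= => ->; have := bformZr lP a (a2 _ Df) Ah; rewrite /= => ->; ring.
  + rewrite limit_formC [RHS]limit_formC !limit_formE//; congr (- _).
    rewrite ipC [RHS]ipC.
    by have := form_ae lP (a2 _ Df) (a2 _ Df') (A_L2 Dg) ff'.
- move=> f Df; rewrite limit_formE//; apply: (cvgr_to_ge (approx_form_cvg Df Df)).
  apply: nearW => n; apply: mulr_ge0; first by rewrite divr_ge0// ltW.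
  by apply: Rintegral_ge0 => w _; rewrite -expr2 sqr_ge0.
Qed.

Local Notation qP := limit_form_positive.

(** The generator formula makes [q phi] an [L^2]-continuous functional, which is
    all that closability needs. *)
Lemma limit_form_L2_cvg phi (u : nat -> E -> R) f : D phi -> (forall n, u n \in L2) -> f \in L2 ->
  seq_cvg (L2form mu) u f -> ip (A phi) (u n) @[n --> \oo] --> ip (A phi) f.
Proof.
move=> Dp u2 f2 uf; have A2 := A_L2 Dp.
apply: (seq_cvg_form lP (u := fun=> A phi) (v := u) (f := A phi) (g := f)) => //.
rewrite /seq_cvg; have /= -> := form_sqB lP A2 A2.
have -> : L2form mu (A phi) (A phi) - 2 * L2form mu (A phi) (A phi) +
  L2form mu (A phi) (A phi) = 0 by ring.
exact: cvg_cst.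
Qed.

(** For fixed [n], the value [q (u n) (u m)] tends to zero with [m] by
    [L^2]-continuity, whereas [q (u n) (u n \- u m)] is small by the Cauchy
    property. *)
Lemma limit_form_closable : closable mu q.
Proof.
move=> u Du0 u0 /form_cauchyP uC; have Du n : D (u n) := Du0 n.
have u2 n : u n \in L2 by exact: (alg_L2 mu DA Dm (Du n)).
have {}u0 : seq_cvg (L2form mu) u (cst 0) by apply/L2_cvgE => //; exact: L2_cst.
apply/cvg0P => [n|e e0]; first exact: (form_ge0 qP (Du n)).
have e4 : 0 < e / 4 by lra.
have [N HN] := uC _ e4; exists N => n Nn.
have quu : q (u n) (u m) @[m --> \oo] --> 0.
  have E1 m : q (u n) (u m) = - 1 * ip (A (u n)) (u m).
    by rewrite limit_formE// mulNr mul1r.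
  rewrite (eq_cvg _ _ E1); apply: cvgMl0.
  have -> : 0 = ip (A (u n)) (cst 0).
    rewrite /ip -[LHS](Rint_cst mu 0); apply: eq_Rintegral => x _ /=.
    by rewrite mulr0.
  by apply: limit_form_L2_cvg => //; exact: L2_cst.
have /cvgrPdist_lt /(_ _ e4)[N1 _ HN1] := quu.
pose m := maxn N N1.
have := HN1 m (leq_maxr _ _); rewrite /= sub0r normrN => Hm.
have Hnm := HN _ _ Nn (leq_maxl N N1 : (N <= m)%N).
have DB : D (u n \- u m) by exact: (algB DA).
have Y1 := form_young qP ltr01 (Du n) DB.
rewrite (bformBr qP)// invr1 !mul1r in Y1.
have := ler_norm (q (u n) (u n) - q (u n) (u m)).
have := ler_norm (q (u n) (u m)).
move: Y1 Hnm Hm; rewrite /=.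
move: (limit_form _ _ _ _ (u n) (u n)) (limit_form _ _ _ _ (u n) (u m)).
move: (limit_form _ _ _ _ (u n \- u m) _) => a b c; lra.
Qed.

(** Since [q] is a limit of averages of squared increments, it inherits every
    pointwise comparison between them. *)
Lemma energy_le (a b : R) f g h : D f -> D g -> D h ->
  (forall x y, (h x - h y) ^+ 2 <= a * (f x - f y) ^+ 2 + b * (g x - g y) ^+ 2) ->
  q h h <= a * q f f + b * q g g.
Proof.
move=> Df Dg Dh H.
have cf : a * expect n (fun w => incr n f w * incr n f w) +
    b * expect n (fun w => incr n g w * incr n g w) @[n --> \oo] -->
    a * (2 * q f f) + b * (2 * q g g).
  by apply: cvgD; apply: cvgM; (exact: cvg_cst || exact: expect_incr).
suff : 2 * q h h <= a * (2 * q f f) + b * (2 * q g g).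
  by move: (q h h) (q f f) (q g g) => ? ? ?; lra.
apply: (ler_cvg_to (expect_incr Dh Dh) cf); apply: nearW => n.
rewrite -expect_lin; [|by apply: bmeasM; exact: bmeas_incr..].
apply: expect_le.
- by apply: bmeasM; exact: bmeas_incr.
- by apply: bmeasD; apply: bmeasM; (exact: bmeas_cst || (apply: bmeasM; exact: bmeas_incr)).
- by move=> w; rewrite -!expr2; exact: H.
Qed.

Lemma energy_lip (K : R) f h : D f -> D h -> 0 <= K ->
  (forall x y, `|h x - h y| <= K * `|f x - f y|) ->
  q h h <= K ^+ 2 * q f f.
Proof.
move=> Df Dh K0 H; have := @energy_le (K ^+ 2) 0 f f h Df Df Dh.
rewrite mul0r addr0; apply => x y; rewrite mul0r addr0.
rewrite -[leLHS]real_normK ?num_real// -[(f x - f y) ^+ 2]real_normK ?num_real//.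
by rewrite -exprMn lerXn2r ?nnegrE ?mulr_ge0.
Qed.

(** The square field operator attached to the generator [A]. *)
Definition gam u v : E -> R :=
  (A (u \* v) \- A v \* u) \- A u \* v.

(** The integral of [gam u v] against [chi], expressed by the form alone; it is
    symmetric in [u] and [v]. *)
Definition trip chi u v : R :=
  q (u \* chi) v + q (v \* chi) u - q chi (u \* v).

Lemma gam_L2 u v : D u -> D v -> gam u v \in L2.
Proof.
move=> Du Dv; have Duv := algM DA Du Dv.
apply: L2B; first apply: L2B.
- exact: A_L2.
- by apply: L2_mulb; [exact: A_L2|exact: Dm|exact: (alg_bounded DA)].
- by apply: L2_mulb; [exact: A_L2|exact: Dm|exact: (alg_bounded DA)].
Qed.

Lemma gam_trip chi u v : D chi -> D u -> D v -> ip (gam u v) chi = trip chi u v.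
Proof.
move=> Dc Du Dv; have Duv := algM DA Du Dv.
have a2 f : D f -> f \in L2 by exact: (alg_L2 mu DA Dm).
have m2 f g : D f -> D g -> A f \* g \in L2.
  by move=> Df Dg; apply: L2_mulb; [exact: A_L2|exact: Dm|exact: (alg_bounded DA)].
have AB := bformBl lP (A_L2 Duv) (m2 _ _ Dv Du) (a2 _ Dc).
have B2 : A (u \* v) \- A v \* u \in L2 by apply: L2B; [exact: A_L2|exact: m2].
have /= -> := bformBl lP B2 (m2 _ _ Du Dv) (a2 _ Dc).
rewrite /= in AB; rewrite AB /trip.
have ipM f g : ip (A f \* g) chi = ip (A f) (g \* chi).
  by apply: eq_Rintegral => x _ /=; rewrite mulrA.
rewrite !ipM [q chi _]limit_formC [q (u \* chi) v]limit_formC.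
rewrite [q (v \* chi) u]limit_formC !limit_formE//; try exact: (algM DA).
by ring.
Qed.

(** The algebraic identity behind it holds before the limit: the product of the
    increments of [u] and [v] with the average of [chi] is half the combination
    defining [trip], with [q] replaced by products of increments. *)
Lemma expect_trip chi u v : D chi -> D u -> D v ->
  expect n (fun w => incr n u w * incr n v w * avg n chi w) @[n --> \oo] -->
  trip chi u v.
Proof.
move=> Dc Du Dv.
have Duv := algM DA Du Dv; have Duc := algM DA Du Dc; have Dvc := algM DA Dv Dc.
have c1 := expect_incr Duc Dv; have c2 := expect_incr Dvc Du.
have c3 := expect_incr Dc Duv.
have E1 n : expect n (fun w => incr n u w * incr n v w * avg n chi w) =
   2^-1 * expect n (fun w => incr n (u \* chi) w * incr n v w) +
   2^-1 * (expect n (fun w => incr n (v \* chi) w * incr n u w) +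
     - 1 * expect n (fun w => incr n chi w * incr n (u \* v) w)).
  have b1 : bmeas (fun w => incr n (u \* chi) w * incr n v w).
    by apply: bmeasM; exact: bmeas_incr.
  have b2 : bmeas (fun w => incr n (v \* chi) w * incr n u w).
    by apply: bmeasM; exact: bmeas_incr.
  have b3 : bmeas (fun w => incr n chi w * incr n (u \* v) w).
    by apply: bmeasM; exact: bmeas_incr.
  rewrite -[X in X + - 1 * _]mul1r -(expect_lin n 1 (- 1))//.
  rewrite -expect_lin//; last first.
    by apply: bmeasD; apply: bmeasM => //; exact: bmeas_cst.
  by apply: eq_expect => w; rewrite /incr /avg /=; field.
rewrite (eq_cvg _ _ E1).
have -> : trip chi u v = 2^-1 * (2 * q (u \* chi) v) +
    2^-1 * (2 * q (v \* chi) u + - 1 * (2 * q chi (u \* v))).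
  by rewrite /trip; move: (q _ _) (q (v \* chi) u) (q chi _) => ? ? ?; field.
apply: cvgD; apply: cvgM; try exact: cvg_cst; first exact: c1.
by apply: cvgD; [exact: c2|apply: cvgM; [exact: cvg_cst|exact: c3]].
Qed.

Lemma limit_form_cst f c : D f -> q f (cst c) = 0.
Proof.
move=> Df; have Dc := alg_cst DA c.
rewrite /= /Defs.limit_form.
have -> : (fun n => approx_form P Y Yn alpha n f (cst c)) = cst 0.
  apply/funext => n; rewrite /approx_form /=.
  under eq_Rintegral do rewrite subrr mulr0.
  by rewrite Rint_cst mulr0.
by apply: cvg_lim => //; exact: cvg_cst.
Qed.

(** The [L^1]-norm is computed by test functions bounded by one; for these the
    averages [avg n chi] are bounded by one as well, and Young's inequality for
    the increments of [u] and [v] passes to the limit. *)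
Lemma gam_L1 (t : R) u v : 0 < t -> D u -> D v ->
  \int[mu]_y `|gam u v y| <= t * q u u + t^-1 * q v v.
Proof.
move=> t0 Du Dv; apply: (alg_L1_norm DA Dm Dd); first exact: gam_L2.
move=> chi Dc chi1; rewrite gam_trip//.
have cf : t / 2 * expect n (fun w => incr n u w * incr n u w) +
    t^-1 / 2 * expect n (fun w => incr n v w * incr n v w) @[n --> \oo] -->
    t / 2 * (2 * q u u) + t^-1 / 2 * (2 * q v v).
  by apply: cvgD; apply: cvgM; (exact: cvg_cst || exact: expect_incr).
have -> : t * q u u + t^-1 * q v v = t / 2 * (2 * q u u) + t^-1 / 2 * (2 * q v v).
  by move: (q u u) (q v v) => ? ?; field; rewrite gt_eqF.
apply: (ler_cvg_to (expect_trip Dc Du Dv) cf); apply: nearW => n.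
rewrite -expect_lin; [|by apply: bmeasM; exact: bmeas_incr..].
apply: expect_le.
- by apply: bmeasM; [apply: bmeasM; exact: bmeas_incr|exact: bmeas_avg].
- by apply: bmeasD; apply: bmeasM; (exact: bmeas_cst || (apply: bmeasM; exact: bmeas_incr)).
- move=> w; set a := incr n u w; set b := incr n v w.
  have av1 : `|avg n chi w| <= 1.
    rewrite /avg normrM [`|2^-1|]ger0_norm// ler_pdivrMr// mul1r.
    by rewrite (le_trans (ler_normD _ _))// -[2]/(1 + 1) lerD.
  have ab : `|a * b| <= t / 2 * (a * a) + t^-1 / 2 * (b * b).
    have ti : t * t^-1 = 1 by rewrite divff// gt_eqF.
    have ti0 : 0 < t^-1 by rewrite invr_gt0.
    have s1 : 0 <= t^-1 * (t * a - b) ^+ 2 by rewrite mulr_ge0 ?sqr_ge0// ltW.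
    have s2 : 0 <= t^-1 * (t * a + b) ^+ 2 by rewrite mulr_ge0 ?sqr_ge0// ltW.
    have e1 : t^-1 * (t * a - b) ^+ 2 = t * (a * a) + t^-1 * (b * b) - 2 * (a * b).
      by field; rewrite gt_eqF.
    have e2 : t^-1 * (t * a + b) ^+ 2 = t * (a * a) + t^-1 * (b * b) + 2 * (a * b).
      by field; rewrite gt_eqF.
    by rewrite ler_norml; apply/andP; split; move: s1 s2; rewrite e1 e2; lra.
  apply: le_trans ab; apply: (le_trans (ler_norm _)).
  by rewrite normrM ler_piMr.
Qed.

(** * The closure is a Dirichlet form *)

Variable EE : bform E R.
Hypotheses (EEc : closed_form mu EE) (EEx : extends EE q).
Hypothesis EEcore : forall f, dom EE f -> exists u : nat -> E -> R,
  [/\ forall n, D (u n), seq_cvg (L2form mu) u f & seq_cvg EE u f].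

Let eP : positive_form mu EE. Proof. by case: EEc. Qed.

Lemma EE_dom f : D f -> dom EE f. Proof. by case: EEx => + _; apply. Qed.

Lemma EE_q f g : D f -> D g -> EE f g = q f g. Proof. by case: EEx => _; apply. Qed.

Let EE_L2 f : dom EE f -> f \in L2. Proof. exact: (form_L2 eP). Qed.

Let D_L2 f : D f -> f \in L2. Proof. exact: (alg_L2 mu DA Dm). Qed.

Lemma EE_near f (e : R) : dom EE f -> 0 < e -> exists2 u, D u &
  ip (u \- f) (u \- f) < e /\ EE (u \- f) (u \- f) < e.
Proof.
move=> ef e0; have [u [Du ul ue]] := EEcore ef.
have u2 n : u n \in L2 by exact: D_L2.
have eu n : dom EE (u n) by exact: EE_dom.
have [N1 H1] := (seq_cvgP lP u2 (EE_L2 ef)).1 ul _ e0.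
have [N2 H2] := (seq_cvgP eP eu ef).1 ue _ e0.
exists (u (maxn N1 N2)) => //; split; first by apply: H1; rewrite leq_maxl.
by apply: H2; rewrite leq_maxr.
Qed.

Lemma ip_le2 (a b : R) f g h : 0 <= a -> 0 <= b -> f \in L2 -> g \in L2 -> h \in L2 ->
  (forall x, `|h x| <= a * `|f x| + b * `|g x|) ->
  ip h h <= 2 * (a ^+ 2 * ip f f) + 2 * (b ^+ 2 * ip g g).
Proof.
move=> a0 b0 f2 g2 h2 H.
have nE (k : E -> R) : k \in L2 -> ip (fun x => `|k x|) (fun x => `|k x|) = ip k k.
  by move=> _; apply: eq_Rintegral => x _; rewrite -normrM ger0_norm// -expr2 sqr_ge0.
have af2 := L2Z a (L2_norm f2); have bg2 := L2Z b (L2_norm g2).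
have /= := form_sqD_le lP af2 bg2.
have /= -> := form_sqZ lP a (L2_norm f2); have /= -> := form_sqZ lP b (L2_norm g2).
rewrite !nE//; apply: le_trans; apply: ip_le => //; first exact: L2D.
by move=> x; rewrite [leRHS]ger0_norm//= addr_ge0// mulr_ge0.
Qed.

Lemma L2_cvg_dominated (K : R) (w u : nat -> E -> R) g f : 0 <= K ->
  (forall n, w n \in L2) -> (forall n, u n \in L2) -> g \in L2 -> f \in L2 ->
  (forall n x, `|w n x - g x| <= inv_succ n + K * `|u n x - f x|) ->
  seq_cvg (L2form mu) u f -> seq_cvg (L2form mu) w g.
Proof.
move=> K0 w2 u2 g2 f2 H uf.
have cv : 2 * (1 ^+ 2 * (inv_succ n) ^+ 2) + 2 * (K ^+ 2 * ip (u n \- f) (u n \- f))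
    @[n --> \oo] --> 0.
  apply: cvgD0; apply: cvgMl0; apply: cvgMl0; last exact: uf.
  have c : inv_succ n @[n --> \oo] --> (0 : R) by exact: cvg_harmonic.
  rewrite -[X in _ --> X](mul0r (0 : R)); under eq_cvg do rewrite expr2.
  exact: cvgM.
apply: (squeeze_cvgr _ (cvg_cst 0) cv); apply: nearW => n.
rewrite ip_ge0 /= -(ip_cst mu (inv_succ n)).
apply: ip_le2 => //; [exact: L2_cst|exact: L2B|exact: L2B|].
move=> x /=; apply: le_trans (H n x) _.
by rewrite mul1r lerD2r ler_norm.
Qed.

(** A Lipschitz function acts on the domain through polynomials approximating it:
    their energies are controlled before the limit. *)
Lemma EE_lipschitz_seq (F : R -> R) (K : R) f : 0 <= K ->
  (forall x y, `|F x - F y| <= K * `|x - y|) -> dom EE f ->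
  exists g : nat -> E -> R, [/\ forall n, D (g n),
    seq_cvg (L2form mu) g (F \o f),
    (forall e, 0 < e -> exists N, forall n, (N <= n)%N ->
       EE (g n) (g n) <= K ^+ 2 * EE f f + e) &
    forall lo hi, (forall x, lo <= F x <= hi) -> forall n x, lo <= g n x <= hi].
Proof.
move=> K0 FK ef; have [u [Du ul ue]] := EEcore ef; have f2 := EE_L2 ef.
have eu n : dom EE (u n) by exact: EE_dom.
have u2 n : u n \in L2 by exact: D_L2.
have /choice[g Hg] : forall n, exists g, [/\ D g,
    forall x, `|g x - F (u n x)| <= inv_succ n,
    forall x y, `|g x - g y| <= K * `|u n x - u n y| &
    forall lo hi, (forall x, lo <= F x <= hi) -> forall x, lo <= g x <= hi].
  by move=> n; exact: (alg_lipschitz DA K0 (inv_succ_gt0 n) FK (Du n)).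
have Dg n : D (g n) by have [] := Hg n.
have g2 n : g n \in L2 by exact: D_L2.
have Ff2 := L2_lipschitz K0 FK f2.
exists g; split => //.
- apply: (L2_cvg_dominated K0 g2 u2 Ff2 f2 _ ul) => n x /=.
  have [_ Hn _ _] := Hg n.
  have -> : g n x - F (f x) = (g n x - F (u n x)) + (F (u n x) - F (f x)) by ring.
  by rewrite (le_trans (ler_normD _ _))// lerD.
- move=> e e0; have K21 : 0 < K ^+ 2 + 1 by rewrite ltr_wpDl ?sqr_ge0.
  have eK : 0 < e / (K ^+ 2 + 1) by rewrite divr_gt0.
  have /cvgrPdist_lt /(_ _ eK)[N _ HN] := seq_cvg_form eP eu eu ef ef ue ue.
  exists N => n Nn; have [_ _ Hl _] := Hg n.
  rewrite EE_q//; apply: le_trans (energy_lip (Du n) (Dg n) K0 Hl) _.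
  rewrite -EE_q//; apply: (@le_trans _ _ (K ^+ 2 * (EE f f + e / (K ^+ 2 + 1)))).
    apply: ler_wpM2l; first exact: sqr_ge0.
    have := HN n Nn; rewrite /= ltr_norml => /andP[]; lra.
  rewrite mulrDr lerD2l mulrCA; apply: ler_piMr; first exact: ltW.
  by rewrite ler_pdivrMr// mul1r lerDl.
- by move=> lo hi H n x; have [_ _ _] := Hg n; apply.
Qed.

Lemma EE_lipschitz (F : R -> R) (K : R) f : 0 <= K ->
  (forall x y, `|F x - F y| <= K * `|x - y|) -> dom EE f ->
  dom EE (F \o f) /\ EE (F \o f) (F \o f) <= K ^+ 2 * EE f f.
Proof.
move=> K0 FK ef; have [g [Dg gl ge _]] := EE_lipschitz_seq K0 FK ef.
have Ff2 := L2_lipschitz K0 FK (EE_L2 ef).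
apply: (closed_form_lsc EEc) => // e e0.
have g2 n : g n \in L2 by exact: D_L2.
have [N1 H1] := (seq_cvgP lP g2 Ff2).1 gl _ e0.
have [N2 H2] := ge _ e0.
exists (g (maxn N1 N2)); split; first exact: EE_dom.
- by apply: H1; rewrite leq_maxl.
- by apply: H2; rewrite leq_maxr.
Qed.

Lemma EE_dirichlet : dirichlet_form mu EE.
Proof.
split => //.
  move=> f f2 e e0; have [g Dg gf] := Dd f2 e0; exists g => //; exact: EE_dom.
move=> f ef; have [] := EE_lipschitz ler01 (@unit_trunc_lip R) ef.
by rewrite expr1n mul1r.
Qed.

Lemma EE_ae f f' : dom EE f -> f' \in L2 -> f = f' %[ae mu] -> dom EE f'.
Proof. by case: EEc => _ H _; exact: H. Qed.

(** The sequence built for the truncation [clamp M], which fixes [f], has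
    asymptotic energy at most that of [f], so that its weak convergence is
    strong. *)
Lemma EE_bounded_seq (M : R) f : dom EE f -> 0 <= M -> (forall x, `|f x| <= M) ->
  exists g : nat -> E -> R, [/\ forall n, D (g n), forall n x, `|g n x| <= M,
    seq_cvg (L2form mu) g f & seq_cvg EE g f].
Proof.
move=> ef M0 fM.
have [g [Dg gl ge gM]] := EE_lipschitz_seq ler01 (@clamp_lip R M) ef.
have fE : clamp M \o f = f by apply/funext => x /=; rewrite clamp_id.
rewrite fE in gl; exists g; split => //.
  by move=> n x; rewrite ler_norml; apply: gM => y; exact: clamp_range.
apply: (closed_form_strong EEc) => //; first by move=> n; exact: EE_dom.
by move=> e /ge[N HN]; exists N => n /HN; rewrite expr1n mul1r.
Qed.

(** * The square field operator *)

Lemma trip_lin chi (a : R) u u' v : D chi -> D u -> D u' -> D v ->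
  trip chi (a \*o u \+ u') v = a * trip chi u v + trip chi u' v.
Proof.
move=> Dc Du Du' Dv; rewrite /trip.
have -> : (a \*o u \+ u') \* chi = a \*o (u \* chi) \+ (u' \* chi).
  by apply/funext => x /=; ring.
have -> : (a \*o u \+ u') \* v = a \*o (u \* v) \+ (u' \* v).
  by apply/funext => x /=; ring.
have d1 := algM DA Du Dc; have d2 := algM DA Du' Dc; have d3 := algM DA Dv Dc.
have d4 := algM DA Du Dv; have d5 := algM DA Du' Dv.
have d6 := algZ DA a Du; have d7 := algZ DA a d4.
rewrite (form_lin qP)// !(bformDr qP)// !(bformZr qP)//.
move: (q (u \* chi) v) (q (u' \* chi) v) (q (v \* chi) u) (q (v \* chi) u').
by move: (q chi (u \* v)) (q chi (u' \* v)) => *; ring.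
Qed.

Lemma tripC chi u v : trip chi u v = trip chi v u.
Proof.
rewrite /trip (_ : u \* v = v \* u); last by apply/funext => x /=; rewrite mulrC.
by rewrite [X in X - _]addrC.
Qed.

Lemma gamC u v : D u -> D v -> gam u v = gam v u %[ae mu].
Proof.
move=> Du Dv; apply: (alg_test_ae DA Dm Dd); try exact: gam_L2.
by move=> chi Dc; rewrite (gam_trip Dc Du Dv) (gam_trip Dc Dv Du) tripC.
Qed.

Lemma gam_lin (a : R) u u' v : D u -> D u' -> D v ->
  gam (a \*o u \+ u') v = a \*o gam u v \+ gam u' v %[ae mu].
Proof.
move=> Du Du' Dv; have Dl : D (a \*o u \+ u') by apply: (algD DA) => //; exact: (algZ DA).
have G1 := gam_L2 Du Dv; have G2 := gam_L2 Du' Dv.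
apply: (alg_test_ae DA Dm Dd); [exact: gam_L2|exact: L2_lin|].
move=> chi Dc; rewrite gam_trip// trip_lin// -!gam_trip//.
by have := form_lin lP a G1 G2 (D_L2 Dc).
Qed.

(** Bilinearity splits the difference into two terms with one small factor each;
    a large parameter in Young's inequality lets this factor compensate for the
    bounded one. *)
Lemma gam_dist (t : R) u v u' v' : 0 < t -> D u -> D v -> D u' -> D v' ->
  norm1 mu (gam u v \- gam u' v') <=
  (t * q (u \- u') (u \- u') + t^-1 * q v v) +
  (t * q (v \- v') (v \- v') + t^-1 * q u' u').
Proof.
move=> t0 Du Dv Du' Dv'.
have Duu := algB DA Du Du'; have Dvv := algB DA Dv Dv'.
have BE f g : f \- g = -1 \*o g \+ f by apply/funext => x /=; ring.
have G1 := gam_L2 Duu Dv; have G2 := gam_L2 Dvv Du'.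
have G3 := gam_L2 Du Dv; have G4 := gam_L2 Du' Dv'.
have -> : norm1 mu (gam u v \- gam u' v') =
    norm1 mu (gam (u \- u') v \+ gam (v \- v') u').
  apply: norm1_ae; [exact: meas_L2 (L2B G3 G4)|exact: meas_L2 (L2D G1 G2)|].
  apply: (alg_test_ae DA Dm Dd); [exact: L2B|exact: L2D|].
  move=> chi Dc; have c2 := D_L2 Dc.
  have /= -> := bformBl lP G3 G4 c2; have /= -> := bformDl lP G1 G2 c2.
  rewrite !gam_trip// !BE !trip_lin// (tripC chi v u') (tripC chi v' u').
  by move: (trip chi u v) (trip chi u' v) (trip chi u' v') => *; ring.
apply: (le_trans (norm1D (L2_intg G1) (L2_intg G2))).
by rewrite lerD// gam_L1.
Qed.

Lemma gam_close (C e : R) : 0 < e -> exists2 del : R, 0 < del &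
  forall u v u' v', D u -> D v -> D u' -> D v' -> q v v <= C -> q u' u' <= C ->
    q (u \- u') (u \- u') < del -> q (v \- v') (v \- v') < del ->
    norm1 mu (gam u v \- gam u' v') < e.
Proof.
move=> e0; pose t := 4 * (`|C| + 1) / e.
have C1 : 0 < `|C| + 1 by rewrite ltr_wpDl.
have t0 : 0 < t by rewrite divr_gt0// mulr_gt0.
have tC : t^-1 * (`|C| + 1) = e / 4 by rewrite /t; field; rewrite !gt_eqF.
exists (e / (4 * t)); first by rewrite divr_gt0// mulr_gt0.
move=> u v u' v' Du Dv Du' Dv' vC uC du dv.
apply: le_lt_trans (gam_dist t0 Du Dv Du' Dv') _.
move: (q v v) (q u' u') (q (u \- u') _) (q (v \- v') _) vC uC du dv.
move=> a b c b' aC bC cd bd.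
have tde : t * (e / (4 * t)) = e / 4 by field; rewrite gt_eqF.
have K x : x <= C -> t^-1 * x <= e / 4.
  move=> xC; rewrite -tC ler_wpM2l ?invr_ge0 ?(ltW t0)//.
  by rewrite (le_trans xC)// (le_trans (ler_norm _))// lerDl.
have := K _ aC; have := K _ bC.
have : t * c < e / 4 by rewrite -tde ltr_pM2l.
have : t * b' < e / 4 by rewrite -tde ltr_pM2l.
by move: (t * c) (t * b') (t^-1 * a) (t^-1 * b) => *; lra.
Qed.

(** [G] is the limit in [L^1] of [gam] along core pairs converging in energy to
    [(f, g)]. The statement with tolerances singles out no sequence, which makes
    symmetry, linearity and uniqueness direct. *)
Definition isG f g (G : E -> R) := mu.-integrable setT (EFin \o G) /\
  forall e : R, 0 < e -> exists u v, [/\ D u, D v,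
    EE (u \- f) (u \- f) < e, EE (v \- g) (v \- g) < e &
    norm1 mu (gam u v \- G) < e].

Let gam_intg u v : D u -> D v -> mu.-integrable setT (EFin \o gam u v).
Proof. by move=> Du Dv; apply/L2_intg/gam_L2. Qed.

Let near_bound u f : D u -> dom EE f -> EE (u \- f) (u \- f) < 1 ->
  q u u <= 2 + 2 * EE f f.
Proof.
move=> Du ef uf; rewrite -EE_q//.
have := form_sqD_le eP (form_domB eP (EE_dom Du) ef) ef.
rewrite (_ : _ \+ _ = u); last by apply/funext => x /=; rewrite subrK.
move: uf; lra.
Qed.

Let near_dist u u' f (del : R) : D u -> D u' -> dom EE f ->
  EE (u \- f) (u \- f) < del / 4 -> EE (u' \- f) (u' \- f) < del / 4 ->
  q (u \- u') (u \- u') < del.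
Proof.
move=> Du Du' ef uf uf'; have Duu := algB DA Du Du'; rewrite -EE_q//.
have := form_sqB_trans eP (EE_dom Du) ef (EE_dom Du').
rewrite (form_sqBC eP ef (EE_dom Du')); move: uf uf'; lra.
Qed.

Lemma isG_near f g (G : E -> R) (e : R) : dom EE f -> dom EE g -> isG f g G -> 0 < e ->
  exists2 del : R, 0 < del & forall u v, D u -> D v ->
    EE (u \- f) (u \- f) < del -> EE (v \- g) (v \- g) < del ->
    norm1 mu (gam u v \- G) < e.
Proof.
move=> ef eg [IG HG] e0; have e2 : 0 < e / 2 by rewrite divr_gt0.
have f0 := form_ge0 eP ef; have g0 := form_ge0 eP eg.
have [d0 d00 H0] := gam_close (2 + 2 * EE f f + 2 * EE g g) e2.
have m0 : 0 < Num.min 1 (d0 / 4) by rewrite lt_min ltr01 divr_gt0.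
exists (Num.min 1 (d0 / 4)) => // u v Du Dv.
rewrite !lt_min => /andP[u1 ud] /andP[v1 vd].
have : 0 < Num.min (Num.min 1 (d0 / 4)) (e / 2) by rewrite lt_min m0.
move=> /HG[u' [v' [Du' Dv']]]; rewrite !lt_min.
move=> /andP[/andP[u1' ud'] _] /andP[/andP[v1' vd'] _] /andP[_ Ge].
have I1 := gam_intg Du Dv; have I2 := gam_intg Du' Dv'.
apply: le_lt_trans (norm1B I1 I2 IG) _.
suff H1 : norm1 mu (gam u v \- gam u' v') < e / 2 by move: H1 Ge; lra.
apply: H0 => //.
- by have := near_bound Dv eg v1; move: f0; lra.
- by have := near_bound Du' ef u1'; move: g0; lra.
- exact: near_dist ud ud'.
- exact: near_dist vd vd'.
Qed.

Lemma isG_exists f g : dom EE f -> dom EE g -> exists G, isG f g G.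
Proof.
move=> ef eg.
have /choice[w Hw] : forall n, exists uv : (E -> R) * (E -> R),
    [/\ D uv.1, D uv.2, EE (uv.1 \- f) (uv.1 \- f) < inv_succ n &
        EE (uv.2 \- g) (uv.2 \- g) < inv_succ n].
  move=> n; have [u Du [_ uf]] := EE_near ef (inv_succ_gt0 n).
  have [v Dv [_ vg]] := EE_near eg (inv_succ_gt0 n).
  by exists (u, v).
have f0 := form_ge0 eP ef; have g0 := form_ge0 eP eg.
pose G n := gam (w n).1 (w n).2.
have IG n : mu.-integrable setT (EFin \o G n) by have [? ? _ _] := Hw n; exact: gam_intg.
have CG : L1_cauchy mu G.
  move=> e e0; have [d0 d00 H0] := gam_close (2 + 2 * EE f f + 2 * EE g g) e0.
  have m0 : 0 < Num.min 1 (d0 / 4) by rewrite lt_min ltr01 divr_gt0.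
  have [N HN] := inv_succ_lt m0; exists N => k l /HN Nk /HN Nl.
  move: Nk Nl; rewrite !lt_min => /andP[k1 k4] /andP[l1 l4].
  have [Du Dv uf vg] := Hw k; have [Du' Dv' uf' vg'] := Hw l.
  apply: (H0 _ _ _ _ Du Dv Du' Dv').
  - by have := near_bound Dv eg (lt_trans vg k1); move: f0; lra.
  - by have := near_bound Du' ef (lt_trans uf' l1); move: g0; lra.
  - exact: near_dist (lt_trans uf k4) (lt_trans uf' l4).
  - exact: near_dist (lt_trans vg k4) (lt_trans vg' l4).
have [G0 IG0 HG0] := L1_complete IG CG; exists G0; split => // e e0.
have [N1 H1] := HG0 _ e0; have [N2 H2] := inv_succ_lt e0.
have [Du Dv uf vg] := Hw (maxn N1 N2).
exists (w (maxn N1 N2)).1, (w (maxn N1 N2)).2; split => //.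
- by rewrite (lt_trans uf)// H2// leq_maxr.
- by rewrite (lt_trans vg)// H2// leq_maxr.
- by apply: H1; rewrite leq_maxl.
Qed.

Lemma isG_unique f g (G G' : E -> R) : dom EE f -> dom EE g ->
  isG f g G -> isG f g G' -> G = G' %[ae mu].
Proof.
move=> ef eg GP GP'; have [IG _] := GP; have [IG' _] := GP'.
suff : norm1 mu (G \- G') <= 0.
  move=> /(norm1_eq0 (intgB IG IG')).
  by apply: filterS => x /= /[apply] /eqP; rewrite subr_eq0 => /eqP.
apply/ler_addgt0Pr => e e0; rewrite add0r.
have e2 : 0 < e / 2 by rewrite divr_gt0.
have [d1 d10 H1] := isG_near ef eg GP e2; have [d2 d20 H2] := isG_near ef eg GP' e2.
have m0 : 0 < Num.min d1 d2 by rewrite lt_min d10.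
have [u Du [_]] := EE_near ef m0; rewrite lt_min => /andP[u1 u2].
have [v Dv [_]] := EE_near eg m0; rewrite lt_min => /andP[v1 v2].
have := norm1B IG (gam_intg Du Dv) IG'; rewrite [X in _ <= X + _]norm1BC.
have := H1 u v Du Dv u1 v1; have := H2 u v Du Dv u2 v2; lra.
Qed.

(** The continuous extension of [gam] to pairs in the domain of the closure. *)
Definition gamma f g : E -> R := xget (cst 0) [set G | isG f g G].

Lemma gammaP f g : dom EE f -> dom EE g -> isG f g (gamma f g).
Proof. by move=> ef eg; have [G HG] := isG_exists ef eg; exact: (xgetPex _ (ex_intro _ G HG)). Qed.

Let sqB0 f : dom EE f -> EE (f \- f) (f \- f) = 0.
Proof. by move=> ef; rewrite (form_sqB eP)//; ring. Qed.

Lemma gamma_gam u v : D u -> D v -> gamma u v = gam u v %[ae mu].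
Proof.
move=> Du Dv; have eu := EE_dom Du; have ev := EE_dom Dv.
apply: (isG_unique eu ev (gammaP eu ev)); split; first exact: gam_intg.
move=> e e0; exists u, v; split; rewrite ?sqB0//.
rewrite /norm1 (_ : \int[mu]_x _ = 0)//.
by rewrite -[RHS](Rint_cst mu 0); apply: eq_Rintegral => x _ /=; rewrite subrr normr0.
Qed.

Lemma gammaC f g : dom EE f -> dom EE g -> gamma f g = gamma g f %[ae mu].
Proof.
move=> ef eg; apply: (isG_unique ef eg (gammaP ef eg)).
have [IG HG] := gammaP eg ef; split => // e /HG[u [v [Du Dv ug vf Ge]]].
exists v, u; split => //; apply: le_lt_trans Ge; rewrite le_eqVlt; apply/orP; left.
apply/eqP; apply: norm1_ae.
- by apply: measurable_funB; [exact: meas_L2 (gam_L2 Dv Du)|exact: intg_meas IG].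
- by apply: measurable_funB; [exact: meas_L2 (gam_L2 Du Dv)|exact: intg_meas IG].
- by apply: filterS (gamC Du Dv) => x /= /(_ I) ->.
Qed.

Lemma gamma_lin (a : R) f g h : dom EE f -> dom EE g -> dom EE h ->
  gamma (a \*o f \+ g) h = a \*o gamma f h \+ gamma g h %[ae mu].
Proof.
move=> ef eg eh; have el : dom EE (a \*o f \+ g).
  by apply: (form_domD eP) => //; exact: (form_domZ eP).
have GP1 := gammaP ef eh; have GP2 := gammaP eg eh.
have [I1 _] := GP1; have [I2 _] := GP2.
have I3 := intgD (intgZ a I1) I2.
apply: (isG_unique el eh (gammaP el eh)); split => // e e0.
pose c := 2 * a ^+ 2 + 2 + 2 * `|a|.
have c0 : 0 < c by rewrite /c; have := sqr_ge0 a; have := normr_ge0 a; lra.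
have ec0 : 0 < e / c by rewrite divr_gt0.
have [d1 d10 H1] := isG_near ef eh GP1 ec0; have [d2 d20 H2] := isG_near eg eh GP2 ec0.
pose m := Num.min (Num.min d1 d2) (Num.min e (e / c)).
have m0 : 0 < m by rewrite !lt_min d10 d20 e0.
have [u Du [_]] := EE_near ef m0; rewrite !lt_min => /andP[/andP[u1 u2] /andP[u3 u4]].
have [v Dv [_]] := EE_near eg m0; rewrite !lt_min => /andP[/andP[v1 v2] /andP[v3 v4]].
have [w Dw [_]] := EE_near eh m0; rewrite !lt_min => /andP[/andP[w1 w2] /andP[w3 w4]].
have Dl : D (a \*o u \+ v) by apply: (algD DA) => //; exact: (algZ DA).
have p1 := mulr_ge0 (sqr_ge0 a) (ltW ec0).
have p2 := mulr_ge0 (normr_ge0 a) (ltW ec0).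
have key : 2 * (a ^+ 2 * (e / c)) + 2 * (e / c) + 2 * (`|a| * (e / c)) = e.
  have kc r : 2 * (a ^+ 2 * r) + 2 * r + 2 * (`|a| * r) = c * r by rewrite /c; ring.
  by rewrite kc mulrC divfK// gt_eqF.
exists (a \*o u \+ v), w; split => //.
  have -> : a \*o u \+ v \- (a \*o f \+ g) = a \*o (u \- f) \+ (v \- g).
    by apply/funext => x /=; ring.
  have euf := form_domB eP (EE_dom Du) ef; have evg := form_domB eP (EE_dom Dv) eg.
  apply: le_lt_trans (form_sqD_le eP (form_domZ eP a euf) evg) _.
  rewrite (form_sqZ eP)//.
  apply: (@lt_le_trans _ _ (2 * (a ^+ 2 * (e / c)) + 2 * (e / c))).
    apply: ler_ltD; last by rewrite ltr_pM2l.
    by rewrite ler_wpM2l// ler_wpM2l ?sqr_ge0// ltW.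
  by rewrite -[leRHS]key lerDl mulr_ge0.
have J1 := gam_intg Du Dw; have J2 := gam_intg Dv Dw.
have E1 : norm1 mu (gam (a \*o u \+ v) w \- (a \*o gamma f h \+ gamma g h)) =
   norm1 mu (a \*o (gam u w \- gamma f h) \+ (gam v w \- gamma g h)).
  apply: norm1_ae.
  - by apply: measurable_funB; [exact: meas_L2 (gam_L2 Dl Dw)|exact: intg_meas I3].
  - exact: intg_meas (intgD (intgZ a (intgB J1 I1)) (intgB J2 I2)).
  - by apply: filterS (gam_lin a Du Dv Dw) => x /= /(_ I) -> _; ring.
rewrite E1; apply: le_lt_trans (norm1D (intgZ a (intgB J1 I1)) (intgB J2 I2)) _.
rewrite (norm1Z a (intgB J1 I1)).
have B1 := H1 _ _ Du Dw u1 w1; have B2 := H2 _ _ Dv Dw v2 w2.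
apply: (@lt_le_trans _ _ (`|a| * (e / c) + e / c)).
  by apply: ler_ltD => //; rewrite ler_wpM2l// ltW.
rewrite -[leRHS]key; move: ec0 p1 p2.
by move: (`|a| * (e / c)) (a ^+ 2 * (e / c)) (e / c) => *; lra.
Qed.

Lemma gamma_cvg (u v : nat -> E -> R) f g : (forall n, dom EE (u n)) ->
  (forall n, dom EE (v n)) -> dom EE f -> dom EE g ->
  seq_cvg EE u f -> seq_cvg EE v g ->
  norm1 mu (gamma (u n) (v n) \- gamma f g) @[n --> \oo] --> 0.
Proof.
move=> eu ev ef eg /(seq_cvgP eP eu ef) uf /(seq_cvgP eP ev eg) vg.
apply/cvg0P => [n|e e0]; first exact: norm1_ge0.
have e2 : 0 < e / 2 by rewrite divr_gt0.
have GP := gammaP ef eg; have [IG _] := GP.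
have [d0 d00 H0] := isG_near ef eg GP e2.
have d4 : 0 < d0 / 4 by rewrite divr_gt0.
have [N1 H1] := uf _ d4; have [N2 H2] := vg _ d4.
exists (maxn N1 N2) => n; rewrite geq_max => /andP[/H1 n1 /H2 n2].
have [In Hn] := gammaP (eu n) (ev n).
have : 0 < Num.min (d0 / 4) (e / 2) by rewrite lt_min d4.
move=> /Hn[w [z [Dw Dz]]]; rewrite !lt_min => /andP[wu _] /andP[zv _] /andP[_ Ge].
have T x y h : D x -> dom EE y -> dom EE h -> EE (x \- y) (x \- y) < d0 / 4 ->
    EE (y \- h) (y \- h) < d0 / 4 -> EE (x \- h) (x \- h) < d0.
  by move=> Dx ey eh; have := form_sqB_trans eP (EE_dom Dx) ey eh; lra.
have := H0 _ _ Dw Dz (T _ _ _ Dw (eu n) ef wu n1) (T _ _ _ Dz (ev n) eg zv n2).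
have := norm1B In (gam_intg Dw Dz) IG; rewrite [X in _ <= X + _]norm1BC.
move: Ge; lra.
Qed.

(** The factor converging in [L^1] is frozen at an index where it is close to its
    limit. Being in [L^2], the frozen function can be paired with the sequence
    converging in [L^2], and the bound [M] controls the error of freezing. *)
Lemma L1_bounded_cvg (G : nat -> E -> R) (G0 : E -> R) (chi : nat -> E -> R) h (M : R) :
  (forall n, G n \in L2) -> mu.-integrable setT (EFin \o G0) ->
  norm1 mu (G n \- G0) @[n --> \oo] --> 0 ->
  (forall n, measurable_fun setT (chi n)) -> measurable_fun setT h ->
  (forall n x, `|chi n x| <= M) -> (forall x, `|h x| <= M) ->
  seq_cvg (L2form mu) chi h ->
  \int[mu]_x (G n x * chi n x) @[n --> \oo] --> \int[mu]_x (G0 x * h x).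
Proof.
move=> G2 IG0 GG0 mchi mh chiM hM chih.
have M0 : 0 <= M by apply: le_trans (hM point); exact: normr_ge0.
have c2 n : chi n \in L2 by apply: L2_bounded => //; exists M.
have h2 : h \in L2 by apply: L2_bounded => //; exists M.
have IG n := L2_intg (G2 n).
apply/cvgrPdist_lt => e e0.
have GG n : 0 <= norm1 mu (G n \- G0) by exact: norm1_ge0.
pose del := e / (4 * (M + 1)).
have M1 : 0 < M + 1 by rewrite ltr_wpDl.
have del0 : 0 < del by rewrite divr_gt0// mulr_gt0.
have delE : (M + 1) * del = e / 4 by rewrite /del; field; rewrite gt_eqF.
have [N HN] := (cvg0P GG).1 GG0 _ del0.
have c : ip (G N) (chi n) @[n --> \oo] --> ip (G N) h.
  apply: (seq_cvg_form lP (fun=> G2 N) c2 (G2 N) h2 _ chih).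
  have z : L2form mu (G N \- G N) (G N \- G N) = 0.
    by rewrite (form_sqB lP (G2 N) (G2 N)); ring.
  by rewrite /seq_cvg z; exact: cvg_cst.
have e4 : 0 < e / 4 by rewrite divr_gt0.
have /cvgrPdist_lt /(_ _ e4)[N1 _ HN1] := c.
exists (maxn N N1) => //= n /=; rewrite geq_max => /andP[nN /HN1 /= Hn].
have bc k : bounded_fun_on (chi k) by exists M.
have bh : bounded_fun_on h by exists M.
have I1 := intg_mulb (IG n) (mchi n) (bc n).
have I2 := intg_mulb IG0 (mchi n) (bc n); have I3 := intg_mulb IG0 mh bh.
have I4 := intg_mulb (IG N) (mchi n) (bc n); have I5 := intg_mulb (IG N) mh bh.
have A1 := norm1_mulb (intgB (IG n) IG0) (mchi n) (chiM n).
have A2 := norm1_mulb (intgB (IG N) IG0) (mchi n) (chiM n).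
have A3 := norm1_mulb (intgB (IG N) IG0) mh hM.
have X (k l : E -> R) : mu.-integrable setT (EFin \o k) -> measurable_fun setT l -> bounded_fun_on l ->
   \int[mu]_x ((k x - G0 x) * l x) = \int[mu]_x (k x * l x) - \int[mu]_x (G0 x * l x).
  move=> Ik ml bl; rewrite -RintegralB//; [|exact: intg_mulb..].
  by apply: eq_Rintegral => x _; rewrite mulrBl.
rewrite !X// in A1 A2 A3.
have B1 := HN _ nN; have B2 := HN _ (leqnn N).
have S (k : E -> R) : norm1 mu k < del -> M * norm1 mu k <= e / 4.
  move=> kd; rewrite -delE; apply: ler_pM => //; [exact: norm1_ge0| |exact: ltW].
  by rewrite lerDl.
have := S _ B1; have := S _ B2.
move: Hn A1 A2 A3; rewrite /ip.
move: (\int[mu]_x (G N x * h x)) (\int[mu]_x (G N x * chi n x)).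
move: (\int[mu]_x (G0 x * h x)) (\int[mu]_x (G0 x * chi n x)).
move: (\int[mu]_x (G n x * chi n x)) (M * norm1 mu (G N \- G0)) (M * _).
move=> a b c' x y z w; rewrite !ler_norml !ltr_norml.
move=> /andP[? ?] /andP[? ?] /andP[? ?] /andP[? ?] ? ?.
by apply/andP; split; lra.
Qed.

Lemma EE_weak_strong (u v : nat -> E -> R) f g (C : R) : (forall n, dom EE (u n)) ->
  (forall n, dom EE (v n)) -> dom EE f -> dom EE g ->
  seq_cvg (L2form mu) u f ->
  (exists N, forall n, (N <= n)%N -> EE (u n) (u n) <= C) -> seq_cvg EE v g ->
  EE (u n) (v n) @[n --> \oo] --> EE f g.
Proof.
move=> eu ev ef eg uf uC vg.
have evg n := form_domB eP (ev n) eg.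
have E1 n : EE (u n) (v n) = EE (u n) g + EE (v n \- g) (u n).
  by rewrite (bformBl eP)// (bformC eP (ev n) (eu n)) (bformC eP eg (eu n)); ring.
have c1 := closed_form_weak EEc eu ef eg uf uC.
have c2 := form_cvg0_bounded eP evg eu vg uC.
by rewrite (eq_cvg _ _ E1); have := cvgD c1 c2; rewrite addr0; exact.
Qed.

Lemma EE_cvg_bounded (u : nat -> E -> R) f : (forall n, dom EE (u n)) -> dom EE f ->
  seq_cvg EE u f -> exists N, forall n, (N <= n)%N -> EE (u n) (u n) <= EE f f + 1.
Proof.
move=> eu ef uf.
have /cvgrPdist_lt /(_ _ ltr01)[N _ HN] := seq_cvg_form eP eu eu ef ef uf uf.
by exists N => n /HN /=; rewrite ltr_norml => /andP[? _]; lra.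
Qed.

(** Products of bounded core functions converge in [L^2] with bounded energies,
    which is enough for weak convergence. *)
Lemma EE_prod_seq (M : R) f h (u v : nat -> E -> R) :
  dom EE f -> dom EE h -> (forall x, `|f x| <= M) -> (forall x, `|h x| <= M) ->
  (forall n, D (u n)) -> (forall n, D (v n)) ->
  (forall n x, `|u n x| <= M) -> (forall n x, `|v n x| <= M) ->
  seq_cvg (L2form mu) u f -> seq_cvg (L2form mu) v h ->
  seq_cvg EE u f -> seq_cvg EE v h ->
  [/\ dom EE (f \* h), seq_cvg (L2form mu) (fun n => u n \* v n) (f \* h) &
    exists C, exists N, forall n, (N <= n)%N -> EE (u n \* v n) (u n \* v n) <= C].
Proof.
move=> ef eh fM hM Du Dv uM vM ul vl ue ve.
have M0 : 0 <= M by apply: le_trans (hM point); exact: normr_ge0.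
have f2 := EE_L2 ef; have h2 := EE_L2 eh.
have eu n := EE_dom (Du n); have ev n := EE_dom (Dv n).
have Duv n := algM DA (Du n) (Dv n).
have fh2 : f \* h \in L2 by apply: L2_mulb => //; [exact: meas_L2 h2|exists M].
have uvl : seq_cvg (L2form mu) (fun n => u n \* v n) (f \* h).
  have cv : 2 * (M ^+ 2 * ip (u n \- f) (u n \- f)) +
      2 * (M ^+ 2 * ip (v n \- h) (v n \- h)) @[n --> \oo] --> 0.
    by apply: cvgD0; apply: cvgMl0; exact: cvgMl0.
  apply: (squeeze_cvgr _ (cvg_cst 0) cv); apply: nearW => n.
  rewrite ip_ge0 /=; apply: ip_le2 => //.
  - exact: L2B (D_L2 (Du n)) f2.
  - exact: L2B (D_L2 (Dv n)) h2.
  - exact: L2B (D_L2 (Duv n)) fh2.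
  move=> x /=.
  have -> : u n x * v n x - f x * h x = v n x * (u n x - f x) + f x * (v n x - h x).
    by ring.
  by rewrite (le_trans (ler_normD _ _))// !normrM lerD// ler_wpM2r.
have uvC : exists C, exists N, forall n, (N <= n)%N -> EE (u n \* v n) (u n \* v n) <= C.
  have [N1 H1] := EE_cvg_bounded eu ef ue; have [N2 H2] := EE_cvg_bounded ev eh ve.
  exists (2 * M ^+ 2 * (EE f f + 1) + 2 * M ^+ 2 * (EE h h + 1)).
  exists (maxn N1 N2) => n; rewrite geq_max => /andP[/H1 n1 /H2 n2].
  have M2 : 0 <= 2 * M ^+ 2 by rewrite mulr_ge0 ?sqr_ge0.
  rewrite EE_q//; apply: (@le_trans _ _ (2 * M ^+ 2 * q (u n) (u n) + 2 * M ^+ 2 * q (v n) (v n))).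
    apply: energy_le => // x y /=.
    set a := u n x; set b := u n y; set c := v n x; set d := v n y.
    have -> : a * c - b * d = c * (a - b) + b * (c - d) by ring.
    have S k : `|k| <= M -> k ^+ 2 <= M ^+ 2.
      by move=> kM; rewrite -[leLHS]real_normK ?num_real// lerXn2r ?nnegrE.
    have Sc : c ^+ 2 * (a - b) ^+ 2 <= M ^+ 2 * (a - b) ^+ 2.
      by rewrite ler_wpM2r ?sqr_ge0// S//; exact: vM.
    have Sb : b ^+ 2 * (c - d) ^+ 2 <= M ^+ 2 * (c - d) ^+ 2.
      by rewrite ler_wpM2r ?sqr_ge0// S//; exact: uM.
    have T (r s : R) : (r + s) ^+ 2 <= 2 * r ^+ 2 + 2 * s ^+ 2.
      by have := sqr_ge0 (r - s); rewrite sqrrB sqrrD; lra.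
    apply: le_trans (T _ _) _; rewrite !exprMn.
    rewrite -[leRHS]/(2 * M ^+ 2 * (a - b) ^+ 2 + 2 * M ^+ 2 * (c - d) ^+ 2).
    have e1 r : 2 * M ^+ 2 * r = 2 * (M ^+ 2 * r) by rewrite mulrA.
    by rewrite !e1 lerD// ler_wpM2l.
  by rewrite -!EE_q// lerD// ler_wpM2l.
split => //; have [C [N HC]] := uvC.
have uv2 n := D_L2 (Duv n).
have [] // := @closed_form_lsc _ _ _ _ EE (f \* h) C EEc fh2.
move=> e e0; have [N1 H1] := (seq_cvgP lP uv2 fh2).1 uvl _ e0.
exists (u (maxn N N1) \* v (maxn N N1)); split; first exact: EE_dom.
  by apply: H1; rewrite leq_maxr.
by rewrite (le_trans (HC _ (leq_maxl _ _)))// lerDl ltW.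
Qed.

Lemma gamma_cvg_core (u : nat -> E -> R) f : (forall n, D (u n)) -> dom EE f ->
  seq_cvg EE u f -> norm1 mu (gam (u n) (u n) \- gamma f f) @[n --> \oo] --> 0.
Proof.
move=> Du ef uf; apply/cvg0P => [n|e e0]; first exact: norm1_ge0.
have eu n := EE_dom (Du n).
have [del del0 H] := isG_near ef ef (gammaP ef ef) e0.
have [N HN] := (seq_cvgP eP eu ef).1 uf _ del0.
by exists N => n /HN Hn; exact: H.
Qed.

(** On the core the identity is [gam_trip]. In each energy term a product
    converges weakly and the other argument strongly, while the right-hand side
    is a case of [L1_bounded_cvg]. *)
Lemma gamma_identity_bounded (M : R) f h : dom EE f -> dom EE h ->
  (forall x, `|f x| <= M) -> (forall x, `|h x| <= M) ->
  dom EE (f \* h) /\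
  2 * EE (f \* h) f - EE h (f \* f) = \int[mu]_x (gamma f f x * h x).
Proof.
move=> ef eh fM hM.
have M0 : 0 <= M by apply: le_trans (hM point); exact: normr_ge0.
have [u [Du uM ul ue]] := EE_bounded_seq ef M0 fM.
have [v [Dv vM vl ve]] := EE_bounded_seq eh M0 hM.
have eu n := EE_dom (Du n); have ev n := EE_dom (Dv n).
have [efh uvl [C1 uvC]] := EE_prod_seq ef eh fM hM Du Dv uM vM ul vl ue ve.
have [eff uul [C2 uuC]] := EE_prod_seq ef ef fM fM Du Du uM uM ul ul ue ue.
have Duv n := algM DA (Du n) (Dv n); have Duu n := algM DA (Du n) (Du n).
have euv n := EE_dom (Duv n); have euu n := EE_dom (Duu n).
split => //.
have c1 := EE_weak_strong euv eu efh ef uvl uvC ue.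
have c2 := EE_weak_strong euu ev eff eh uul uuC ve.
have c3 : 2 * EE (u n \* v n) (u n) - EE (u n \* u n) (v n) @[n --> \oo] -->
    2 * EE (f \* h) f - EE (f \* f) h.
  by apply: cvgB => //; apply: cvgM => //; exact: cvg_cst.
have E1 n : 2 * EE (u n \* v n) (u n) - EE (u n \* u n) (v n) =
    \int[mu]_x (gam (u n) (u n) x * v n x).
  transitivity (trip (v n) (u n) (u n)); last by rewrite -gam_trip.
  rewrite !EE_q// /trip [q (v n) _]limit_formC.
  by move: (q (u n \* v n) (u n)) (q (u n \* u n) _) => *; ring.
rewrite (eq_cvg _ _ E1) in c3.
have IG : mu.-integrable setT (EFin \o gamma f f) by have [] := gammaP ef ef.
have c4 : \int[mu]_x (gam (u n) (u n) x * v n x) @[n --> \oo] -->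
    \int[mu]_x (gamma f f x * h x).
  apply: (L1_bounded_cvg _ IG (gamma_cvg_core Du ef ue) _ _ vM hM vl).
  - by move=> n; exact: gam_L2.
  - by move=> n; exact: Dm.
  - exact: meas_L2 (EE_L2 eh).
by rewrite (bformC eP eh eff); exact: (cvg_unique _ c3 c4).
Qed.

Lemma gamma_ae f f' g g' : dom EE f -> dom EE f' -> dom EE g -> dom EE g' ->
  f = f' %[ae mu] -> g = g' %[ae mu] -> gamma f g = gamma f' g' %[ae mu].
Proof.
move=> ef ef' eg eg' ff' gg'; apply: (isG_unique ef' eg' _ (gammaP ef' eg')).
have [IG HG] := gammaP ef eg; split => // e /HG[u [v [Du Dv uf vg Ge]]].
have X (w k k' : E -> R) : D w -> dom EE k -> dom EE k' -> k = k' %[ae mu] ->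
    EE (w \- k') (w \- k') = EE (w \- k) (w \- k).
  move=> Dw ek ek' kk'; have ew := EE_dom Dw.
  apply: (form_sq_ae eP); [exact: (form_domB eP)|exact: (form_domB eP)|].
  by apply: filterS kk' => x /= /(_ I) ->.
by exists u, v; rewrite (X u f f')// (X v g g').
Qed.

Lemma EE_square_field : square_field_operator mu EE gamma.
Proof.
split.
- by move=> f g ef eg; apply/Lfun1_integrable; have [] := gammaP ef eg.
- exact: gammaC.
- exact: gamma_lin.
- move=> u v f g eu ev ef eg /(form_cvgE eP eu ef)[_ uf] /(form_cvgE eP ev eg)[_ vg].
  have c := gamma_cvg eu ev ef eg uf vg.
  have E1 n : ('N[mu]_1 [EFin \o (gamma (u n) (v n) \- gamma f g)%R])%E =
      (norm1 mu (gamma (u n) (v n) \- gamma f g))%:E.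
    have [I1 _] := gammaP (eu n) (ev n); have [I2 _] := gammaP ef eg.
    by apply: Lnorm1E; exact: intgB.
  by rewrite (eq_cvg _ _ E1); apply: cvg_EFin => //; exact: nearW.
- move=> f h ef /Lfun_infty_bounded[M1 M10 fM] eh /Lfun_infty_bounded[M2 M20 hM].
  (* Clamping modifies the two essentially bounded functions on a null set only. *)
  pose M := Num.max M1 M2.
  have M0 : 0 <= M by rewrite le_max M10.
  have [efc _] := EE_lipschitz ler01 (@clamp_lip R M) ef.
  have [ehc _] := EE_lipschitz ler01 (@clamp_lip R M) eh.
  have fE : f = clamp M \o f %[ae mu].
    apply: filterS fM => x /= fM _; rewrite clamp_id//.
    by rewrite (le_trans fM)// le_max lexx.
  have hE : h = clamp M \o h %[ae mu].
    apply: filterS hM => x /= hM _; rewrite clamp_id//.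
    by rewrite (le_trans hM)// le_max lexx orbT.
  have cM (k : E -> R) x : `|(clamp M \o k) x| <= M by exact: clamp_norm.
  have [efhc idc] := gamma_identity_bounded efc ehc (cM f) (cM h).
  have [effc _] := gamma_identity_bounded efc efc (cM f) (cM f).
  have mf := meas_L2 (EE_L2 ef); have mh := meas_L2 (EE_L2 eh).
  have mulE (k l : E -> R) : k = clamp M \o k %[ae mu] -> l = clamp M \o l %[ae mu] ->
      (clamp M \o k) \* (clamp M \o l) = k \* l %[ae mu].
    by move=> kE lE; apply: filterS2 kE lE => x /= /(_ I) {2}-> /(_ I) {2}->.
  have fhE := mulE _ _ fE hE; have ffE := mulE _ _ fE fE.
  have efh : dom EE (f \* h).
    by apply: (EE_ae efhc _ fhE); apply: (L2_ae_mem _ fhE (EE_L2 efhc)); exact: measurable_funM.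
  have eff : dom EE (f \* f).
    by apply: (EE_ae effc _ ffE); apply: (L2_ae_mem _ ffE (EE_L2 effc)); exact: measurable_funM.
  have fE' : clamp M \o f = f %[ae mu] by apply: filterS fE => x /= /[apply].
  have hE' : clamp M \o h = h %[ae mu] by apply: filterS hE => x /= /[apply].
  rewrite -(form_ae eP efhc efh ef fhE) (bformC eP efhc ef).
  rewrite -(form_ae eP efc ef efhc fE') (bformC eP efc efhc).
  rewrite -(form_ae eP ehc eh eff hE') (bformC eP ehc eff) -(form_ae eP effc eff ehc ffE).
  rewrite (bformC eP effc ehc) idc.
  have [IG _] := gammaP ef ef; have [IGc _] := gammaP efc efc.
  apply: Rint_ae.
  + by apply: measurable_funM; [exact: intg_meas IGc|exact: meas_L2 (EE_L2 ehc)].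
  + by apply: measurable_funM => //; exact: intg_meas IG.
  + apply: filterS2 hE' (gamma_ae efc ef efc ef fE' fE') => x /= /(_ I) -> /(_ I) -> _.
    by rewrite mulrC.
Qed.

Lemma expect_gamma chi u v : D chi -> D u -> D v ->
  expect n (fun w => incr n u w * incr n v w * avg n chi w) @[n --> \oo] -->
  \int[mu]_y (gamma u v y * chi y).
Proof.
move=> Dc Du Dv; have [IG _] := gammaP (EE_dom Du) (EE_dom Dv).
have -> : \int[mu]_y (gamma u v y * chi y) = trip chi u v.
  rewrite -gam_trip//; apply: Rint_ae.
  - by apply: measurable_funM; [exact: intg_meas IG|exact: Dm].
  - by apply: measurable_funM; [exact: meas_L2 (gam_L2 Du Dv)|exact: Dm].
  - by apply: filterS (gamma_gam Du Dv) => x /= /(_ I) ->.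
exact: expect_trip.
Qed.

(** * Locality and fourth moments *)

Lemma EE_cstr f c : dom EE f -> EE f (cst c) = 0.
Proof.
move=> ef; have Dc := alg_cst DA c; have ec := EE_dom Dc.
have := form_normM eP ef ec.
by rewrite (EE_q Dc Dc) (limit_form_cst c Dc) sqrtr0 mulr0 normr_le0 => /eqP.
Qed.

Lemma EE_shift f g c c' : dom EE f -> dom EE g ->
  dom EE (fun x => f x - c) /\ EE (fun x => f x - c) (fun x => g x - c') = EE f g.
Proof.
move=> ef eg; have ec := EE_dom (alg_cst DA c); have ec' := EE_dom (alg_cst DA c').
have efc := form_domB eP ef ec; have egc := form_domB eP eg ec'.
split=> //.
transitivity (EE (f \- cst c) (g \- cst c')); first by [].
rewrite (bformBl eP)// !(bformBr eP)// (EE_cstr _ ef) (EE_cstr _ ec).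
by rewrite (bformC eP ec eg) (EE_cstr _ eg) !subr0.
Qed.

Lemma bmeas_incr_comp n (F : R -> R) phi (K : R) : 0 <= K ->
  (forall x y, `|F x - F y| <= K * `|x - y|) -> D phi -> bmeas (incr n (F \o phi)).
Proof.
move=> K0 FK Dp; have mF := continuous_measurable_fun (lipschitz_continuous K0 FK).
have [M M0 phiM] := alg_bound DA Dp.
have mFp : measurable_fun setT (F \o phi) by apply: measurableT_comp => //; exact: Dm.
have bFp : bounded_fun_on (F \o phi).
  exists (`|F 0| + K * M) => x /=.
  rewrite -[F (phi x)](subrK (F 0)) addrC (le_trans (ler_normD _ _))// lerD//.
  by rewrite (le_trans (FK _ _))// subr0 ler_wpM2l.
by apply: bmeasB; exact: bmeas_comp.
Qed.

(** Approximating [F] by polynomials in the Lipschitz seminorm makes the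
    approximation of [F \o phi] uniform along the limit defining the form. *)
Lemma C1_seq (F F1 : R -> R) (K : R) phi : lipschitz_C1 K F F1 -> D phi ->
  exists u : nat -> E -> R, [/\ forall n, D (u n),
    forall n x y, `|u n x - u n y| <= K * `|phi x - phi y|,
    forall n x y, `|(u n x - F (phi x)) - (u n y - F (phi y))| <=
      inv_succ n * `|phi x - phi y| & core_approx mu q (F \o phi) u].
Proof.
move=> [K0 dF F1K F1L] Dp; have FK := is_derive_lipschitz dF F1K.
have [M M0 pM] := alg_bound DA Dp.
have /choice[p Hp] : forall n, exists p : {poly R},
  [/\ forall x, `|x| <= M -> `|p.[x] - F x| <= inv_succ n,
      forall x y, `|x| <= M -> `|y| <= M -> `|p.[x] - p.[y]| <= K * `|x - y| &
      forall x, `|x| <= M -> `|p^`().[x] - F1 x| <= inv_succ n].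
  by move=> n; exact: (C1_poly_approx K0 M0 FK K0 dF F1L (inv_succ_gt0 n)).
pose u (n : nat) (x : E) := (p n).[phi x].
have Du n : D (u n) by exact: (alg_poly DA).
have pF n (x y : R) : `|x| <= M -> `|y| <= M ->
    `|((p n).[x] - F x) - ((p n).[y] - F y)| <= inv_succ n * `|x - y|.
  have [_ _ H3] := Hp n.
  have dpF (z : R) : is_derive z 1 (fun z => (p n).[z] - F z) ((p n)^`().[z] - F1 z).
    exact: (is_deriveB (is_derive_poly (p n) z) (dF z)).
  exact: (is_derive_lipschitz_on dpF H3).
have u2 n := D_L2 (Du n); have Fp2 := L2_lipschitz K0 FK (D_L2 Dp).
exists u; split => //.
- by move=> n x y; have [_ H _] := Hp n; exact: H.
- by move=> n x y; exact: pF.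
split => //.
- have p0 : seq_cvg (L2form mu) (fun=> phi) phi.
    have [_ _ + _] := approx_cst qP Dp; exact.
  apply: (L2_cvg_dominated K0 u2 (fun=> D_L2 Dp) Fp2 (D_L2 Dp) _ p0) => n x /=.
  by rewrite subrr normr0 mulr0 addr0; have [H _ _] := Hp n; exact: H.
- apply/form_cauchyP => e e0.
  have q0 := form_ge0 qP Dp.
  have q1 : 0 < 4 * (q phi phi + 1) by rewrite mulr_gt0// ltr_wpDl.
  have e1 : 0 < Num.min 1 (e / (4 * (q phi phi + 1))) by rewrite lt_min ltr01 divr_gt0.
  have [N HN] := inv_succ_lt e1; exists N => k l /HN + /HN.
  rewrite !lt_min => /andP[k1 k2] /andP[l1 l2].
  have Dkl := algB DA (Du k) (Du l).
  have s0 : 0 <= inv_succ k + inv_succ l :> R by rewrite addr_ge0 ?ltW ?inv_succ_gt0.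
  apply: le_lt_trans (energy_lip Dp Dkl s0 _) _.
    move=> x y /=.
    have -> : u k x - u l x - (u k y - u l y) =
      ((u k x - F (phi x)) - (u k y - F (phi y))) -
      ((u l x - F (phi x)) - (u l y - F (phi y))) by ring.
    rewrite (le_trans (ler_normB _ _))// mulrDl lerD//; exact: pF.
  set r := e / (4 * (q phi phi + 1)) in k2 l2.
  have re : r * (4 * (q phi phi + 1)) = e by rewrite /r divfK// gt_eqF.
  have i0 n : 0 < inv_succ n :> R by exact: inv_succ_gt0.
  have sq : (inv_succ k + inv_succ l) ^+ 2 <= 4 * r.
    have := i0 k; have := i0 l.
    move: (inv_succ k) (inv_succ l) k1 k2 l1 l2 => a b a1 ar b1 br b0 a0.
    rewrite expr2; apply: (@le_trans _ _ ((a + b) * 2)).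
      by rewrite ler_wpM2l//; lra.
    lra.
  apply: le_lt_trans (ler_wpM2r q0 sq) _.
  have rp : 0 < r by rewrite divr_gt0.
  move: re; move: (q phi phi) => Q re.
  have -> : e = 4 * r * (Q + 1) by rewrite -re; ring.
  by rewrite ltr_pM2l ?ltrDl// mulr_gt0.
Qed.

Lemma core_approx_dom (F : R -> R) phi (u : nat -> E -> R) :
  core_approx mu q (F \o phi) u -> dom EE (F \o phi) /\ seq_cvg EE u (F \o phi).
Proof.
move=> [Fp2 Du ul uC].
apply: (closed_form_lim EEc) => //; first by move=> n; exact: EE_dom (Du n).
apply/form_cauchyP => e /((form_cauchyP _ _).1 uC)[N HN]; exists N => k l Nk Nl.
by have DB := algB DA (Du k) (Du l); rewrite EE_q//; exact: HN.
Qed.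

(** The polynomial approximations change the product of increments by a small
    multiple of the squared increment of [phi], whose normalised expectations
    stay bounded in [n]; the two limits can therefore be exchanged. *)
Lemma C1_limit (F F1 G G1 : R -> R) (K : R) phi :
  lipschitz_C1 K F F1 -> lipschitz_C1 K G G1 -> D phi ->
  [/\ dom EE (F \o phi), dom EE (G \o phi) &
  expect n (fun w => incr n (F \o phi) w * incr n (G \o phi) w) @[n --> \oo] -->
  2 * EE (F \o phi) (G \o phi)].
Proof.
move=> CF CG Dp; have [K0 dF F1K _] := CF; have [_ dG G1K _] := CG.
have FK := is_derive_lipschitz dF F1K; have GK := is_derive_lipschitz dG G1K.
have [u [Du uK uF ua]] := C1_seq CF Dp.
have [v [Dv vK vG va]] := C1_seq CG Dp.
have [eF uE] := core_approx_dom ua; have [eG vE] := core_approx_dom va.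
split => //.
have eu n := EE_dom (Du n); have ev n := EE_dom (Dv n).
have /cvgrPdist_lt cuv := seq_cvg_form eP eu ev eF eG uE vE.
apply/cvgrPdist_lt => e e0; have e8 : 0 < e / 8 by rewrite divr_gt0.
have [N1 _ H1] := cuv _ e8.
have /cvgrPdist_lt /(_ _ ltr01)[N2 _ H2] := expect_incr Dp Dp.
pose B := 2 * q phi phi + 1.
have B0 : 0 < B by rewrite /B ltr_wpDl// mulr_ge0// (form_ge0 qP).
have KB0 : 0 < e / (8 * (K * B + 1)).
  by rewrite divr_gt0// mulr_gt0// ltr_wpDl// mulr_ge0// ltW.
have [N3 H3] := inv_succ_lt KB0.
pose k := maxn N1 N3.
have Hk := H1 k (leq_maxl _ _); have Ik := H3 k (leq_maxr _ _).
have /cvgrPdist_lt /(_ _ e8)[N4 _ H4] := expect_incr (Du k) (Dv k).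
exists (maxn N2 N4) => //= n /=; rewrite geq_max => /andP[/H2 /= n2 /H4 /= n4].
rewrite /= (EE_q (Du k) (Dv k)) in Hk.
have bu := bmeas_incr n (Du k); have bv := bmeas_incr n (Dv k).
have bF := bmeas_incr_comp n K0 FK Dp; have bG := bmeas_incr_comp n K0 GK Dp.
have bp := bmeas_incr n Dp.
have bFG := bmeasM bF bG; have buv := bmeasM bu bv; have bpp := bmeasM bp bp.
pose X w := incr n (F \o phi) w * incr n (G \o phi) w.
pose Z w := incr n (u k) w * incr n (v k) w.
pose S w := incr n phi w * incr n phi w.
have XZ w : `|X w - Z w| <= 2 * K * inv_succ k * S w.
  rewrite /X /Z /S.
  have := uK k (Yn n w) (Y w); have := vK k (Yn n w) (Y w).
  have := uF k (Yn n w) (Y w); have := vG k (Yn n w) (Y w).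
  have := FK (phi (Yn n w)) (phi (Y w)); have := GK (phi (Yn n w)) (phi (Y w)).
  rewrite /incr /=.
  set a := F _ - F _; set b := G _ - G _; set a' := u k _ - u k _; set b' := v k _ - v k _.
  set p := phi _ - phi _.
  have -> : u k (Yn n w) - F (phi (Yn n w)) - (u k (Y w) - F (phi (Y w))) = a' - a.
    by rewrite /a /a'; ring.
  have -> : v k (Yn n w) - G (phi (Yn n w)) - (v k (Y w) - G (phi (Y w))) = b' - b.
    by rewrite /b /b'; ring.
  move=> hb ha hbb haa hb' ha'.
  have -> : a * b - a' * b' = - ((a' - a) * b + a' * (b' - b)) by ring.
  rewrite normrN (le_trans (ler_normD _ _))// !normrM.
  have i0 : 0 <= inv_succ k :> R by rewrite ltW// inv_succ_gt0.
  have -> : 2 * K * inv_succ k * (p * p) =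
     inv_succ k * `|p| * (K * `|p|) + K * `|p| * (inv_succ k * `|p|).
    by rewrite -expr2 -[p ^+ 2]real_normK ?num_real// expr2; ring.
  by rewrite lerD// ler_pM.
have Se : expect n S <= B.
  have : `|2 * q phi phi - expect n S| < 1 by exact: n2.
  rewrite /B; move: (q phi phi) (expect n S) => a b.
  by rewrite ltr_norml => /andP[? _]; lra.
have c0 : 0 <= 2 * K * inv_succ k.
  by rewrite !mulr_ge0// ltW// inv_succ_gt0.
have XZe : `|expect n X - expect n Z| <= 2 * K * inv_succ k * expect n S.
  have E1 : expect n X - expect n Z = expect n (fun w => 1 * X w + (- 1) * Z w).
    by rewrite expect_lin//; ring.
  have E2 : 2 * K * inv_succ k * expect n S =
      expect n (fun w => 2 * K * inv_succ k * S w + 0 * S w).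
    by rewrite expect_lin// mul0r addr0.
  have E3 : - (2 * K * inv_succ k * expect n S) =
      expect n (fun w => - (2 * K * inv_succ k) * S w + 0 * S w).
    by rewrite expect_lin// mul0r addr0 mulNr.
  have bl (c c' : R) (V V' : Omega -> R) : bmeas V -> bmeas V' ->
      bmeas (fun w => c * V w + c' * V' w).
    by move=> bV bV'; apply: bmeasD; apply: bmeasM => //; exact: bmeas_cst.
  rewrite ler_norml E1 E3 E2; apply/andP; split; apply: expect_le; try exact: bl.
    move=> w; have := XZ w; rewrite ler_norml mul0r addr0 mul1r mulN1r mulNr.
    by case/andP.
  move=> w; have := XZ w; rewrite ler_norml mul0r addr0 mul1r mulN1r.
  by case/andP.
have small : 2 * K * inv_succ k * expect n S <= e / 4.
  apply: (@le_trans _ _ (2 * K * inv_succ k * B)); first by rewrite ler_wpM2l.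
  have -> : 2 * K * inv_succ k * B = 2 * (inv_succ k * (K * B)) by ring.
  have -> : e / 4 = 2 * (e / (8 * (K * B + 1)) * (K * B + 1)).
    by field; rewrite gt_eqF// ltr_wpDl// mulr_ge0// ltW.
  rewrite ler_pM2l// ler_pM//; [by rewrite ltW// inv_succ_gt0|
    by rewrite mulr_ge0// ltW|exact: ltW|by rewrite lerDl].
have {}Hk : `|EE (F \o phi) (G \o phi) - q (u k) (v k)| < e / 8 by exact: Hk.
have {}n4 : `|2 * q (u k) (v k) - expect n Z| < e / 8 by exact: n4.
suff : `|2 * EE (F \o phi) (G \o phi) - expect n X| < e by [].
move: Hk n4 XZe small.
move: (expect n X) (expect n Z) (EE _ _) (q (u k) (v k)) (2 * K * _ * _).
move=> x z f g r; rewrite !ltr_norml ler_norml.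
by move=> /andP[? ?] /andP[? ?] /andP[? ?] ?; apply/andP; split; lra.
Qed.

Definition fourth_moment phi n : R := expect n (fun w => incr n phi w ^+ 4).

Lemma bmeas_sum (N : nat) (X : nat -> Omega -> R) : (forall i, bmeas (X i)) ->
  bmeas (fun w => \sum_(i < N) X i w).
Proof.
move=> bX; elim: N => [|N IH].
  by have := bmeas_cst Omega (0 : R); congr bmeas; apply/funext => w; rewrite big_ord0.
have := bmeasD IH (bX N); congr bmeas.
by apply/funext => w; rewrite big_ord_recr.
Qed.

Lemma expect_sum n (N : nat) (X : nat -> Omega -> R) : (forall i, bmeas (X i)) ->
  expect n (fun w => \sum_(i < N) X i w) = \sum_(i < N) expect n (X i).
Proof.
move=> bX; elim: N => [|N IH].
  rewrite big_ord0 /expect; under eq_Rintegral do rewrite big_ord0.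
  by rewrite Rint_cst mulr0.
rewrite big_ord_recr /= -IH.
have -> : expect n (fun w => \sum_(i < N) X i w) + expect n (X N) =
    1 * expect n (fun w => \sum_(i < N) X i w) + 1 * expect n (X N) by ring.
rewrite -expect_lin//; last exact: bmeas_sum.
by apply: eq_expect => w; rewrite big_ord_recr /= !mul1r.
Qed.

Lemma sum_cvg0 (N : nat) (x : nat -> nat -> R) :
  (forall i, x i n @[n --> \oo] --> 0) ->
  \sum_(i < N) x i n @[n --> \oo] --> 0.
Proof.
move=> x0; elim: N => [|N IH].
  by under eq_cvg do rewrite big_ord0; exact: cvg_cst.
by under eq_cvg do rewrite big_ord_recr /=; exact: cvgD0.
Qed.

Lemma local_incr (F G : R -> R) phi : local_form EE -> D phi ->
  test_function F -> test_function G -> fun_support F `&` fun_support G = set0 ->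
  expect n (fun w => incr n (F \o phi) w * incr n (G \o phi) w) @[n --> \oo] --> 0.
Proof.
move=> loc Dp tF tG FG0.
have [F1 [KF [KF0 CF _]]] := test_function_C1 tF.
have [G1 [KG [KG0 CG _]]] := test_function_C1 tG.
have [||eF eG] := @C1_limit F F1 G G1 (KF + KG) phi _ _ Dp.
- by apply: CF; rewrite lerDl.
- by apply: CG; rewrite lerDr.
have [_ E1] := EE_shift (F 0) (G 0) eF eG.
have := loc phi F G (EE_dom Dp) tF tG FG0; rewrite E1 => ->.
by rewrite mulr0.
Qed.

(** For fixed [h] the bump terms of [large_increment] disappear in the limit, and
    the remaining one is of order [h ^+ 2]. *)
Lemma local_fourth phi : local_form EE -> D phi ->
  fourth_moment phi n @[n --> \oo] --> 0.
Proof.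
move=> loc Dp; have [M M0 pM] := alg_bound DA Dp.
have b4 n : bmeas (fun w => incr n phi w ^+ 4) by apply: bmeasX; exact: bmeas_incr.
have pos n : 0 <= fourth_moment phi n.
  rewrite /fourth_moment /expect mulr_ge0 ?(ltW (alpha_gt0 n))//.
  by apply: Rintegral_ge0 => w _; rewrite -[4%N]/(2 * 2)%N exprM sqr_ge0.
apply/(cvg0P pos) => e e0.
have q0 := form_ge0 qP Dp.
pose h := Num.min 1 (e / (64 * (q phi phi + 1))).
have q1 : 0 < q phi phi + 1 by rewrite ltr_wpDl.
have h0 : 0 < h by rewrite lt_min ltr01 divr_gt0// mulr_gt0.
have [N [a [b [C [C0 ab H]]]]] := large_increment M0 h0.
pose F i := smooth_bump (- M - h) (a i); pose G i := smooth_bump (b i) (M + h).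
have FG0 i : fun_support (F i) `&` fun_support (G i) = set0.
  rewrite -subset0 => x [/smooth_bump_support + /smooth_bump_support]; rewrite /= !in_itv /=.
  by move=> /andP[_ xa] /andP[bx _]; have := lt_le_trans (ab i) (le_trans bx xa); rewrite ltxx.
have tF i : test_function (F i) by exact: smooth_bump_test_function.
have tG i : test_function (G i) by exact: smooth_bump_test_function.
have lim i := local_incr loc Dp (tF i) (tG i) (FG0 i).
have bFG i n : bmeas (fun w => - (incr n (F i \o phi) w * incr n (G i \o phi) w)).
  have [F1 [KF [_ /(_ _ (lexx _))[KF0 dF F1K _] _]]] := test_function_C1 (tF i).
  have [G1 [KG [_ /(_ _ (lexx _))[KG0 dG G1K _] _]]] := test_function_C1 (tG i).
  have b1 := bmeas_incr_comp n KF0 (is_derive_lipschitz dF F1K) Dp.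
  have b2 := bmeas_incr_comp n KG0 (is_derive_lipschitz dG G1K) Dp.
  have := bmeasM (bmeas_cst Omega (-1 : R)) (bmeasM b1 b2).
  by congr bmeas; apply/funext => w; rewrite mulN1r.
pose r n := 16 * h ^+ 2 * expect n (fun w => incr n phi w * incr n phi w) +
  C * \sum_(i < N) expect n (fun w => - (incr n (F i \o phi) w * incr n (G i \o phi) w)).
have rle n : fourth_moment phi n <= r n.
  have b2 := bmeasM (bmeas_incr n Dp) (bmeas_incr n Dp).
  have bs := bmeas_sum N (fun i => bFG i n).
  rewrite /r -(expect_sum n N (fun i => bFG i n)) -expect_lin//.
  apply: expect_le => //.
    by apply: bmeasD; apply: bmeasM => //; exact: bmeas_cst.
  by move=> w; rewrite -expr2; exact: H.
have rcvg : r n @[n --> \oo] --> 16 * h ^+ 2 * (2 * q phi phi) + C * 0.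
  apply: cvgD; apply: cvgM; try exact: cvg_cst; first exact: expect_incr.
  apply: (@sum_cvg0 N (fun i n => expect n
    (fun w => - (incr n (F i \o phi) w * incr n (G i \o phi) w)))) => i.
  have E1 n : expect n (fun w => - (incr n (F i \o phi) w * incr n (G i \o phi) w)) =
     - 1 * expect n (fun w => incr n (F i \o phi) w * incr n (G i \o phi) w).
    rewrite /expect mulrCA; congr (_ * _).
    rewrite -RintegralZl//; last first.
      apply: bmeas_intg; have := bmeasM (bmeas_cst Omega (-1 : R)) (bFG i n).
      by congr bmeas; apply/funext => w; rewrite mulN1r opprK.
    by apply: eq_Rintegral => w _; rewrite mulN1r.
  by rewrite (eq_cvg _ _ E1); apply: cvgMl0; exact: lim.
have small : 16 * h ^+ 2 * (2 * q phi phi) + C * 0 < e.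
  rewrite mulr0 addr0.
  have h1 : h <= 1 by rewrite ge_min lexx.
  have h2 : h * (64 * (q phi phi + 1)) <= e.
    by rewrite -ler_pdivlMr ?mulr_gt0// ge_min lexx orbT.
  move: q0 h2; move: (q phi phi) => Q Q0 h2.
  apply: (@le_lt_trans _ _ (h * (32 * Q))).
    have -> : 16 * h ^+ 2 * (2 * Q) = h * h * (32 * Q) by ring.
    rewrite ler_wpM2r ?mulr_ge0//.
    by rewrite -[leRHS]mulr1 ler_wpM2l// ltW.
  apply: lt_le_trans h2; rewrite ltr_pM2l//; lra.
have /cvgrPdist_lt := rcvg.
set l := 16 * h ^+ 2 * _ + _ in small rcvg *.
have el : 0 < e - l by rewrite subr_gt0.
move=> /(_ _ el)[N0 _ HN0]; exists N0 => n /HN0 /=.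
rewrite ltr_norml => /andP[+ _]; have := rle n.
by move: (fourth_moment phi n) (r n) => *; lra.
Qed.

Lemma quartic_product (a b c e : R) : `|a * b * c * e| <= a ^+ 4 + b ^+ 4 + (c ^+ 4 + e ^+ 4).
Proof.
have AG (x y : R) : 2 * `|x * y| <= x ^+ 2 + y ^+ 2.
  rewrite normrM; have := sqr_ge0 (`|x| - `|y|).
  by rewrite sqrrB !real_normK ?num_real//; move: (`|x| * `|y|) => *; lra.
have := AG (a * b) (c * e); have := AG (a ^+ 2) (b ^+ 2); have := AG (c ^+ 2) (e ^+ 2).
rewrite -!exprM -[(2 * 2)%N]/4%N -!exprMn ![`|_ ^+ 2|]ger0_norm ?sqr_ge0//.
rewrite -(mulrA (a * b)); have := sqr_ge0 (a * b); have := sqr_ge0 (c * e).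
have P4 (x : R) : 0 <= x ^+ 4 by rewrite -[4%N]/(2 * 2)%N exprM sqr_ge0.
have := P4 a; have := P4 b; have := P4 c; have := P4 e.
move: ((a * b) ^+ 2) ((c * e) ^+ 2) (`|_|) (a ^+ 4) (b ^+ 4) (c ^+ 4) (e ^+ 4) => *; lra.
Qed.

Section fourth_moments_vanish.
Hypothesis M4 : forall phi, D phi -> fourth_moment phi n @[n --> \oo] --> 0.

Lemma expect_prod4 u v f g : D u -> D v -> D f -> D g ->
  expect n (fun w => incr n u w * incr n v w * incr n f w * incr n g w)
    @[n --> \oo] --> 0.
Proof.
move=> Du Dv Df Dg.
have c : 1 * (1 * fourth_moment u n + 1 * fourth_moment v n) +
    1 * (1 * fourth_moment f n + 1 * fourth_moment g n) @[n --> \oo] --> 0.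
  have c2 f' g' (Df' : D f') (Dg' : D g') :=
    cvgMl0 1 (cvgD0 (cvgMl0 1 (M4 Df')) (cvgMl0 1 (M4 Dg'))).
  exact: (cvgD0 (c2 _ _ Du Dv) (c2 _ _ Df Dg)).
apply/norm_cvg0P; apply: (squeeze_cvgr _ (cvg_cst 0) c); apply: nearW => n.
have b4 phi : D phi -> bmeas (fun w => incr n phi w ^+ 4).
  by move=> Dp; apply: bmeasX; exact: bmeas_incr.
have bl (a a' : R) X Z : bmeas X -> bmeas Z -> bmeas (fun w => a * X w + a' * Z w).
  by move=> bX bZ; apply: bmeasD; apply: bmeasM => //; exact: bmeas_cst.
have b1 := bmeas_incr n Du; have b2 := bmeas_incr n Dv.
have b3 := bmeas_incr n Df; have b5 := bmeas_incr n Dg.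
have bp := bmeasM (bmeasM (bmeasM b1 b2) b3) b5.
have buv := bl 1 1 _ _ (b4 _ Du) (b4 _ Dv); have bfg := bl 1 1 _ _ (b4 _ Df) (b4 _ Dg).
rewrite normr_ge0 /= /fourth_moment -!expect_lin; try exact: b4; try by [].
rewrite ler_norml; apply/andP; split.
  have -> : - expect n (fun w => 1 * (1 * incr n u w ^+ 4 + 1 * incr n v w ^+ 4) +
     1 * (1 * incr n f w ^+ 4 + 1 * incr n g w ^+ 4)) =
     expect n (fun w => (- 1) * (1 * incr n u w ^+ 4 + 1 * incr n v w ^+ 4) +
     (- 1) * (1 * incr n f w ^+ 4 + 1 * incr n g w ^+ 4)).
    by rewrite !expect_lin; try exact: b4; try by []; ring.
  apply: expect_le => //; first exact: bl.
  move=> w; have := quartic_product (incr n u w) (incr n v w) (incr n f w) (incr n g w).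
  by rewrite !mul1r !mulN1r -opprD ler_norml => /andP[].
apply: expect_le => //; first exact: bl.
move=> w; have := quartic_product (incr n u w) (incr n v w) (incr n f w) (incr n g w).
by rewrite !mul1r ler_norml => /andP[].
Qed.

(** At finite [n] the two sides differ by half the expectation of a product of
    four increments, which the fourth moments dominate. *)
Lemma trip_leibniz chi phi psi g : D chi -> D phi -> D psi -> D g ->
  trip chi (phi \* psi) g = trip (chi \* phi) psi g + trip (chi \* psi) phi g.
Proof.
move=> Dc Dp Ds Dg.
have Dps := algM DA Dp Ds; have Dcp := algM DA Dc Dp; have Dcs := algM DA Dc Ds.
have c0 := expect_trip Dc Dps Dg; have c1 := expect_trip Dcp Ds Dg.
have c2 := expect_trip Dcs Dp Dg; have c4 := expect_prod4 Ds Dg Dc Dp.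
have c3 : expect n (fun w => incr n psi w * incr n g w * avg n (chi \* phi) w) +
    expect n (fun w => incr n phi w * incr n g w * avg n (chi \* psi) w) +
    - 2^-1 * expect n (fun w => incr n psi w * incr n g w * incr n chi w * incr n phi w)
    @[n --> \oo] --> trip (chi \* phi) psi g + trip (chi \* psi) phi g.
  by have := cvgD (cvgD c1 c2) (cvgMl0 (- 2^-1) c4); rewrite addr0; exact.
suff E1 n : expect n (fun w => incr n (phi \* psi) w * incr n g w * avg n chi w) =
    expect n (fun w => incr n psi w * incr n g w * avg n (chi \* phi) w) +
    expect n (fun w => incr n phi w * incr n g w * avg n (chi \* psi) w) +
    - 2^-1 * expect n (fun w => incr n psi w * incr n g w * incr n chi w * incr n phi w).
  by rewrite (eq_cvg _ _ E1) in c0; exact: (cvg_unique _ c0 c3).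
have bi f (Df : D f) := bmeas_incr n Df; have ba f (Df : D f) := bmeas_avg n Df.
have b1 := bmeasM (bmeasM (bi _ Ds) (bi _ Dg)) (ba _ Dcp).
have b2 := bmeasM (bmeasM (bi _ Dp) (bi _ Dg)) (ba _ Dcs).
have b4 := bmeasM (bmeasM (bmeasM (bi _ Ds) (bi _ Dg)) (bi _ Dc)) (bi _ Dp).
rewrite -[X in X + _ + _]mul1r -[X in _ + X + _]mul1r -expect_lin//.
rewrite -[X in X + _]mul1r -expect_lin//; last first.
  by apply: bmeasD; apply: bmeasM => //; exact: bmeas_cst.
by apply: eq_expect => w; rewrite /incr /avg /=; field.
Qed.

Lemma trip_cst chi c g : D chi -> D g -> trip chi (cst c) g = 0.
Proof.
move=> Dc Dg; rewrite /trip (limit_form_cst _ (algM DA Dg Dc)) addr0.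
have -> : cst c \* chi = c \*o chi by [].
have -> : cst c \* g = c \*o g by [].
by rewrite (bformZl qP)// (bformZr qP)// subrr.
Qed.

Lemma tripDc chi chi' u v : D chi -> D chi' -> D u -> D v ->
  trip (chi \+ chi') u v = trip chi u v + trip chi' u v.
Proof.
move=> Dc Dc' Du Dv; have Dcc := algD DA Dc Dc'.
rewrite -!gam_trip//.
by have := bformDr lP (D_L2 Dc) (D_L2 Dc') (gam_L2 Du Dv).
Qed.

(** Horner's scheme for [p] applies the Leibniz rule once per degree; the factor
    split off is absorbed in the test function [chi], over which the induction
    is therefore generalised. *)
Lemma trip_chain (p : {poly R}) chi phi g : D chi -> D phi -> D g ->
  trip chi (fun x => p.[phi x]) g = trip (chi \* (fun x => p^`().[phi x])) phi g.
Proof.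
move=> + Dp Dg; elim/poly_ind: p chi => [|p c IH] chi Dc.
  have -> : (fun x => (0 : {poly R}).[phi x]) = cst 0 by apply/funext => x; rewrite horner0.
  have -> : chi \* (fun x => (0 : {poly R})^`().[phi x]) = cst 0.
    by apply/funext => x /=; rewrite deriv0 horner0 mulr0.
  rewrite trip_cst// -gam_trip//; last exact: (alg_cst DA).
  by apply/esym; rewrite ipC; exact: (bform0l lP (gam_L2 Dp Dg)).
have Dpp := alg_poly DA p Dp; have Dpd := alg_poly DA p^`() Dp.
have Dcst := alg_cst DA c.
have -> : (fun x => (p * 'X + c%:P).[phi x]) =
    1 \*o ((fun x => p.[phi x]) \* phi) \+ cst c.
  by apply/funext => x /=; rewrite hornerMXaddC mul1r.
rewrite trip_lin//; last exact: (algM DA).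
rewrite (trip_cst c Dc Dg) addr0 mul1r trip_leibniz// IH; last exact: (algM DA).
have -> : chi \* (fun x => (p * 'X + c%:P)^`().[phi x]) =
    (chi \* (fun x => p.[phi x])) \+ ((chi \* phi) \* (fun x => p^`().[phi x])).
  by apply/funext => x /=; rewrite derivD derivM derivX derivC !hornerE; ring.
by rewrite tripDc//; apply: (algM DA) => //; exact: (algM DA).
Qed.

(** The Leibniz rule, used in one argument and then in the other. *)
Lemma chain_rule (p r : {poly R}) phi psi : D phi -> D psi ->
  2 * q (fun x => p.[phi x]) (fun x => r.[psi x]) =
  ip (gam psi phi) (fun x => p^`().[phi x] * r^`().[psi x]).
Proof.
move=> Dp Ds; have D1 := alg_cst DA 1.
have Dpp := alg_poly DA p Dp; have Dpd := alg_poly DA p^`() Dp.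
have Drs := alg_poly DA r Ds; have Drd := alg_poly DA r^`() Ds.
transitivity (trip (cst 1) (fun x => p.[phi x]) (fun x => r.[psi x])).
  have M1 f : f \* cst 1 = f by apply/funext => x /=; rewrite mulr1.
  rewrite /trip !M1 [q (cst 1) _]limit_formC (limit_form_cst 1 (algM DA Dpp Drs)) subr0.
  by rewrite [q (fun x => r.[psi x]) _]limit_formC mulr_natl mulr2n.
rewrite trip_chain// tripC trip_chain//; last exact: (algM DA).
rewrite -gam_trip//; last by apply: (algM DA) => //; exact: (algM DA).
by congr ip; apply/funext => x /=; rewrite mul1r.
Qed.

Lemma poly_core_approx (F F1 : R -> R) (K : R) f (phi : nat -> E -> R) :
  lipschitz_C1 K F F1 -> f \in L2 -> (forall n, D (phi n)) -> seq_cvg (L2form mu) phi f ->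
  exists p : nat -> {poly R}, [/\
    seq_cvg (L2form mu) (fun n x => (p n).[phi n x]) (F \o f),
    forall n, q (fun x => (p n).[phi n x]) (fun x => (p n).[phi n x]) <=
      K ^+ 2 * q (phi n) (phi n),
    forall n x, `|(p n)^`().[phi n x]| <= K + 1 &
    seq_cvg (L2form mu) (fun n x => (p n)^`().[phi n x]) (F1 \o f)].
Proof.
move=> [K0 dF F1K F1L] f2 Dp phil; have FK := is_derive_lipschitz dF F1K.
have p2 n := D_L2 (Dp n).
have /choice[p Hp] : forall n, exists p : {poly R},
  [/\ forall x, `|p.[phi n x] - F (phi n x)| <= inv_succ n,
      forall x y, `|p.[phi n x] - p.[phi n y]| <= K * `|phi n x - phi n y| &
      forall x, `|p^`().[phi n x] - F1 (phi n x)| <= inv_succ n].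
  move=> n; have [M M0 pM] := alg_bound DA (Dp n).
  have [p [pa pb pc]] := C1_poly_approx K0 M0 FK K0 dF F1L (inv_succ_gt0 n).
  by exists p; split => [x|x y|x]; [exact: pa|exact: pb|exact: pc].
have near (r : nat -> {poly R}) (H : R -> R) : (forall x y, `|H x - H y| <= K * `|x - y|) ->
    (forall n x, `|(r n).[phi n x] - H (phi n x)| <= inv_succ n) ->
    seq_cvg (L2form mu) (fun n x => (r n).[phi n x]) (H \o f).
  move=> HK rH.
  apply: (L2_cvg_dominated K0 _ p2 (L2_lipschitz K0 HK f2) f2 _ phil) => [n|n x /=].
    exact: (D_L2 (alg_poly DA (r n) (Dp n))).
  have -> : (r n).[phi n x] - H (f x) =
    ((r n).[phi n x] - H (phi n x)) + (H (phi n x) - H (f x)) by ring.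
  by rewrite (le_trans (ler_normD _ _))// lerD.
exists p; split.
- by apply: near => // n x; have [Hn _ _] := Hp n.
- move=> n; have [_ Hn _] := Hp n.
  exact: (energy_lip (Dp n) (alg_poly DA (p n) (Dp n)) K0 Hn).
- move=> n x; have [_ _ Hn] := Hp n.
  rewrite -[(p n)^`().[_]](subrK (F1 (phi n x))) addrC.
  rewrite (le_trans (ler_normD _ _))// lerD// (le_trans (Hn x))//.
  by rewrite (le_trans (inv_succ_le (leq0n n)))// /inv_succ invr1.
- by apply: (near (fun n => (p n)^`())) => // n x; have [_ _ Hn] := Hp n.
Qed.

Let quarter_sum (B y z e : R) :
  y * (4 * B) < e -> z * (4 * B) < e -> 2 * (B * y) + 2 * (B * z) <= e.
Proof. by move=> *; lra. Qed.

(** By the chain rule the mutual energy of two polynomials of core functions is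
    half the integral of [gam] against the product of their derivatives. That
    product stays bounded and tends to [a \* b = 0] in [L^2], while [gam]
    converges in [L^1]. *)
Lemma poly_energy_small (K e : R) (a b : E -> R) f (phi : nat -> E -> R)
    (p r : nat -> {poly R}) : 0 <= K -> 0 < e -> dom EE f ->
  (forall n, D (phi n)) -> seq_cvg EE phi f ->
  (forall n x, `|(p n)^`().[phi n x]| <= K + 1) ->
  (forall n x, `|(r n)^`().[phi n x]| <= K + 1) ->
  a \in L2 -> b \in L2 -> (forall x, `|a x| <= K) -> (forall x, a x * b x = 0) ->
  seq_cvg (L2form mu) (fun n x => (p n)^`().[phi n x]) a ->
  seq_cvg (L2form mu) (fun n x => (r n)^`().[phi n x]) b ->
  exists N, forall k l, (N <= k)%N -> (N <= l)%N ->
    `|EE (fun x => (p k).[phi k x]) (fun x => (r l).[phi l x])| <= e.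
Proof.
move=> K0 e0 ef Dp phie pB rB Fl2 Gl2 aK ab0 al bl.
have ep n := EE_dom (Dp n); have [N0 HN0] := EE_cvg_bounded ep ef phie.
pose u n x := (p n).[phi n x]; pose v n x := (r n).[phi n x].
pose c n x := (p n)^`().[phi n x]; pose s n x := (r n)^`().[phi n x].
have Du n : D (u n) := alg_poly DA (p n) (Dp n).
have Dv n : D (v n) := alg_poly DA (r n) (Dp n).
have Dc n : D (c n) := alg_poly DA (p n)^`() (Dp n).
have Ds n : D (s n) := alg_poly DA (r n)^`() (Dp n).
pose B := K + 1; have B0 : 0 < B by rewrite ltr_wpDl.
have B20 : 0 < B ^+ 2 by rewrite exprn_gt0.
have eB : 0 < e / B ^+ 2 by rewrite divr_gt0.
have [del del0 Hdel] := gam_close (EE f f + 1) eB.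
have d4 : 0 < del / 4 by rewrite divr_gt0.
have [N1 HN1] := (seq_cvgP eP ep ef).1 phie _ d4.
(* The varying [gam] is first frozen at the index [N], where it is in [L^2]. *)
pose N := maxn N0 N1; pose h := gam (phi N) (phi N).
have h2 : h \in L2 := gam_L2 (Dp N) (Dp N).
have hh0 : 0 <= ip h h := ip_ge0 mu h.
pose t := e / (ip h h + 1).
have t0 : 0 < t by rewrite divr_gt0// ltr_wpDl.
have s0 : 0 < e * t / (4 * B ^+ 2) by apply: divr_gt0; apply: mulr_gt0.
have c2 n := D_L2 (Dc n); have s2 n := D_L2 (Ds n).
have [N2 HN2] := (seq_cvgP lP c2 Fl2).1 al _ s0.
have [N3 HN3] := (seq_cvgP lP s2 Gl2).1 bl _ s0.
exists (maxn N (maxn N2 N3)) => k l.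
rewrite !geq_max => /andP[/andP[k0 k1] /andP[k2 _]] /andP[/andP[l0 l1] /andP[_ l3]].
have Dcs := algM DA (Dc k) (Ds l); have cs2 := D_L2 Dcs.
have csB x : `|(c k \* s l) x| <= B ^+ 2.
  by rewrite /= normrM expr2 ler_pM//; [exact: pB|exact: rB].
have E1 : 2 * EE (u k) (v l) = ip (gam (phi l) (phi k)) (c k \* s l).
  by rewrite EE_q//; exact: chain_rule.
have g2 := gam_L2 (Dp l) (Dp k); have gh := L2B g2 h2.
have near n : (N0 <= n)%N -> (N1 <= n)%N ->
    q (phi n) (phi n) <= EE f f + 1 /\ q (phi n \- phi N) (phi n \- phi N) < del.
  move=> n0 n1; rewrite -(EE_q (Dp n) (Dp n)); split; first exact: HN0.
  exact: near_dist (Dp n) (Dp N) ef (HN1 _ n1) (HN1 _ (leq_maxr _ _)).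
have [ql dl] := near l l0 l1; have [qk dk] := near k k0 k1.
have [qN _] := near N (leq_maxl _ _) (leq_maxr _ _).
have T1 : `|ip (gam (phi l) (phi k) \- h) (c k \* s l)| <= e.
  apply: le_trans (norm1_mulb (L2_intg gh) (meas_L2 cs2) csB) _.
  rewrite -ler_pdivlMl// mulrC ltW//.
  exact: (Hdel _ _ _ _ (Dp l) (Dp k) (Dp N) (Dp N) qk qN dl dk).
have cs_le : ip (c k \* s l) (c k \* s l) <= e * t.
  have da := L2B (c2 k) Fl2; have db := L2B (s2 l) Gl2.
  apply: le_trans (@ip_le2 B B _ _ _ (ltW B0) (ltW B0) da db cs2 _) _.
    move=> x /=.
    have -> : c k x * s l x = s l x * (c k x - a x) + a x * (s l x - b x).
      by rewrite mulrBr mulrBr ab0; ring.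
    rewrite (le_trans (ler_normD _ _))// !normrM lerD// ler_wpM2r//; first exact: rB.
    by rewrite (le_trans (aK _))// lerDl.
  have := HN2 _ k2; have := HN3 _ l3; rewrite /= !ltr_pdivlMr ?mulr_gt0//.
  by move=> Hs Hc; exact: quarter_sum Hc Hs.
have T2 : `|ip h (c k \* s l)| <= e.
  have Yg : 2 * `|ip h (c k \* s l)| <= t * ip h h + t^-1 * ip (c k \* s l) (c k \* s l).
    exact: (form_young lP t0 h2 cs2).
  have th : t * ip h h <= e.
    by rewrite /t mulrAC ler_pdivrMr ?ltr_wpDl// ler_pM2l// lerDl.
  have tcs : t^-1 * ip (c k \* s l) (c k \* s l) <= e by rewrite ler_pdivrMl// mulrC.
  by rewrite -(ler_pM2l (ltr0n R 2)) (le_trans Yg)// mulr_natl mulr2n lerD.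
have W : 2 * EE (u k) (v l) =
    ip (gam (phi l) (phi k) \- h) (c k \* s l) + ip h (c k \* s l).
  by have := bformBl lP g2 h2 cs2; rewrite /= -E1 => ->; rewrite subrK.
rewrite -(ler_pM2l (ltr0n R 2)) -[X in X * `|_|]normr_nat -normrM W.
by rewrite (le_trans (ler_normD _ _))// mulr_natl mulr2n lerD.
Qed.

(** The two limits are taken one at a time: weak convergence, which is what the
    bounded energies provide, does not pass to a joint limit. *)
Lemma C1_local (F F1 G G1 : R -> R) (K : R) f :
  lipschitz_C1 K F F1 -> lipschitz_C1 K G G1 -> dom EE f ->
  (forall x, F1 x * G1 x = 0) ->
  [/\ dom EE (F \o f), dom EE (G \o f) & EE (F \o f) (G \o f) = 0].
Proof.
move=> CF CG ef FG0; have [K0 dF F1K F1L] := CF; have [_ dG G1K G1L] := CG.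
have [eF _] := EE_lipschitz K0 (is_derive_lipschitz dF F1K) ef.
have [eG _] := EE_lipschitz K0 (is_derive_lipschitz dG G1K) ef.
split => //.
have [phi [Dp phil phie]] := EEcore ef.
have ep n := EE_dom (Dp n); have f2 := EE_L2 ef.
have [p [ul uq aB al]] := poly_core_approx CF f2 Dp phil.
have [r [vl vq bB bl]] := poly_core_approx CG f2 Dp phil.
pose u n x := (p n).[phi n x]; pose v n x := (r n).[phi n x].
have Du n : D (u n) := alg_poly DA (p n) (Dp n).
have Dv n : D (v n) := alg_poly DA (r n) (Dp n).
have [N0 HN0] := EE_cvg_bounded ep ef phie.
have bnd (w : nat -> E -> R) : (forall n, D (w n)) ->
    (forall n, q (w n) (w n) <= K ^+ 2 * q (phi n) (phi n)) ->
    exists N, forall n, (N <= n)%N -> EE (w n) (w n) <= K ^+ 2 * (EE f f + 1).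
  move=> Dw wq; exists N0 => n /HN0 Hn; rewrite EE_q//; apply: (le_trans (wq n)).
  by rewrite -(EE_q (Dp n) (Dp n)) ler_wpM2l ?sqr_ge0.
have c1 l : EE (u k) (v l) @[k --> \oo] --> EE (F \o f) (v l).
  exact: (closed_form_weak EEc (fun n => EE_dom (Du n)) eF (EE_dom (Dv l)) ul (bnd _ Du uq)).
have c2 : EE (v l) (F \o f) @[l --> \oo] --> EE (G \o f) (F \o f).
  exact: (closed_form_weak EEc (fun n => EE_dom (Dv n)) eG eF vl (bnd _ Dv vq)).
rewrite (bformC eP eF eG); apply/eqP; rewrite -normr_le0.
apply/ler_addgt0Pr => e e0; rewrite add0r.
have [N HN] := poly_energy_small K0 e0 ef Dp phie aB bB (L2_lipschitz K0 F1L f2)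
  (L2_lipschitz K0 G1L f2) (fun x => F1K (f x)) (fun x => FG0 (f x)) al bl.
apply: (cvgr_to_le (cvg_norm c2)); exists N => //= l Nl.
rewrite (bformC eP (EE_dom (Dv l)) eF).
by apply: (cvgr_to_le (cvg_norm (c1 l))); exists N => //= k Nk; exact: HN.
Qed.

End fourth_moments_vanish.

Lemma local_formP : local_form EE <->
  forall phi, D phi -> fourth_moment phi n @[n --> \oo] --> 0.
Proof.
split=> [loc phi|M4]; first exact: local_fourth.
move=> f F G ef tF tG FG0.
have [F1 [KF [KF0 CF F1S]]] := test_function_C1 tF.
have [G1 [KG [KG0 CG G1S]]] := test_function_C1 tG.
have F1G1 x : F1 x * G1 x = 0.
  have [Fx|Fx] := pselect (fun_support F x); last by rewrite F1S ?mul0r.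
  rewrite G1S ?mulr0// => Gx; have : (fun_support F `&` fun_support G) x by [].
  by rewrite FG0.
have [||eF eG FG] := @C1_local M4 F F1 G G1 (KF + KG) f _ _ ef F1G1.
- by apply: CF; rewrite lerDl.
- by apply: CG; rewrite lerDr.
by have [_ ->] := EE_shift (F 0) (G 0) eF eG.
Qed.
End limit_form.

(** * Complex convergence by parts *)

Section complex_numbers.
Context {R : realType}.
Implicit Types (z w : R[i]).

Lemma Re_mul z w : complex.Re (z * w) =
  complex.Re z * complex.Re w - complex.Im z * complex.Im w.
Proof. by case: z => a b; case: w. Qed.

Lemma Im_mul z w : complex.Im (z * w) =
  complex.Re z * complex.Im w + complex.Im z * complex.Re w.
Proof. by case: z => a b; case: w. Qed.

Lemma Re_add z w : complex.Re (z + w) = complex.Re z + complex.Re w.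
Proof. by case: z => a b; case: w. Qed.

Lemma Im_add z w : complex.Im (z + w) = complex.Im z + complex.Im w.
Proof. by case: z => a b; case: w. Qed.

Lemma Re_sub z w : complex.Re (z - w) = complex.Re z - complex.Re w.
Proof. by case: z => a b; case: w. Qed.

Lemma Im_sub z w : complex.Im (z - w) = complex.Im z - complex.Im w.
Proof. by case: z => a b; case: w. Qed.

Lemma Re_half z : complex.Re (z / 2) = complex.Re z / 2.
Proof.
have -> : complex.Re z = complex.Re (z / 2 + z / 2) by rewrite -splitr.
by rewrite Re_add; field.
Qed.

Lemma Im_half z : complex.Im (z / 2) = complex.Im z / 2.
Proof.
have -> : complex.Im z = complex.Im (z / 2 + z / 2) by rewrite -splitr.
by rewrite Im_add; field.
Qed.

Definition ReIm := (Re_half, Im_half, Re_mul, Im_mul, Re_sub, Im_sub, Re_add, Im_add).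

Lemma Re_norm_ge_Re z : `|complex.Re z| <= complex.Re `|z|.
Proof. by have := normc_ge_Re z; rewrite lecE => /andP[]. Qed.

Lemma Re_norm_ge_Im z : `|complex.Im z| <= complex.Re `|z|.
Proof.
rewrite normc_def /= -sqrtr_sqr ler_sqrt ?addr_ge0 ?sqr_ge0//.
by rewrite lerDr sqr_ge0.
Qed.

Lemma Re_norm_le z : complex.Re `|z| <= `|complex.Re z| + `|complex.Im z|.
Proof.
rewrite normc_def /= -[leRHS]ger0_norm ?addr_ge0// -sqrtr_sqr ler_sqrt ?sqr_ge0//.
rewrite sqrrD !real_normK ?num_real// lerD2r lerDl.
by rewrite mulrn_wge0// mulr_ge0.
Qed.

Lemma Im_norm z : complex.Im `|z| = 0.
Proof. by rewrite normc_def. Qed.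

Lemma complex_cvgP (z : nat -> R[i]) (l : R[i]) :
  ((z n : (R[i] : numFieldType)) @[n --> \oo] --> (l : (R[i] : numFieldType))) <->
  (complex.Re (z n) @[n --> \oo] --> complex.Re l /\
   complex.Im (z n) @[n --> \oo] --> complex.Im l).
Proof.
split=> [/cvgrPdist_lt zl|[/cvgrPdist_lt rl /cvgrPdist_lt il]].
  split; apply/cvgrPdist_lt => e e0.
    have /zl : 0 < (e%:C)%C :> R[i] by rewrite ltcE /= eqxx.
    apply: filterS => n; rewrite ltcE /= => /andP[_]; apply: le_lt_trans.
    by rewrite -Re_sub; exact: Re_norm_ge_Re.
  have /zl : 0 < (e%:C)%C :> R[i] by rewrite ltcE /= eqxx.
  apply: filterS => n; rewrite ltcE /= => /andP[_]; apply: le_lt_trans.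
  by rewrite -Im_sub; exact: Re_norm_ge_Im.
apply/cvgrPdist_lt => e; rewrite ltcE /= => /andP[/eqP ei er].
have e2 : 0 < complex.Re e / 2 by rewrite divr_gt0.
near=> n; rewrite ltcE Im_norm ei eqxx /=.
apply: le_lt_trans (Re_norm_le _) _; rewrite Re_sub Im_sub [ltRHS]splitr ltrD//.
  by near: n; exact: rl.
by near: n; exact: il.
Unshelve. all: by end_near. Qed.

End complex_numbers.

(** * Complex test functions *)

Section complex_test_functions.
Context (R : realType) (dO dE : measure_display)
    (Omega : measurableType dO) (E : measurableType dE)
    (P : probability Omega R) (mu : probability E R)
    (Y : {RV P >-> E}) (Yn : nat -> {RV P >-> E})
    (alpha : nat -> R) (alpha_gt0 : forall n, 0 < alpha n).
Variables (D : set (E -> R[i])) (A : (E -> R[i]) -> E -> R[i]).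
Hypotheses (DA : bounded_algebra D)
  (DJ : forall phi, D phi -> D (fun y => ((phi y)^*)%C))
  (Dm : forall phi, D phi -> cmeasurable phi)
  (Dd : cL2_dense mu D).
Hypothesis HA : forall phi, D phi -> cLfun2 mu (A phi) /\
  forall chi, D chi ->
    ((((alpha n)%:C)%C * cintegral P (fun w => (phi (Yn n w) - phi (Y w)) *
                                         (chi (Yn n w) - chi (Y w)))
       : (R[i] : numFieldType)) @[n --> \oo] -->
     (- 2 * cintegral mu (fun y => A phi y * chi y) : (R[i] : numFieldType))).
Implicit Types (f g phi psi chi : E -> R[i]) (u v : E -> R).

Local Notation re f := (fun x => complex.Re (f x)).
Local Notation im f := (fun x => complex.Im (f x)).
Local Notation RD := (real_part D).
Local Notation L2 := (Lfun mu 2%:E).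
Local Notation ip := (ip mu).

(** The generator of the real form: real functions are embedded, and the
    imaginary part of the result is discarded, being zero almost everywhere. *)
Definition generator_re u : E -> R := re (A (complexify u)).
Local Notation AR := generator_re.

Let Dcst (c : R[i]) : D (cst c). Proof. by case: DA. Qed.
Let DD f g : D f -> D g -> D (f \+ g). Proof. by case: DA => _ + _ _; apply. Qed.
Let DM f g : D f -> D g -> D (f \* g). Proof. by case: DA => _ _ + _; apply. Qed.

Lemma re_dom f : D f -> RD (re f).
Proof.
move=> Df; rewrite /real_part /=.
have -> : complexify (re f) = (f \+ (fun y => ((f y)^*)%C)) \* cst (2^-1).
  by apply/funext => x; rewrite /complexify /= ReJ_add.
by apply: DM => //; apply: DD => //; exact: DJ.
Qed.

Lemma im_dom f : D f -> RD (im f).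
Proof.
move=> Df; have -> : im f = re (f \* cst (- 'i)%C).
  by apply/funext => x /=; rewrite Re_mul /= oppr0; ring.
by apply: re_dom; exact: DM.
Qed.

Lemma real_part_algebra : bounded_algebra RD.
Proof.
split => [c|f g Df Dg|f g Df Dg|f Df].
- exact: (Dcst c%:C%C).
- rewrite /real_part /=; have -> : complexify (f \+ g) = complexify f \+ complexify g.
    by apply/funext => x; rewrite /complexify /= rmorphD.
  exact: DD.
- rewrite /real_part /=; have -> : complexify (f \* g) = complexify f \* complexify g.
    by apply/funext => x; rewrite /complexify /= rmorphM.
  exact: DM.
- case: DA => _ _ _ /(_ _ Df)[M fM]; exists (complex.Re M) => x.
  have := fM x; rewrite lecE => /andP[_]; apply: le_trans.
  exact: Re_norm_ge_Re (complexify f x).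
Qed.

Lemma real_part_measurable u : RD u -> measurable_fun setT u.
Proof. by case/Dm. Qed.

(** The real part of a complex approximant is at least as close to a real
    function as the approximant itself. *)
Lemma real_part_dense : L2_dense mu RD.
Proof.
move=> u u2 e e0.
have cu2 : cLfun2 mu (complexify u) by split => //; exact: L2_cst.
have [g Dg ge] := Dd cu2 e0; exists (re g); first exact: re_dom.
have rg2 : re g \in L2.
  exact: (alg_L2 mu real_part_algebra real_part_measurable (re_dom Dg)).
have ig2 : im g \in L2.
  exact: (alg_L2 mu real_part_algebra real_part_measurable (im_dom Dg)).
have n2 : (fun x => complex.Re `|complexify u x - g x|) \in L2.
  apply: (L2_le (f := (fun x => `|u x - complex.Re (g x)|) \+ (fun x => `|complex.Im (g x)|))).
  - rewrite (_ : (fun _ => _) = fun x => Num.sqrt ((u x - complex.Re (g x)) ^+ 2 +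
       (complex.Im (g x)) ^+ 2)); last first.
      by apply/funext => x; rewrite normc_def /= Re_sub Im_sub sub0r sqrrN.
    apply: (measurableT_comp (continuous_measurable_fun (@sqrt_continuous R))).
    apply: measurable_funD; apply: measurable_funX; last exact: meas_L2 ig2.
    by apply: measurable_funB; [exact: meas_L2 u2|exact: meas_L2 rg2].
  - move=> x /=; rewrite [leRHS]ger0_norm ?addr_ge0// [leLHS]ger0_norm; last first.
      by apply: le_trans (Re_norm_ge_Re _); exact: normr_ge0.
    apply: le_trans (Re_norm_le _) _; rewrite Re_sub Im_sub /=.
    by rewrite sub0r normrN.
  - by apply: L2D; apply: L2_norm => //; exact: L2B.
have urg2 : u \- re g \in L2 by exact: L2B.
rewrite Lnorm2_lt//; apply: (@le_lt_trans _ _ (ip (fun x => complex.Re `|complexify u x - g x|)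
   (fun x => complex.Re `|complexify u x - g x|))).
  apply: ip_le => // x /=; rewrite [leRHS]ger0_norm; last first.
    by apply: le_trans (Re_norm_ge_Re _); exact: normr_ge0.
  by have := Re_norm_ge_Re (complexify u x - g x); rewrite Re_sub.
by rewrite -Lnorm2_lt.
Qed.

Local Notation EP := (expect P alpha).
Local Notation incr := (incr Y Yn).
Local Notation avg := (avg Y Yn).

Lemma cexpect_Re n (h : Omega -> R[i]) :
  complex.Re (((alpha n)%:C)%C * cintegral P h) = EP n (re h).
Proof. by rewrite Re_mul /= mul0r subr0. Qed.

Lemma cexpect_Im n (h : Omega -> R[i]) :
  complex.Im (((alpha n)%:C)%C * cintegral P h) = EP n (im h).
Proof. by rewrite Im_mul /= mul0r addr0. Qed.

Lemma cexpect_cvgP (h : nat -> Omega -> R[i]) (l : R[i]) :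
  ((((alpha n)%:C)%C * cintegral P (h n) : (R[i] : numFieldType)) @[n --> \oo] -->
    (l : (R[i] : numFieldType))) <->
  (EP n (re (h n)) @[n --> \oo] --> complex.Re l /\
   EP n (im (h n)) @[n --> \oo] --> complex.Im l).
Proof.
split.
  move=> /complex_cvgP[]; rewrite (eq_cvg _ _ (fun n => cexpect_Re n (h n))).
  by rewrite (eq_cvg _ _ (fun n => cexpect_Im n (h n))).
move=> [hr hi]; apply/complex_cvgP.
rewrite (eq_cvg _ _ (fun n => cexpect_Re n (h n))).
by rewrite (eq_cvg _ _ (fun n => cexpect_Im n (h n))).
Qed.

(** Testing [A phi] against real functions only sees the increments of the real
    and imaginary parts of [phi] separately. *)
Lemma generator_parts phi (chi : E -> R) : D phi -> RD chi ->
  (EP n (fun w => incr n (re phi) w * incr n chi w) @[n --> \oo] -->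
     - 2 * \int[mu]_y (complex.Re (A phi y) * chi y)) /\
  (EP n (fun w => incr n (im phi) w * incr n chi w) @[n --> \oo] -->
     - 2 * \int[mu]_y (complex.Im (A phi y) * chi y)).
Proof.
move=> Dp Dc; have [_ /(_ _ Dc)/cexpect_cvgP[]] := HA Dp.
have c2 : (- 2 : R[i]) = ((- 2 : R)%:C)%C by rewrite rmorphN /= rmorph_nat.
rewrite c2 Re_mul Im_mul /= !mul0r subr0 addr0.
have E1 : \int[mu]_x complex.Re (A phi x * complexify chi x) =
    \int[mu]_x (complex.Re (A phi x) * chi x).
  by apply: eq_Rintegral => x _; rewrite Re_mul /= mulr0 subr0.
have E2 : \int[mu]_x complex.Im (A phi x * complexify chi x) =
    \int[mu]_x (complex.Im (A phi x) * chi x).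
  by apply: eq_Rintegral => x _; rewrite Im_mul /= mulr0 add0r.
rewrite E1 E2.
have F1 n : EP n (fun w => complex.Re ((phi (Yn n w) - phi (Y w)) *
    (complexify chi (Yn n w) - complexify chi (Y w)))) =
    EP n (fun w => incr n (re phi) w * incr n chi w).
  by apply: eq_expect => w; rewrite !ReIm /complexify /= subrr mulr0 subr0.
have F2 n : EP n (fun w => complex.Im ((phi (Yn n w) - phi (Y w)) *
    (complexify chi (Yn n w) - complexify chi (Y w)))) =
    EP n (fun w => incr n (im phi) w * incr n chi w).
  by apply: eq_expect => w; rewrite !ReIm /complexify /= subrr mulr0 add0r.
by rewrite (eq_cvg _ _ F1) (eq_cvg _ _ F2).
Qed.

Lemma generator_reP u : RD u -> AR u \in L2 /\
  forall v, RD v ->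
    alpha n * \int[P]_w ((u (Yn n w) - u (Y w)) * (v (Yn n w) - v (Y w)))
      @[n --> \oo] --> - 2 * \int[mu]_y (AR u y * v y).
Proof.
move=> Du; split; first by have [[]] := HA Du.
by move=> v /(generator_parts Du)[+ _]; exact.
Qed.

Local Notation q := (BForm RD (limit_form P Y Yn alpha)).
Let RA := real_part_algebra.
Let Rm := real_part_measurable.
Let Rd := real_part_dense.
Let qP : positive_form mu q := limit_form_positive alpha_gt0 RA Rm generator_reP.

Lemma generator_Re phi : D phi -> re (A phi) = AR (re phi) %[ae mu].
Proof.
move=> Dp; have [[A2 _] _] := HA Dp; have [B2 HB] := generator_reP (re_dom Dp).
apply: (alg_test_ae RA Rm Rd A2 B2) => chi Dc.
have [h1 _] := generator_parts Dp Dc; have h2 := HB _ Dc.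
have e : - 2 * ip (re (A phi)) chi = - 2 * ip (AR (re phi)) chi.
  exact: (cvg_unique _ h1 h2).
by apply: mulfI e; rewrite oppr_eq0 pnatr_eq0.
Qed.

Lemma generator_Im phi : D phi -> im (A phi) = AR (im phi) %[ae mu].
Proof.
move=> Dp; have [[_ A2] _] := HA Dp; have [B2 HB] := generator_reP (im_dom Dp).
apply: (alg_test_ae RA Rm Rd A2 B2) => chi Dc.
have [_ h1] := generator_parts Dp Dc; have h2 := HB _ Dc.
have e : - 2 * ip (im (A phi)) chi = - 2 * ip (AR (im phi)) chi.
  exact: (cvg_unique _ h1 h2).
by apply: mulfI e; rewrite oppr_eq0 pnatr_eq0.
Qed.

Lemma generator_re_lin (a : R) u v : RD u -> RD v ->
  AR (a \*o u \+ v) = a \*o AR u \+ AR v %[ae mu].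
Proof.
move=> Du Dv; have lP := L2form_positive mu.
have Dl : RD (a \*o u \+ v) by apply: (algD RA) => //; exact: (algZ RA).
have [A1 _] := generator_reP Du; have [A2 _] := generator_reP Dv.
have [A3 _] := generator_reP Dl.
apply: (alg_test_ae RA Rm Rd A3); first exact: L2_lin.
move=> chi Dc; have c2 := alg_L2 mu RA Rm Dc.
have /= -> := form_lin lP a A1 A2 c2; apply: oppr_inj.
rewrite opprD -mulrN -!(limit_formE generator_reP)//.
exact: (form_lin qP).
Qed.

Let RM u v : RD u -> RD v -> RD (u \* v). Proof. exact: (algM RA). Qed.

Let bi n u : RD u -> bmeas (incr n u). Proof. exact: bmeas_incr. Qed.

Lemma capprox_form_cvg f g : D f -> D g ->
  (capprox_form P Y Yn alpha n f g @[n --> \oo] -->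
   (((q (re f) (re g) - q (im f) (im g)) +i* (q (re f) (im g) + q (im f) (re g)))%C
     : (R[i] : numFieldType))).
Proof.
move=> Df Dg; have Dfr := re_dom Df; have Dfi := im_dom Df.
have Dgr := re_dom Dg; have Dgi := im_dom Dg.
have ex := expect_incr generator_reP.
apply/complex_cvgP => /=; split.
- have E1 n : complex.Re (capprox_form P Y Yn alpha n f g) =
      2^-1 * (1 * EP n (fun w => incr n (re f) w * incr n (re g) w) +
              - 1 * EP n (fun w => incr n (im f) w * incr n (im g) w)).
    rewrite -expect_lin; [|by apply: bmeasM; exact: bi..].
    rewrite Re_mul /= mul0r subr0 /expect mulrCA mulrA; congr (_ * _).
    by apply: eq_Rintegral => w _; rewrite !ReIm mul1r mulN1r.
  rewrite (eq_cvg _ _ E1).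
  have -> : q (re f) (re g) - q (im f) (im g) =
      2^-1 * (1 * (2 * q (re f) (re g)) + - 1 * (2 * q (im f) (im g))).
    by move: (q _ _) (q (im f) _) => a b; field.
  by apply: cvgM; [exact: cvg_cst|apply: cvgD; apply: cvgM;
    (exact: cvg_cst || exact: ex)].
- have E1 n : complex.Im (capprox_form P Y Yn alpha n f g) =
      2^-1 * (1 * EP n (fun w => incr n (re f) w * incr n (im g) w) +
              1 * EP n (fun w => incr n (im f) w * incr n (re g) w)).
    rewrite -expect_lin; [|by apply: bmeasM; exact: bi..].
    rewrite Im_mul /= mul0r addr0 /expect mulrCA mulrA; congr (_ * _).
    by apply: eq_Rintegral => w _; rewrite !ReIm !mul1r.
  rewrite (eq_cvg _ _ E1).
  have -> : q (re f) (im g) + q (im f) (re g) =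
      2^-1 * (1 * (2 * q (re f) (im g)) + 1 * (2 * q (im f) (re g))).
    by move: (q _ _) (q (im f) _) => a b; field.
  by apply: cvgM; [exact: cvg_cst|apply: cvgD; apply: cvgM;
    (exact: cvg_cst || exact: ex)].
Qed.

Lemma climit_formE f g : D f -> D g -> climit_form P Y Yn alpha f g =
  ((q (re f) (re g) - q (im f) (im g)) +i* (q (re f) (im g) + q (im f) (re g)))%C.
Proof.
move=> Df Dg; rewrite /climit_form.
exact: (cvg_lim (@norm_hausdorff _ (R[i] : numFieldType)) (capprox_form_cvg Df Dg)).
Qed.

Let q0l u : RD u -> q (cst 0) u = 0. Proof. exact: (bform0l qP). Qed.

Lemma climit_form_real u v : RD u -> RD v ->
  climit_form P Y Yn alpha (complexify u) (complexify v) =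
  ((limit_form P Y Yn alpha u v)%:C)%C.
Proof.
move=> Du Dv; rewrite climit_formE//.
have D0 : RD (cst 0) := alg_cst RA 0.
have -> : q (im (complexify u)) (im (complexify v)) = 0 := q0l D0.
have -> : q (im (complexify u)) (re (complexify v)) = 0 := q0l Dv.
have -> : q (re (complexify u)) (im (complexify v)) = 0.
  by rewrite (bformC qP Du D0); exact: q0l.
by rewrite subr0 addr0.
Qed.

Lemma climit_form_bilinear : sym_bilinear_on mu D (climit_form P Y Yn alpha).
Proof.
have rd := re_dom; have id := im_dom.
split=> [f g Df Dg|a f g h Df Dg Dh|f f' g Df Df' Dg ff'].
- rewrite !climit_formE// (bformC qP (rd _ Df) (rd _ Dg)) (bformC qP (id _ Df) (id _ Dg)).
  rewrite (bformC qP (rd _ Df) (id _ Dg)) (bformC qP (id _ Df) (rd _ Dg)).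
  by rewrite [X in (_ +i* X)%C]addrC.
- have Dl : D (a \*o f \+ g) by apply: DD => //; exact: (DM (Dcst a) Df).
  rewrite !climit_formE//.
  have -> : re (a \*o f \+ g) =
      complex.Re a \*o re f \+ ((- complex.Im a) \*o im f \+ re g).
    by apply/funext => x /=; rewrite !ReIm; ring.
  have -> : im (a \*o f \+ g) =
      complex.Re a \*o im f \+ (complex.Im a \*o re f \+ im g).
    by apply/funext => x /=; rewrite !ReIm; ring.
  have d1 := algD RA (algZ RA (- complex.Im a) (id _ Df)) (rd _ Dg).
  have d2 := algD RA (algZ RA (complex.Im a) (rd _ Df)) (id _ Dg).
  have Dfr := rd _ Df; have Dfi := id _ Df; have Dgr := rd _ Dg.
  have Dgi := id _ Dg; have Dhr := rd _ Dh; have Dhi := id _ Dh.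
  rewrite !(form_lin qP)//.
  move: (q (re f) _) (q (re f) _) (q (im f) _) (q (im f) _).
  move: (q (re g) _) (q (re g) _) (q (im g) _) (q (im g) _).
  move=> r1 r2 r3 r4 r5 r6 r7 r8; case: a {Dl d1 d2} => x y /=.
  by apply/eqP; rewrite eq_complex /=; apply/andP; split; apply/eqP; ring.
- have rr : re f = re f' %[ae mu] by apply: filterS ff' => x /= /[apply] ->.
  have ii : im f = im f' %[ae mu] by apply: filterS ff' => x /= /[apply] ->.
  have ae u u' v : RD u -> RD u' -> RD v -> u = u' %[ae mu] -> q u v = q u' v.
    by move=> Du Du' Dv; exact: (form_ae qP Du Du' Dv).
  rewrite !climit_formE// (ae _ _ _ (rd _ Df) (rd _ Df') (rd _ Dg) rr).
  rewrite (ae _ _ _ (id _ Df) (id _ Df') (id _ Dg) ii).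
  rewrite (ae _ _ _ (rd _ Df) (rd _ Df') (id _ Dg) rr).
  by rewrite (ae _ _ _ (id _ Df) (id _ Df') (rd _ Dg) ii).
Qed.

(** Almost everywhere [A] acts separately on real and imaginary parts, by
    [generator_Re] and [generator_Im]; what remains is the bilinear expansion of
    the square. *)
Lemma generator_square phi : D phi ->
  (fun y => A (phi \* phi) y - 2 * phi y * A phi y) =
  (fun y => ((gam AR (re phi) (re phi) y - gam AR (im phi) (im phi) y) +i*
     (gam AR (re phi) (im phi) y + gam AR (im phi) (re phi) y))%C) %[ae mu].
Proof.
move=> Dp; have Du := re_dom Dp; have Dv := im_dom Dp.
have Dpp := DM Dp Dp; have Duu := RM Du Du; have Dvv := RM Dv Dv.
have Duv := RM Du Dv; have Dvu := RM Dv Du.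
have RE : re (phi \* phi) = - 1 \*o (im phi \* im phi) \+ (re phi \* re phi).
  by apply/funext => x /=; rewrite !ReIm; ring.
have IM : im (phi \* phi) = 1 \*o (re phi \* im phi) \+ (im phi \* re phi).
  by apply/funext => x /=; rewrite !ReIm; ring.
have h1 := generator_Re Dpp; have h2 := generator_Im Dpp.
rewrite RE in h1; rewrite IM in h2.
have h3 := generator_re_lin (- 1) Dvv Duu; have h4 := generator_re_lin 1 Duv Dvu.
have h5 := generator_Re Dp; have h6 := generator_Im Dp.
have h12 : \forall x \ae mu, complex.Re (A (phi \* phi) x) =
    - AR (im phi \* im phi) x + AR (re phi \* re phi) x /\
    complex.Im (A (phi \* phi) x) =
    AR (re phi \* im phi) x + AR (im phi \* re phi) x.
  apply: filterS2 (filterI h1 h2) (filterI h3 h4) => x /= [e1 e2] [e3 e4].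
  by rewrite e1// e2// e3// e4// mulN1r mul1r.
apply: filterS2 h12 (filterI h5 h6) => x /= [e1 e2] [e5 e6] _.
have {}e5 := e5 I; have {}e6 := e6 I.
apply/eqP; rewrite eq_complex /=.
have two : (2 : R[i]) = (2%:C)%C by rewrite rmorph_nat.
rewrite two !ReIm /= e1 e2 e5 e6 /gam /=.
by apply/andP; split; apply/eqP; ring.
Qed.

Variable EE : bform E R.
Hypotheses (EEc : closed_form mu EE) (EEx : extends EE q).
Hypothesis EEcore : forall (f : E -> R), dom EE f -> exists u : nat -> E -> R,
  [/\ forall n, RD (u n), seq_cvg (L2form mu) u f & seq_cvg EE u f].
Local Notation G := (gamma mu RD AR EE).

Let G_gam u v : RD u -> RD v -> G u v = gam AR u v %[ae mu].
Proof. exact: (gamma_gam alpha_gt0 RA Rm Rd generator_reP EEc EEx EEcore). Qed.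

Let G_intg u v chi : RD u -> RD v -> D chi ->
  mu.-integrable setT (EFin \o (fun y => G u v y * complex.Re (chi y))) /\
  mu.-integrable setT (EFin \o (fun y => G u v y * complex.Im (chi y))).
Proof.
move=> Du Dv Dc.
have [GI _ _ _ _] := EE_square_field alpha_gt0 RA Rm Rd generator_reP EEc EEx EEcore.
have IG : mu.-integrable setT (EFin \o G u v).
  by apply/Lfun1_integrable/GI; case: EEx => + _; apply.
by split; apply: intg_mulb => //; (apply: Rm || apply: (alg_bounded RA));
  (exact: re_dom || exact: im_dom).
Qed.

Lemma cextension_generator phi : D phi -> cextension G phi phi =
  (fun y => A (phi \* phi) y - 2 * phi y * A phi y) %[ae mu].
Proof.
move=> Dp; have Du := re_dom Dp; have Dv := im_dom Dp.
apply: filterS2 (generator_square Dp) (filterI (filterI (G_gam Du Du) (G_gam Dv Dv))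
  (filterI (G_gam Du Dv) (G_gam Dv Du))) => y /= /(_ I) -> [[e1 e2] [e3 e4]] _.
by rewrite /cextension e1// e2// e3// e4.
Qed.

Lemma cextension_limit phi chi : D phi -> D chi ->
  ((((alpha n)%:C)%C * cintegral P (fun w => (phi (Yn n w) - phi (Y w)) ^+ 2 *
       ((chi (Yn n w) + chi (Y w)) / 2)) : (R[i] : numFieldType)) @[n --> \oo] -->
   (cintegral mu (fun y => cextension G phi phi y * chi y) : (R[i] : numFieldType))).
Proof.
move=> Dp Dc; have Du := re_dom Dp; have Dv := im_dom Dp.
have Ds := re_dom Dc; have Dt := im_dom Dc.
have lim u v s : RD u -> RD v -> RD s ->
    EP n (fun w => incr n u w * incr n v w * avg n s w) @[n --> \oo] -->
    \int[mu]_y (G u v y * s y).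
  move=> Du' Dv' Ds'.
  exact: (expect_gamma alpha_gt0 RA Rm Rd generator_reP EEc EEx EEcore Ds' Du' Dv').
have bt n u v s : RD u -> RD v -> RD s ->
    bmeas (fun w => incr n u w * incr n v w * avg n s w).
  move=> Du' Dv' Ds'; apply: bmeasM; first by apply: bmeasM; exact: bi.
  exact: (bmeas_avg Y Yn RA Rm).
have bl (a a' : R) X Z : bmeas X -> bmeas Z -> bmeas (fun w : Omega => a * X w + a' * Z w).
  by move=> bX bZ; apply: bmeasD; apply: bmeasM => //; exact: bmeas_cst.
have [I1 I1'] := G_intg Du Du Dc; have [I2 I2'] := G_intg Dv Dv Dc.
have [I3 I3'] := G_intg Du Dv Dc; have [I4 I4'] := G_intg Dv Du Dc.
apply/cexpect_cvgP; split.
- have E1 n : EP n (fun w => complex.Re ((phi (Yn n w) - phi (Y w)) ^+ 2 *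
       ((chi (Yn n w) + chi (Y w)) / 2))) =
     1 * (1 * EP n (fun w => incr n (re phi) w * incr n (re phi) w * avg n (re chi) w) +
          - 1 * EP n (fun w => incr n (im phi) w * incr n (im phi) w * avg n (re chi) w)) +
     - 1 * (1 * EP n (fun w => incr n (re phi) w * incr n (im phi) w * avg n (im chi) w) +
          1 * EP n (fun w => incr n (im phi) w * incr n (re phi) w * avg n (im chi) w)).
    rewrite -!expect_lin; try exact: bt; try by apply: bl; exact: bt.
    by apply: eq_expect => w; rewrite expr2 !ReIm /incr /avg; ring.
  rewrite (eq_cvg _ _ E1).
  have -> : complex.Re (cintegral mu (fun y => cextension G phi phi y * chi y)) =
     1 * (1 * \int[mu]_y (G (re phi) (re phi) y * complex.Re (chi y)) +
          - 1 * \int[mu]_y (G (im phi) (im phi) y * complex.Re (chi y))) +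
     - 1 * (1 * \int[mu]_y (G (re phi) (im phi) y * complex.Im (chi y)) +
          1 * \int[mu]_y (G (im phi) (re phi) y * complex.Im (chi y))).
    rewrite /= !mul1r !mulN1r -RintegralB// -RintegralD// -RintegralB//.
    + by apply: eq_Rintegral => y _; rewrite Re_mul /cextension /=; ring.
    + exact: intgB.
    + exact: intgD.
  by apply: cvgD; apply: cvgM; try exact: cvg_cst; apply: cvgD; apply: cvgM;
    (exact: cvg_cst || exact: lim).
- have E1 n : EP n (fun w => complex.Im ((phi (Yn n w) - phi (Y w)) ^+ 2 *
       ((chi (Yn n w) + chi (Y w)) / 2))) =
     1 * (1 * EP n (fun w => incr n (re phi) w * incr n (re phi) w * avg n (im chi) w) +
          - 1 * EP n (fun w => incr n (im phi) w * incr n (im phi) w * avg n (im chi) w)) +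
     1 * (1 * EP n (fun w => incr n (re phi) w * incr n (im phi) w * avg n (re chi) w) +
          1 * EP n (fun w => incr n (im phi) w * incr n (re phi) w * avg n (re chi) w)).
    rewrite -!expect_lin; try exact: bt; try by apply: bl; exact: bt.
    by apply: eq_expect => w; rewrite expr2 !ReIm /incr /avg; ring.
  rewrite (eq_cvg _ _ E1).
  have -> : complex.Im (cintegral mu (fun y => cextension G phi phi y * chi y)) =
     1 * (1 * \int[mu]_y (G (re phi) (re phi) y * complex.Im (chi y)) +
          - 1 * \int[mu]_y (G (im phi) (im phi) y * complex.Im (chi y))) +
     1 * (1 * \int[mu]_y (G (re phi) (im phi) y * complex.Re (chi y)) +
          1 * \int[mu]_y (G (im phi) (re phi) y * complex.Re (chi y))).
    rewrite /= !mul1r !mulN1r -RintegralB// -!RintegralD//.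
    + by apply: eq_Rintegral => y _; rewrite Im_mul /cextension /=; ring.
    + exact: intgB.
    + exact: intgD.
  by apply: cvgD; apply: cvgM; try exact: cvg_cst; apply: cvgD; apply: cvgM;
    (exact: cvg_cst || exact: lim).
Qed.

(** The real and imaginary parts of the fourth power of a complex increment are
    combinations of products of four real increments. *)
Lemma complex_fourth_moment :
  (forall u, RD u -> fourth_moment Y Yn alpha u n @[n --> \oo] --> 0) <->
  (forall phi, D phi ->
    ((((alpha n)%:C)%C * cintegral P (fun w => (phi (Yn n w) - phi (Y w)) ^+ 4)
       : (R[i] : numFieldType)) @[n --> \oo] --> (0 : (R[i] : numFieldType)))).
Proof.
split=> [M4 phi Dp|H u Du]; last first.
  have /cexpect_cvgP[+ _] := H _ Du.
  have E1 n : EP n (fun w => complex.Re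
     ((complexify u (Yn n w) - complexify u (Y w)) ^+ 4)) = fourth_moment Y Yn alpha u n.
    by apply: eq_expect => w; rewrite !exprS expr0 mulr1 !ReIm /complexify /incr /=; ring.
  by rewrite (eq_cvg _ _ E1).
have Du := re_dom Dp; have Dv := im_dom Dp.
have lim := expect_prod4 alpha_gt0 RA Rm M4.
have bp n (u v f g : E -> R) : RD u -> RD v -> RD f -> RD g ->
    bmeas (fun w => incr n u w * incr n v w * incr n f w * incr n g w).
  by move=> ? ? ? ?; apply: bmeasM; [apply: bmeasM; [apply: bmeasM|]|]; exact: bi.
have bl (a a' : R) X Z : bmeas X -> bmeas Z -> bmeas (fun w : Omega => a * X w + a' * Z w).
  by move=> bX bZ; apply: bmeasD; apply: bmeasM => //; exact: bmeas_cst.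
pose m (u v f g : E -> R) n := EP n (fun w => incr n u w * incr n v w * incr n f w * incr n g w).
have m0 (u v f g : E -> R) : RD u -> RD v -> RD f -> RD g -> m u v f g n @[n --> \oo] --> 0.
  exact: lim.
apply/cexpect_cvgP; split => /=.
- have E1 n : EP n (fun w => complex.Re ((phi (Yn n w) - phi (Y w)) ^+ 4)) =
     1 * (1 * m (re phi) (re phi) (re phi) (re phi) n +
          - 6 * m (re phi) (re phi) (im phi) (im phi) n) +
     1 * m (im phi) (im phi) (im phi) (im phi) n.
    rewrite /m -!expect_lin; try exact: bp; try by apply: bl; exact: bp.
    by apply: eq_expect => w; rewrite !exprS expr0 mulr1 !ReIm /incr; ring.
  rewrite (eq_cvg _ _ E1).
  have c := cvgD0 (cvgMl0 1 (m0 _ _ _ _ Du Du Du Du)) (cvgMl0 (- 6) (m0 _ _ _ _ Du Du Dv Dv)).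
  exact: (cvgD0 (cvgMl0 1 c) (cvgMl0 1 (m0 _ _ _ _ Dv Dv Dv Dv))).
- have E1 n : EP n (fun w => complex.Im ((phi (Yn n w) - phi (Y w)) ^+ 4)) =
     4 * m (re phi) (re phi) (re phi) (im phi) n +
     - 4 * m (re phi) (im phi) (im phi) (im phi) n.
    rewrite /m -!expect_lin; try exact: bp.
    by apply: eq_expect => w; rewrite !exprS expr0 mulr1 !ReIm /incr; ring.
  rewrite (eq_cvg _ _ E1).
  exact: (cvgD0 (cvgMl0 4 (m0 _ _ _ _ Du Du Du Dv)) (cvgMl0 (- 4) (m0 _ _ _ _ Du Dv Dv Dv))).
Qed.

End complex_test_functions.

Local Open Scope complex_scope.

Theorem theorem1 (R : realType) (dO dE : measure_display)
    (Omega : measurableType dO) (E : measurableType dE)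
    (P : probability Omega R)
    (Y : {RV P >-> E}) (Yn : nat -> {RV P >-> E})
    (alpha : nat -> R) (alpha_gt0 : forall n, 0 < alpha n) :
  (* real-valued test functions *)
  (forall (D : set (E -> R)) (A : (E -> R) -> E -> R),
    bounded_algebra D ->
    (forall phi, D phi -> measurable_fun setT phi) ->
    L2_dense (distribution P Y) D ->
    (forall phi, D phi ->
      A phi \in Lfun (distribution P Y) 2%:E /\
      forall chi, D chi ->
        alpha n * \int[P]_w ((phi (Yn n w) - phi (Y w)) *
                             (chi (Yn n w) - chi (Y w)))
          @[n --> \oo] -->
        - 2 * \int[distribution P Y]_y (A phi y * chi y)) ->
    let q := BForm D (limit_form P Y Yn alpha) in
    (* (a) *)
    [/\ forall phi chi, D phi -> D chi ->
          cvg (approx_form P Y Yn alpha n phi chi @[n --> \oo]),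
        positive_form (distribution P Y) q,
        closable (distribution P Y) q &
    exists2 EE : bform E R,
      smallest_closed_extension (distribution P Y) q EE &
    [/\ (* (b) *) dirichlet_form (distribution P Y) EE,
        (* (c) *)
        exists2 G : (E -> R) -> (E -> R) -> E -> R,
          square_field_operator (distribution P Y) EE G &
          forall phi chi, D phi -> D chi ->
            (G phi phi = (fun y => A (phi \* phi) y - 2 * phi y * A phi y)
               %[ae (distribution P Y)]) /\
            alpha n * \int[P]_w ((phi (Yn n w) - phi (Y w)) ^+ 2 *
                                 ((chi (Yn n w) + chi (Y w)) / 2))
              @[n --> \oo] -->
            \int[distribution P Y]_y (G phi phi y * chi y) &
        (* (d) *)
        local_form EE <->
        forall phi, D phi ->
          alpha n * \int[P]_w ((phi (Yn n w) - phi (Y w)) ^+ 4)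
            @[n --> \oo] --> (0 : R)]])
  /\
  (* complex-valued test functions *)
  (forall (D : set (E -> R[i])) (A : (E -> R[i]) -> E -> R[i]),
    bounded_algebra D ->
    (forall phi, D phi -> D (fun y => (phi y)^*)) ->
    (forall phi, D phi -> cmeasurable phi) ->
    cL2_dense (distribution P Y) D ->
    (forall phi, D phi ->
      cLfun2 (distribution P Y) (A phi) /\
      forall chi, D chi ->
        ((alpha n)%:C * cintegral P (fun w => (phi (Yn n w) - phi (Y w)) *
                                             (chi (Yn n w) - chi (Y w)))
           : (R[i] : numFieldType))
          @[n --> \oo] -->
        (- 2 * cintegral (distribution P Y) (fun y => A phi y * chi y)
           : (R[i] : numFieldType))) ->
    let q := BForm (real_part D) (limit_form P Y Yn alpha) in
    (* (a) *)
    [/\ forall phi chi, D phi -> D chi ->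
          cvg (capprox_form P Y Yn alpha n phi chi @[n --> \oo]),
        sym_bilinear_on (distribution P Y) D (climit_form P Y Yn alpha) /\
        (forall f g, real_part D f -> real_part D g ->
           climit_form P Y Yn alpha (complexify f) (complexify g) =
           (limit_form P Y Yn alpha f g)%:C),
        positive_form (distribution P Y) q,
        closable (distribution P Y) q &
    exists2 EE : bform E R,
      smallest_closed_extension (distribution P Y) q EE &
    [/\ (* (b) *) dirichlet_form (distribution P Y) EE,
        (* (c) *)
        exists2 G : (E -> R) -> (E -> R) -> E -> R,
          square_field_operator (distribution P Y) EE G &
          forall phi chi, D phi -> D chi ->
            (cextension G phi phi =
               (fun y => A (phi \* phi) y - 2 * phi y * A phi y)
               %[ae (distribution P Y)]) /\
            ((alpha n)%:C *
             cintegral P (fun w => (phi (Yn n w) - phi (Y w)) ^+ 2 *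
                                   ((chi (Yn n w) + chi (Y w)) / 2))
               : (R[i] : numFieldType))
              @[n --> \oo] -->
            (cintegral (distribution P Y)
               (fun y => cextension G phi phi y * chi y)
               : (R[i] : numFieldType)) &
        (* (d) *)
        local_form EE <->
        forall phi, D phi ->
          ((alpha n)%:C * cintegral P (fun w => (phi (Yn n w) - phi (Y w)) ^+ 4)
             : (R[i] : numFieldType))
            @[n --> \oo] --> (0 : (R[i] : numFieldType))]]).
Proof.
split.
- move=> D A DA Dm Dd HA q; set mu := distribution P Y in Dd HA *.
  have qP := limit_form_positive alpha_gt0 DA Dm HA.
  have qC := limit_form_closable alpha_gt0 DA Dm HA.
  have [EE EEs EEcore] := closable_closure qP qC.
  have [EEc EEx _] := EEs.
  split; [|exact: qP|exact: qC|].
    by move=> phi chi Dp Dc; apply/cvg_ex; eexists; exact: (approx_form_cvg HA Dp Dc).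
  exists EE => //; split.
  + exact: (EE_dirichlet alpha_gt0 DA Dm Dd HA EEc EEx EEcore).
  + exists (gamma mu D A EE).
      exact: (EE_square_field alpha_gt0 DA Dm Dd HA EEc EEx EEcore).
    move=> phi chi Dp Dc; split.
      apply: filterS (gamma_gam alpha_gt0 DA Dm Dd HA EEc EEx EEcore Dp Dp).
      by move=> y /= /[apply] ->; rewrite /gam /=; ring.
    have := expect_gamma alpha_gt0 DA Dm Dd HA EEc EEx EEcore Dc Dp Dp.
    exact.
  + exact: (local_formP alpha_gt0 DA Dm Dd HA EEc EEx EEcore).
- move=> D A DA DJ Dm Dd HA q; set mu := distribution P Y in Dd HA *.
  have RA := real_part_algebra DA.
  have Rm := real_part_measurable Dm.
  have Rd := real_part_dense DA DJ Dm Dd.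
  have RG := generator_reP HA.
  have qP := limit_form_positive alpha_gt0 RA Rm RG.
  have qC := limit_form_closable alpha_gt0 RA Rm RG.
  have [EE EEs EEcore] := closable_closure qP qC.
  have [EEc EEx _] := EEs.
  split; [| |exact: qP|exact: qC|].
  + move=> phi chi Dp Dc; apply/cvg_ex; eexists.
    exact: (capprox_form_cvg DA DJ Dm HA Dp Dc).
  + split; first exact: (climit_form_bilinear alpha_gt0 DA DJ Dm HA).
    exact: (climit_form_real alpha_gt0 DA DJ Dm HA).
  exists EE => //; split.
  + exact: (EE_dirichlet alpha_gt0 RA Rm Rd RG EEc EEx EEcore).
  + exists (gamma mu (real_part D) (generator_re A) EE).
      exact: (EE_square_field alpha_gt0 RA Rm Rd RG EEc EEx EEcore).
    move=> phi chi Dp Dc; split.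
      exact: (cextension_generator alpha_gt0 DA DJ Dm Dd HA EEc EEx EEcore Dp).
    exact: (cextension_limit alpha_gt0 DA DJ Dm Dd HA EEc EEx EEcore Dp Dc).
  + rewrite (local_formP alpha_gt0 RA Rm Rd RG EEc EEx EEcore).
    exact: (complex_fourth_moment Y Yn alpha_gt0 DA DJ Dm).
Qed.
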